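(* Let $(W,S)$ be a right-angled, irreducible Coxeter system with $3\leq|S|<\infty$. Then there exists an open neighborhood $\mathcal U\subseteq\mathbb{R}_{>0}^{(W,S)}$ of $1=(1)_{s\in S}$ such that for all $q\in\mathcal U$ the C$^\ast$-algebra $C_{r,q}^\ast(W)$ is simple and has unique tracial state.
   Context: A Coxeter system $(W,S)$ is a group $W$ generated by $S$ with relations $(st)^{m_{s,t}}=1$, $m_{s,s}=1$, $m_{s,t}=m_{t,s}\in\{2,3,\dots,\infty\}$ for $s\neq t$ ($\infty$ meaning no relation). Its Coxeter diagram has vertex set $S$ and edges $(s,t)$ with $m_{s,t}\geq 3$; $(W,S)$ is irreducible if the diagram is connected, and right-angled if $m_{s,t}\in\{1,2,\infty\}$ for all $s,t$. $|\cdot|$ is the word length with respect to $S$. $\mathbb{R}_{>0}^{(W,S)}$ is the set of tuples $(q_s)_{s\in S}$ of positive reals with $q_s=q_t$ whenever $s,t$ are conjugate in $W$. Put $p_s(q)=q_s^{-1/2}(q_s-1)$. On $\ell^2(W)$ with orthonormal basis $(\delta_{\mathbf w})_{\mathbf w\in W}$ let $T_s^{(q)}\delta_{\mathbf w}=\delta_{s\mathbf w}$ if $|s\mathbf w|>|\mathbf w|$ and $T_s^{(q)}\delta_{\mathbf w}=\delta_{s\mathbf w}+p_s(q)\delta_{\mathbf w}$ if $|s\mathbf w|<|\mathbf w|$. The reduced Hecke C$^\ast$-algebra $C_{r,q}^\ast(W)$ is the unital C$^\ast$-subalgebra of $\mathcal B(\ell^2(W))$ generated by $T_s^{(q)}$,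 $s\in S$. A C$^\ast$-algebra is simple if it has no non-trivial closed two-sided ideal. *)

(* Defs.v *)
From HB Require Import structures.
From mathcomp Require Import all_boot all_order all_algebra.
From mathcomp Require Import finmap complex.
From mathcomp Require Import all_classical all_reals all_analysis.
From mathcomp Require Import showcase.summability ring.

Set Implicit Arguments.
Unset Strict Implicit.
Unset Printing Implicit Defensive.

Import Order.TTheory GRing.Theory Num.Theory.
Import numFieldNormedType.Exports.
Import ComplexField.Normc.

Local Open Scope classical_set_scope.
Local Open Scope ring_scope.
Local Open Scope complex_scope.

(* The generating set is given by an injective family [gen : S -> W]; the
   exponent m_{s,t} = infinity is [None]. *)

Definition coxeter_matrix (S : finType) (m : S -> S -> option nat) : Prop :=
  [/\ forall s, m s s = Some 1%N,
      forall s t, m s t = m t s &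
      forall s t k, s != t -> m s t = Some k -> (2 <= k)%N].

Definition coxeter_relations (S : finType) (m : S -> S -> option nat)
    (G : groupType) (f : S -> G) : Prop :=
  forall s t k, m s t = Some k -> ((f s * f t) ^+ k = 1)%g.

Definition word_prod (S : Type) (W : groupType) (gen : S -> W) (r : seq S) : W :=
  (\prod_(s <- r) gen s)%g.

(* [W] is the group presented by the generators [S] and the Coxeter relations.
   Words without inverses suffice for generation because m_{s,s} = 1 makes each
   generator an involution; generation also gives uniqueness of [phi]. *)
Definition coxeter_system (W : groupType) (S : finType) (gen : S -> W)
    (m : S -> S -> option nat) : Prop :=
  [/\ coxeter_matrix m,
      injective gen,
      forall w : W, exists r : seq S, word_prod gen r = w,
      coxeter_relations m gen &
      forall (G : groupType) (f : S -> G), coxeter_relations m f ->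
        exists phi : {multiplicative W -> G}, forall s, phi (gen s) = f s].

Definition coxeter_edge (S : finType) (m : S -> S -> option nat) : rel S :=
  fun s t => if m s t is Some k then (3 <= k)%N else true.

Definition coxeter_irreducible (S : finType) (m : S -> S -> option nat) : Prop :=
  forall s t, connect (coxeter_edge m) s t.

Definition right_angled (S : finType) (m : S -> S -> option nat) : Prop :=
  forall s t, [\/ m s t = Some 1%N, m s t = Some 2%N | m s t = None].

(* [get] picks the unique element of a nonempty subsingleton. *)
Definition word_length (W : groupType) (S : finType) (gen : S -> W) (w : W) : nat :=
  get [set n | (exists2 r : seq S, size r = n & word_prod gen r = w) /\
               (forall r : seq S, word_prod gen r = w -> (n <= size r)%N)].

Definition hecke_params (R : realType) (W : groupType) (S : finType)
    (gen : S -> W) : set {ptws S -> R} :=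
  [set q | (forall s, 0 < q s) /\
           (forall s t, (exists w : W, gen t = (gen s ^ w)%g) -> q s = q t)].

Section L2.
Variables (R : realType) (W : choiceType).

Definition l2sqnorm (f : W -> R[i]) : \bar R :=
  (\esum_(w in [set: W]) ((normc (f w)) ^+ 2)%:E)%E.

Definition l2_pred : {pred W -> (R[i])^o} := [pred f | `[< (l2sqnorm f < +oo)%E >]].

Lemma l2_predP (f : W -> R[i]) : reflect (l2sqnorm f < +oo)%E (f \in l2_pred).
Proof. exact: asboolP. Qed.

Lemma l2sqnorm_ge0 f : (0 <= l2sqnorm f)%E.
Proof. by apply: esum_ge0 => w _; rewrite lee_fin sqr_ge0. Qed.

Lemma esumZ_le (c : R) (F : W -> \bar R) :
  0 <= c -> (forall w, (0 <= F w)%E) ->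
  (\esum_(w in [set: W]) (c%:E * F w) <= c%:E * \esum_(w in [set: W]) F w)%E.
Proof.
move=> c0 F0; apply: ge_ereal_sup => _ [X [finX XI]] <-.
rewrite -ge0_mule_fsumr//; apply: lee_wpmul2l; first by rewrite lee_fin.
by apply: esum_ge; exists X.
Qed.

Lemma l2sqnorm_le (h f g : W -> R[i]) (a b : R) :
  0 <= a -> 0 <= b ->
  (forall w, normc (h w) ^+ 2 <= a * normc (f w) ^+ 2 + b * normc (g w) ^+ 2) ->
  (l2sqnorm h <= a%:E * l2sqnorm f + b%:E * l2sqnorm g)%E.
Proof.
move=> a0 b0 hfg; rewrite /l2sqnorm.
pose F (u : W -> R[i]) w := (normc (u w) ^+ 2)%:E.
have F0 u w : (0 <= F u w)%E by rewrite lee_fin sqr_ge0.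
apply: (@le_trans _ _ (\esum_(w in [set: W]) (a%:E * F f w + b%:E * F g w))%E).
  by apply: le_esum => w _; rewrite /F -!EFinM -EFinD lee_fin.
rewrite esumD => [|w _|w _]; last 2 first.
- by rewrite mule_ge0// lee_fin.
- by rewrite mule_ge0// lee_fin.
by apply: leeD; exact: esumZ_le.
Qed.

Lemma normcZD_le (a x y : R[i]) :
  normc (a * x + y) ^+ 2 <= 2 * normc a ^+ 2 * normc x ^+ 2 + 2 * normc y ^+ 2.
Proof.
have nn (z : R[i]) : 0 <= normc z by case: z => u v; exact: sqrtr_ge0.
have := le_normcD (a * x) y; rewrite normcM => h.
apply: (@le_trans _ _ ((normc a * normc x + normc y) ^+ 2)).
  by rewrite lerXn2r// nnegrE ?addr_ge0 ?mulr_ge0 ?nn.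
rewrite -subr_ge0 (_ : _ - _ = (normc a * normc x - normc y) ^+ 2) ?sqr_ge0//.
by ring.
Qed.

Lemma l2_submod_closed : submod_closed l2_pred.
Proof.
split=> [|a f g].
  apply/l2_predP; rewrite /l2sqnorm esum1 ?ltry// => w _.
  by congr EFin; rewrite [X in X ^+ 2]normc0 expr0n.
move=> /l2_predP f2 /l2_predP g2; apply/l2_predP.
apply: le_lt_trans (l2sqnorm_le (f := f) (g := g) (a := 2 * normc a ^+ 2)
  (b := 2) _ _ _) _.
- by rewrite mulr_ge0// sqr_ge0.
- by [].
- by move=> w; exact: normcZD_le.
by apply: lte_add_pinfty; apply: lte_mul_pinfty; rewrite ?lee_fin ?ler0n//
  mulr_ge0// sqr_ge0.
Qed.

HB.instance Definition _ := GRing.isSubmodClosed.Build _ _ l2_pred l2_submod_closed.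

Record l2 := L2 { l2fun :> W -> (R[i])^o ; _ : l2fun \in l2_pred }.

HB.instance Definition _ := [isSub for l2fun].
HB.instance Definition _ := [Choice of l2 by <:].
HB.instance Definition _ := [SubChoice_isSubLmodule of l2 by <:].

Definition l2norm (f : l2) : R := Num.sqrt (fine (l2sqnorm f)).

(* Unconditional sum: the limit of partial sums along finite subsets of [W]. *)
Definition l2inner (f g : l2) : R[i] :=
  summability.sum (fun w => f w * (g w)^* : (R[i])^o).

Lemma l2delta_subproof (w : W) :
  (fun v => (v == w)%:R : (R[i])^o) \in l2_pred.
Proof.
apply/l2_predP; rewrite /l2sqnorm.
rewrite (esumID [set w]) => [|v _]; last by rewrite lee_fin sqr_ge0.
rewrite setTI [X in (_ + X)%E]esum1 => [|v [_ /= /eqP/negPf ->]]; last first.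
  by rewrite normc0 expr0n.
by rewrite adde0 esum_set1 ?ltry// lee_fin sqr_ge0.
Qed.

Definition l2delta (w : W) : l2 := L2 (l2delta_subproof w).

End L2.

Section Operators.
Variables (R : realType) (W : choiceType).
Local Notation H := (l2 R W).
Local Notation op := (H -> H).

Definition bounded_op (T : op) : Prop :=
  linear T /\ exists M : R, forall f, l2norm (T f) <= M * l2norm f.

Definition opnorm (T : op) : R :=
  sup [set l2norm (T f) | f in [set f : H | l2norm f <= 1]].

Definition is_adjoint (T T' : op) : Prop :=
  forall f g, l2inner (T f) g = l2inner f (T' g).

(* Membership in the operator-norm closure of [A], for bounded [T] and [A]. *)
Definition op_closure (A : set op) : set op :=
  [set T | forall e : R, 0 < e -> exists2 T', A T' & opnorm (T - T') < e].

Record unital_cstar_subalgebra (A : set op) : Prop := UnitalCstarSubalgebra {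
  cstar_bounded : A `<=` bounded_op ;
  cstar_unit : A idfun ;
  cstar_lin : forall (a : R[i]) (T U : op), A T -> A U -> A (a *: T + U) ;
  cstar_mul : forall T U : op, A T -> A U -> A (T \o U) ;
  cstar_adj : forall T T' : op, A T -> bounded_op T' -> is_adjoint T T' -> A T' ;
  cstar_closed : forall T : op, bounded_op T -> op_closure A T -> A T }.

Definition cstar_generated (G : set op) : set op :=
  [set T | forall A, unital_cstar_subalgebra A -> G `<=` A -> A T].

Record closed_ideal (A I : set op) : Prop := ClosedIdeal {
  ideal_sub : I `<=` A ;
  ideal_zero : I 0 ;
  ideal_lin : forall (a : R[i]) (T U : op), I T -> I U -> I (a *: T + U) ;
  ideal_mull : forall T U : op, A T -> I U -> I (T \o U) ;
  ideal_mulr : forall T U : op, I T -> A U -> I (T \o U) ;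
  ideal_closed : forall T : op, A T -> op_closure I T -> I T }.

Definition simple_cstar (A : set op) : Prop :=
  forall I, closed_ideal A I -> I = [set 0] \/ I = A.

(* Functionals on [A] are represented by functions on all operators, of which
   only the values on [A] matter. *)
Record tracial_state (A : set op) (tau : op -> R[i]) : Prop := TracialState {
  state_lin : forall (a : R[i]) (T U : op), A T -> A U ->
    tau (a *: T + U) = a * tau T + tau U ;
  state_pos : forall T T' : op, A T -> A T' -> is_adjoint T T' ->
    0 <= tau (T' \o T) ;
  state_unit : tau idfun = 1 ;
  state_trace : forall T U : op, A T -> A U -> tau (T \o U) = tau (U \o T) }.

Definition unique_tracial_state (A : set op) : Prop :=
  (exists tau, tracial_state A tau) /\
  (forall tau tau', tracial_state A tau -> tracial_state A tau' ->
     forall T, A T -> tau T = tau' T).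

End Operators.

Section Hecke.
Variables (R : realType) (W : groupType) (S : finType) (gen : S -> W).
Local Notation H := (l2 R W).
Local Notation len := (word_length gen).

Definition hecke_p (q : S -> R) (s : S) : R := (Num.sqrt (q s))^-1 * (q s - 1).

(* [T] is the operator T_s^(q), prescribed on the orthonormal basis. *)
Definition is_hecke_op (q : S -> R) (s : S) (T : H -> H) : Prop :=
  bounded_op T /\
  forall w : W,
    ((len w < len (gen s * w)%g)%N ->
       T (l2delta R w) = l2delta R (gen s * w)%g) /\
    ((len (gen s * w)%g < len w)%N ->
       T (l2delta R w) = l2delta R (gen s * w)%g + (hecke_p q s)%:C *: l2delta R w).

Definition hecke_cstar (q : S -> R) : set (H -> H) :=
  cstar_generated [set T | exists s, is_hecke_op q s T].

(* Such an operator exists: it is given in coordinates by [hecke_fun]. *)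
Section Existence.
Hypothesis gen2 : forall s, (gen s * gen s)%g = 1%g.
Variables (q : S -> R) (s : S).

Definition hecke_coef (v : W) : R[i] :=
  (if (len (gen s * v)%g < len v)%N then hecke_p q s else 0)%:C.

Definition hecke_fun (f : W -> R[i]) : W -> (R[i])^o :=
  fun v => hecke_coef v * f v + f (gen s * v)%g.

Lemma l2sqnorm_translate (f : W -> R[i]) :
  l2sqnorm (fun v => f (gen s * v)%g) = l2sqnorm f.
Proof.
apply/esym; apply: (@reindex_esum _ _ _ _ _ (fun v => gen s * v)%g
  (fun w => (normc (f w) ^+ 2)%:E)) => //.
split=> //= [x y _ _|w _]; first exact: mulgI.
by exists (gen s * w)%g => //; rewrite mulgA gen2 mul1g.
Qed.

Lemma hecke_fun_le (f : W -> R[i]) :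
  (l2sqnorm (hecke_fun f) <= (2 * hecke_p q s ^+ 2 + 2)%:E * l2sqnorm f)%E.
Proof.
have p0 : 0 <= 2 * hecke_p q s ^+ 2 by rewrite mulr_ge0// sqr_ge0.
rewrite EFinD ge0_muleDl ?lee_fin//.
rewrite -[X in (_ + _ * X)%E]l2sqnorm_translate.
apply: l2sqnorm_le => // v.
apply: le_trans (normcZD_le _ _ _) _; rewrite lerD2r.
apply: ler_wpM2r; first exact: sqr_ge0.
rewrite ler_wpM2l// /hecke_coef /= expr0n addr0 sqr_sqrtr ?sqr_ge0//.
by case: ifP => // _; rewrite expr0n sqr_ge0.
Qed.

Lemma hecke_fun_l2 (f : H) : hecke_fun f \in @l2_pred R W.
Proof.
apply/l2_predP; apply: le_lt_trans (hecke_fun_le f) _.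
have /l2_predP f2 := valP f.
by rewrite lte_mul_pinfty// lee_fin addr_ge0// mulr_ge0// sqr_ge0.
Qed.

Definition hecke_op (f : H) : H := L2 (hecke_fun_l2 f).

Lemma hecke_opP : is_hecke_op q s hecke_op.
Proof.
split; first split.
- move=> a f g; apply/val_inj/funext => v /=.
  rewrite /hecke_fun.
  change (hecke_coef v * (a * f v + g v) +
    (a * f (gen s * v)%g + g (gen s * v)%g) =
    a * (hecke_coef v * f v + f (gen s * v)%g) +
    (hecke_coef v * g v + g (gen s * v)%g)).
  by ring.
- exists (Num.sqrt (2 * hecke_p q s ^+ 2 + 2)) => f.
  have K0 : 0 <= 2 * hecke_p q s ^+ 2 + 2.
    by rewrite addr_ge0// mulr_ge0// sqr_ge0.
  rewrite /l2norm -sqrtrM// ler_wsqrtr//.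
  have fin (g : H) : (l2sqnorm g \is a fin_num)%E.
    have /l2_predP g2 := valP g.
    by rewrite ge0_fin_numE// l2sqnorm_ge0.
  by rewrite -lee_fin EFinM !fineK//; exact: hecke_fun_le.
have eqs v w : (gen s * v == w)%g = (v == gen s * w)%g.
  by apply/eqP/eqP => [<-|->]; rewrite mulgA gen2 mul1g.
move=> w; split=> ww; apply/val_inj/funext => v.
  change (hecke_coef v * (v == w)%:R + (gen s * v == w)%g%:R =
    (v == gen s * w)%g%:R :> R[i]).
  rewrite eqs /hecke_coef; case: (eqVneq v w) => [->|_]; last by rewrite mulr0 add0r.
  by rewrite ltnNge ltnW// mul0r add0r.
change (hecke_coef v * (v == w)%:R + (gen s * v == w)%g%:R =
  (v == gen s * w)%g%:R + (hecke_p q s)%:C * (v == w)%:R :> R[i]).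
rewrite eqs addrC /hecke_coef; case: (eqVneq v w) => [->|_]; last by rewrite !mulr0.
by rewrite ww.
Qed.

End Existence.

Lemma is_hecke_op_exists (m : S -> S -> option nat) :
  coxeter_system gen m -> forall q s, exists T, is_hecke_op q s T.
Proof.
move=> [[m1 _ _] _ _ rel _] q s.
have gen2 t : (gen t * gen t)%g = 1%g by exact: (rel t t 1%N (m1 t)).
by exists (hecke_op gen2 q s); exact: hecke_opP.
Qed.

End Hecke.

(* Main.v *)
Require Import Defs.
From HB Require Import structures.
From mathcomp Require Import all_boot all_order all_algebra.
From mathcomp Require Import finmap complex.
From mathcomp Require Import all_classical all_reals all_analysis.
From mathcomp Require Import showcase.summability ring lra zify.

Set Implicit Arguments.
Unset Strict Implicit.
Unset Printing Implicit Defensive.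

Import Order.TTheory GRing.Theory Num.Theory.
Import numFieldNormedType.Exports.

Local Open Scope classical_set_scope.
Local Open Scope ring_scope.

(** Simplicity and uniqueness of the trace follow from an averaging argument in
    the spirit of Powers. Let [trace0 T] be the coefficient of [T (delta 1)] at 1.
    It suffices to find a convex combination [avg] of conjugations by unitaries of
    the algebra such that [avg^k T] tends in norm to the scalar [trace0 T] for
    every [T]. Indeed ideals are stable under [avg], so a nonzero ideal, after
    multiplying one of its elements by a suitable operator, contains a nonzero
    scalar ([hecke_cstar_simple]); and a tracial state is invariant under [avg],
    and bounded because [1 - T] is a square for small self-adjoint [T]
    ([state_bound]), so it equals [trace0] ([trace_unique]).

    The unitaries are products of the normalized operators [2 T_s - p_s], whose
    squares are scalars ([YY]). The right Hecke operators commute with the algebra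
    and have [delta 1] as cyclic vector, so an operator is determined by its
    value at [delta 1], and conjugation by such a unitary becomes a unitary
    operator on vectors, close to the permutation of coordinates by conjugation
    in [W] when [p_s] is small ([conj_perm_dist]).

    For these permutations there is a spectral gap on vectors vanishing at 1
    ([perm_gap]). It rests on the combinatorics of [W]: conjugation by a long walk
    in the non-commutation graph, visiting all generators, sends every nontrivial
    element that does not start with the last letter of the walk to an element
    starting with its first two letters ([conj_walk_desc]). Irreducibility gives
    such walks, and three generators are enough to choose three disjoint targets
    ([spreading]); a paradoxical decomposition of this kind is what the infinite
    dihedral group lacks. The gap is an open condition, hence persists for [q] near 1
    ([conj_gap]), and makes [avg] contract the vectors [T (delta 1)] of trace 0.

    The passage from vectors to operator norms is Haagerup's inequality
    ([rapid_decay]): the norm of a polynomial [T] of degree [d] in the Hecke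
    operators is at most a polynomial in [d] times the norm of [T (delta 1)]. As
    [avg] raises the degree by a constant, exponential decay wins
    ([averages_vanish]). The inequality holds because the contributions to a
    product of two elements are described by factorizations [x = v g a],
    [u = v g w], and prefixes are determined by their letter counts
    ([prefix_uniq]), of which there are polynomially many. *)

(** * Elementary inequalities *)

Section RealInequalities.
Variable R : realType.
Implicit Types x y z t F A B : R.

Lemma young_sqr x y : (x + y) ^+ 2 <= 5 / 4 * x ^+ 2 + 5 * y ^+ 2.
Proof.
have : 0 <= (x - 4 * y) ^+ 2 := sqr_ge0 _.
have -> : (x - 4 * y) ^+ 2 = x ^+ 2 - 8 * (x * y) + 16 * y ^+ 2 by ring.
have -> : (x + y) ^+ 2 = x ^+ 2 + 2 * (x * y) + y ^+ 2 by ring.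
lra.
Qed.

Lemma sqr_le_split x y z : 0 <= x -> 0 <= y -> 0 <= z -> y <= 16^-1 * x + z ->
  y ^+ 2 <= 2 * z ^+ 2 + 2 / 256 * x ^+ 2.
Proof.
move=> x0 y0 z0 yz; apply: (@le_trans _ _ ((16^-1 * x + z) ^+ 2)).
  by rewrite lerXn2r// nnegrE ?addr_ge0// mulr_ge0.
have : 0 <= (16^-1 * x - z) ^+ 2 := sqr_ge0 _.
have -> : (16^-1 * x - z) ^+ 2 = 256^-1 * x ^+ 2 - 16^-1 * 2 * (x * z) + z ^+ 2 by field.
have -> : (16^-1 * x + z) ^+ 2 = 256^-1 * x ^+ 2 + 16^-1 * 2 * (x * z) + z ^+ 2 by field.
lra.
Qed.

Lemma cubic_bound t : 0 <= t -> t <= 1 -> 2 * t ^+ 2 + 4 * t <= (4 + t ^+ 2) * (2 * t).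
Proof.
move=> t0 t1; have -> : (4 + t ^+ 2) * (2 * t) = 8 * t + 2 * t ^+ 3 by ring.
have h2 : t ^+ 2 <= t by rewrite expr2 -[leRHS]mulr1 ler_wpM2l.
have h3 : 0 <= t ^+ 3 by rewrite exprn_ge0.
lra.
Qed.

Lemma gap_arith F A B x y : F <= A + B -> 3 * A <= 5 / 4 * F + 5 * x ->
  3 * B <= 5 / 4 * F + 5 * y -> F <= 10 * (x + y).
Proof. lra. Qed.

Lemma gap_arith2 F A B : 0 <= F -> F <= 10 * A -> A <= 2 * B + 6 * (2 / 256 * F) -> F <= 40 * B.
Proof. lra. Qed.

Lemma sum_six_le (F G : bool * 'I_3 -> R) (c : R) :
  (forall j, F j <= 2 * G j + c) -> \sum_j F j <= 2 * \sum_j G j + 6 * c.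
Proof.
move=> FG; apply: le_trans (ler_sum _ (fun j _ => FG j)) _.
rewrite big_split -mulr_sumr lerD2l sumr_const card_prod card_bool card_ord.
by rewrite mulr_natl.
Qed.

(** Induction on [(l + (1 - x)^-1) * x ^+ l]: the shift by [(1 - x)^-1] makes
    this sequence nonincreasing. *)
Lemma ratio_decay x l : 0 < x -> x < 1 -> (l.+1)%:R * x ^+ l <= (1 - x)^-1.
Proof.
move=> x0 x1; have d0 : 0 < 1 - x by rewrite subr_gt0.
set D := (1 - x)^-1.
have D1 : D * (1 - x) = 1 by rewrite mulVf// gt_eqF.
have D0 : 0 < D by rewrite invr_gt0.
have l1 : 1 <= D by rewrite -D1 ler_piMr ?(ltW D0)// gerBl ltW.
suff h : (l%:R + D) * x ^+ l <= D.
  by apply: le_trans h; rewrite ler_wpM2r ?exprn_ge0 ?(ltW x0)// -natr1 lerD2l.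
elim: l => [|l IH]; first by rewrite add0r expr0 mulr1.
apply: le_trans IH; rewrite exprS mulrA ler_wpM2r ?exprn_ge0 ?(ltW x0)//.
rewrite -natr1 -subr_ge0.
have -> : l%:R + D - (l%:R + 1 + D) * x = l%:R * (1 - x) + (D * (1 - x) - x) by ring.
by rewrite D1 addr_ge0 ?mulr_ge0 ?(ltW d0).
Qed.

Lemma poly_geometric (m c : nat) x (B e : R) : 0 < x -> x < 1 -> 0 <= B -> 0 < e ->
  exists k, ((c * k.+1) ^ m)%:R * x ^+ k * B <= e.
Proof.
move=> x0 x1 B0 e0; have d0 : 0 < 1 - x by rewrite subr_gt0.
pose D : R := (c.+1 * (2 * m.+1))%:R * (1 - x)^-1.
have D0 : 0 < D by rewrite mulr_gt0 ?invr_gt0// ltr0n.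
pose u := Num.min 1 (e / (B + 1)).
have B1 : 0 < B + 1 by rewrite ltr_wpDl.
have u0 : 0 < u by rewrite lt_min ltr01 divr_gt0.
have [l lD] : exists l, D * x ^+ l <= u.
  pose y := D * (1 - x)^-1 / u.
  exists (Num.trunc y); have ly := truncnS_gt y.
  have h := ratio_decay (Num.trunc y) x0 x1.
  have n0 : 0 < (Num.trunc y).+1%:R :> R by rewrite ltr0n.
  apply: (@le_trans _ _ (D * ((1 - x)^-1 / (Num.trunc y).+1%:R))).
    by rewrite ler_wpM2l ?(ltW D0)// ler_pdivlMr// mulrC.
  by rewrite mulrA ler_pdivrMr// [leRHS]mulrC -ler_pdivrMr//; exact: ltW.
(* As a multiple of [2 * m.+1] the exponent splits off an [m.+1]-st power, and
   within it one factor [x ^+ l] absorbs [l.+1] and the other is small. *)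
exists (m.+1 * (2 * l))%N.
have k_le : (c * (m.+1 * (2 * l)).+1 <= c.+1 * (2 * m.+1) * l.+1)%N by nia.
apply: (@le_trans _ _ (u ^+ m.+1 * B)).
  apply: ler_wpM2r => //.
  apply: (@le_trans _ _ (((c.+1 * (2 * m.+1) * l.+1)%:R * (x ^+ l * x ^+ l)) ^+ m.+1)).
    rewrite exprMn -exprD addnn -mul2n -exprM [(2 * l * _)%N]mulnC ler_wpM2r ?exprn_ge0 ?(ltW x0)//.
    rewrite -natrX ler_nat (@leq_trans ((c.+1 * (2 * m.+1) * l.+1) ^ m)%N)//.
      by case: (m) k_le => // m' kl; rewrite leq_exp2r.
    by rewrite leq_pexp2l.
  rewrite lerXn2r ?nnegrE ?mulr_ge0 ?exprn_ge0 ?(ltW x0) ?(ltW u0)//.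
  apply: le_trans lD; rewrite natrM mulrA -[_ * l.+1%:R * _]mulrA.
  by rewrite ler_wpM2r ?exprn_ge0 ?(ltW x0)// /D ler_wpM2l// ratio_decay.
have u1 : u <= 1 by rewrite ge_min lexx.
apply: (@le_trans _ _ (u * B)).
  by rewrite ler_wpM2r// exprS ler_piMr ?(ltW u0)// exprn_ile1// (ltW u0).
apply: (@le_trans _ _ (e / (B + 1) * B)); first by rewrite ler_wpM2r// ge_min lexx orbT.
by rewrite mulrAC ler_pdivrMr// ler_wpM2l ?(ltW e0)// lerDl.
Qed.

Lemma mulr_sumr_six x : \sum_(j : bool * 'I_3) x = 6 * x.
Proof. by rewrite sumr_const card_prod card_bool card_ord mulr_natl. Qed.

(** The contraction factor of one averaging step on squared norms: [40] is the
    constant of [conj_gap] and [24 = 6 * 4] comes from averaging six vectors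
    [f + u f]. *)
Definition rate : R := 1 - (24 * 40)^-1.

Lemma rate_gt0 : 0 < rate.
Proof. by rewrite subr_gt0 invf_lt1// ?mulr_gt0// -natrM ltr1n. Qed.

Lemma rate_lt1 : rate < 1.
Proof. by rewrite gtrBl invr_gt0 mulr_gt0. Qed.

Lemma avg_arith x y z : x <= 40 * y -> z <= 6 * (6 * (4 * x) - y) -> 12^-1 ^+ 2 * z <= rate * x.
Proof.
move=> xy zx; apply: (@le_trans _ _ (12^-1 ^+ 2 * (6 * (6 * (4 * x) - y)))).
  by rewrite ler_wpM2l ?sqr_ge0.
have -> : 12^-1 ^+ 2 * (6 * (6 * (4 * x) - y)) = x - 24^-1 * y by field.
by rewrite /rate mulrBl mul1r lerD2l lerN2 invfM -mulrA ler_wpM2l ?invr_ge0// ler_pdivrMl.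
Qed.

End RealInequalities.

Import ComplexField.Normc.
Local Open Scope complex_scope.
Local Open Scope ring_scope.

(** * Square-summable families *)
Section L2Theory.
Variables (R : realType) (W : choiceType).
Local Notation C := R[i].
Local Notation H := (l2 R W).
Local Notation cRe := (@complex.Re R).
Local Notation cIm := (@complex.Im R).
Implicit Types (f g h : H) (a z : C).

Lemma normc_ge0 z : 0 <= normc z. Proof. by case: z => u v; exact: sqrtr_ge0. Qed.

Lemma sqr_normcE z : normc z ^+ 2 = cRe z ^+ 2 + cIm z ^+ 2.
Proof. by case: z => u v /=; rewrite sqr_sqrtr// addr_ge0 ?sqr_ge0. Qed.

Lemma conjE (u v : R) : (u +i* v)^* = u -i* v :> C.
Proof. by []. Qed.

Lemma realcM (x y : R) : (x * y)%:C = x%:C * y%:C :> C.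
Proof. exact: (rmorphM (real_complex R)). Qed.
Lemma realcD (x y : R) : (x + y)%:C = x%:C + y%:C :> C.
Proof. exact: (rmorphD (real_complex R)). Qed.
Lemma realcV (x : R) : (x^-1)%:C = (x%:C)^-1 :> C.
Proof. exact: (fmorphV (real_complex R)). Qed.

Lemma mul_conjc z : z * z^* = (normc z ^+ 2)%:C.
Proof.
rewrite sqr_normcE; case: z => u v; rewrite conjE; apply/eqP; rewrite eq_complex /=.
by apply/andP; split; apply/eqP; ring.
Qed.

Lemma conjc_real (r : R) : (r%:C)^* = r%:C :> C.
Proof. by rewrite conjE oppr0. Qed.

Lemma normc_conj z : normc z^* = normc z.
Proof. by case: z => u v; rewrite conjE /= sqrrN. Qed.

Lemma normc_real (r : R) : normc r%:C = `|r| :> R.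
Proof. by rewrite /= expr0n addr0 sqrtr_sqr. Qed.

Lemma normc_normr z : `|z| = (normc z)%:C. Proof. by case: z. Qed.

Lemma l2D f g w : (f + g) w = f w + g w. Proof. by []. Qed.
Lemma l2Z a f w : (a *: f) w = a * f w. Proof. by []. Qed.
Lemma l2N f w : (- f) w = - f w. Proof. by []. Qed.
Lemma l2_sum (I : Type) (r : seq I) (P : pred I) (F : I -> H) w :
  (\sum_(i <- r | P i) F i) w = \sum_(i <- r | P i) F i w.
Proof. by elim/big_rec2: _ => // i x y _ <-. Qed.
Lemma l2deltaE (v w : W) : l2delta R w v = (v == w)%:R. Proof. by []. Qed.
Lemma l2_eq f g : (forall w, f w = g w) -> f = g.
Proof. by move=> fg; apply/val_inj/funext. Qed.

Lemma l2sqnorm_fin f : (l2sqnorm f \is a fin_num)%E.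
Proof. by have /l2_predP f2 := valP f; rewrite ge0_fin_numE// l2sqnorm_ge0. Qed.

Lemma l2norm_ge0 f : 0 <= l2norm f. Proof. exact: sqrtr_ge0. Qed.

Lemma sqr_l2norm f : l2norm f ^+ 2 = fine (l2sqnorm f).
Proof. by rewrite sqr_sqrtr// fine_ge0// l2sqnorm_ge0. Qed.

Lemma sqr_l2normE f : (l2norm f ^+ 2)%:E = l2sqnorm f.
Proof. by rewrite sqr_l2norm fineK// l2sqnorm_fin. Qed.

Lemma sum_le_l2sqnorm (g : W -> C) (X : seq W) : uniq X ->
  ((\sum_(w <- X) normc (g w) ^+ 2)%:E <= l2sqnorm g)%E.
Proof.
move=> uX; apply: esum_ge; exists [set` X]; first by split.
by rewrite -fsbig_seq// sumEFin.
Qed.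

Lemma sum_le_l2norm f (X : seq W) : uniq X ->
  \sum_(w <- X) normc (f w) ^+ 2 <= l2norm f ^+ 2.
Proof. by move=> uX; rewrite -lee_fin sqr_l2normE sum_le_l2sqnorm. Qed.

Lemma l2sqnorm_le_sum (g : W -> C) (M : R) :
  (forall X : seq W, uniq X -> \sum_(w <- X) normc (g w) ^+ 2 <= M) ->
  (l2sqnorm g <= M%:E)%E.
Proof.
move=> h; apply: ge_ereal_sup => _ [X [finX _] <-].
rewrite fsbig_finite//= sumEFin lee_fin; apply: h; exact: fset_uniq.
Qed.

Lemma l2_of_sums (g : W -> C) (M : R) :
  (forall X : seq W, uniq X -> \sum_(w <- X) normc (g w) ^+ 2 <= M) ->
  exists f : H, (forall w, f w = g w) /\ l2norm f ^+ 2 <= M.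
Proof.
move=> h; have gM := l2sqnorm_le_sum h.
have gl : (g : W -> C^o) \in @l2_pred R W by apply/l2_predP/(le_lt_trans gM)/ltry.
by exists (L2 gl); split=> //; rewrite -lee_fin sqr_l2normE.
Qed.

Lemma normc_le_l2norm f w : normc (f w) <= l2norm f.
Proof.
rewrite -(@ler_pXn2r _ 2) ?nnegrE ?normc_ge0 ?l2norm_ge0//.
by have := @sum_le_l2norm f [:: w] erefl; rewrite big_seq1.
Qed.

Lemma l2norm_eq0 f : l2norm f = 0 -> f = 0.
Proof.
move=> f0; apply: l2_eq => w; apply: eq0_normc; apply/eqP.
by rewrite eq_le normc_ge0 andbT -f0 normc_le_l2norm.
Qed.

Lemma l2_partial_sums f (e : R) : 0 < e ->
  exists X : {fset W}, l2norm f ^+ 2 - e < \sum_(w <- X) normc (f w) ^+ 2.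
Proof.
move=> e0; have : ((l2norm f ^+ 2 - e)%:E < l2sqnorm f)%E.
  by rewrite -sqr_l2normE lte_fin ltrBlDr ltrDl.
move=> /ereal_sup_gt[_ [X [finX _] <-]].
rewrite fsbig_finite//= sumEFin lte_fin => h.
by exists (fset_set X).
Qed.

Lemma partial_sumE (u : W -> C^o) (A : {fset W}) :
  partial_sum u A = \sum_(w <- A) u w.
Proof. by rewrite /partial_sum big_seq_fsetE. Qed.

#[local] Existing Instance totally_filter.

Lemma sum_subseq_le (I : eqType) (X Y : seq I) (F : I -> R) : (forall i, 0 <= F i) ->
  uniq X -> {subset X <= Y} -> \sum_(i <- X) F i <= \sum_(i <- Y) F i.
Proof.
move=> F0; elim: X Y => [|w X IH] Y; first by rewrite big_nil sumr_ge0.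
move=> /= /andP[wX uX] XY; have wY : w \in Y by apply: XY; rewrite in_cons eqxx.
rewrite big_cons (perm_big _ (perm_to_rem wY)) big_cons lerD2l; apply: IH => // v vX.
have : v \in w :: rem w Y by rewrite -(perm_mem (perm_to_rem wY)) XY// in_cons vX orbT.
by rewrite in_cons => /orP[/eqP vw|//]; move: wX; rewrite -vw vX.
Qed.

Lemma cvg_sqr_normc f :
  partial_sum (fun w => (normc (f w) ^+ 2)%:C : C^o) @ totally --> ((l2norm f ^+ 2)%:C : C^o).
Proof.
apply/cvgrPdist_lt => -[e e'] /=; rewrite ltcE /= => /andP[/eqP-> e0].
have [X hX] := l2_partial_sums f e0.
exists X => // A /= XA.
rewrite partial_sumE -(rmorph_sum (real_complex R)) -rmorphB normc_normr normc_real ltcR.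
have h1 : \sum_(w <- A) normc (f w) ^+ 2 <= l2norm f ^+ 2.
  by apply: sum_le_l2norm; exact: fset_uniq.
rewrite ger0_norm ?subr_ge0// ltrBlDr -ltrBlDl.
apply: lt_le_trans hX (sum_subseq_le _ _ _) => [w||]; first exact: sqr_ge0.
  exact: fset_uniq.
exact/fsubsetP.
Qed.

(** Polarization turns the summands into squared moduli, whose unconditional sums
    are the squared norms. *)
Lemma cvg_inner f g :
  partial_sum (fun w => f w * (g w)^* : C^o) @ totally --> (l2inner f g : C^o).
Proof.
have polE : partial_sum (fun w => f w * (g w)^* : C^o) =
    (fun A => 4^-1 *: (partial_sum (fun w => (normc ((f + g) w) ^+ 2)%:C : C^o) A
      - partial_sum (fun w => (normc ((f - g) w) ^+ 2)%:C : C^o) A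
      + 'i%C *: (partial_sum (fun w => (normc ((f + 'i%C *: g) w) ^+ 2)%:C : C^o) A
      - partial_sum (fun w => (normc ((f - 'i%C *: g) w) ^+ 2)%:C : C^o) A)) : C^o).
  apply/funext => A; rewrite !partial_sumE -!sumrB scaler_sumr -big_split scaler_sumr.
  apply: eq_bigr => w _; rewrite !sqr_normcE !(l2D, l2N, l2Z).
  case: (f w) (g w) => [u v] [u' v']; rewrite conjE /=.
  rewrite /GRing.scale /=; apply: (@mulfI _ (4 : C)) => //.
  rewrite mulVKf// (_ : (4 : C) = (4 : R)%:C) ?rmorph_nat//.
  by apply/eqP; rewrite eq_complex /=; apply/andP; split; apply/eqP; ring.
rewrite /l2inner /summability.sum; apply/cvg_ex; rewrite polE.
eexists; apply: cvgZl_tmp; apply: cvgD.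
  by apply: cvgB; exact: cvg_sqr_normc.
by apply: cvgZl_tmp; apply: cvgB; exact: cvg_sqr_normc.
Qed.

Lemma inner_unique f g (l : C) :
  partial_sum (fun w => f w * (g w)^* : C^o) @ totally --> (l : C^o) -> l2inner f g = l.
Proof.
by move=> h; rewrite /l2inner /summability.sum; apply: cvg_lim h; exact: norm_hausdorff.
Qed.

Lemma innerZDl a f g h : l2inner (a *: f + g) h = a * l2inner f h + l2inner g h.
Proof.
apply: inner_unique.
have -> : partial_sum (fun w => (a *: f + g) w * (h w)^* : C^o) =
   (fun A => a *: partial_sum (fun w => f w * (h w)^* : C^o) A +
             partial_sum (fun w => g w * (h w)^* : C^o) A).
  apply/funext => A; rewrite !partial_sumE scaler_sumr -big_split.
  by apply: eq_bigr => w _; rewrite l2D l2Z mulrDl -mulrA.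
by apply: cvgD; [apply: cvgZl_tmp|]; exact: cvg_inner.
Qed.

Lemma inner_conj f g : l2inner g f = (l2inner f g)^*.
Proof.
apply: inner_unique; apply/cvgrPdist_lt => e e0.
have /cvgrPdist_lt/(_ e e0) := @cvg_inner f g.
apply: filterS => A; have -> : partial_sum (fun w => g w * (f w)^* : C^o) A =
    (partial_sum (fun w => f w * (g w)^* : C^o) A)^*.
  rewrite !partial_sumE rmorph_sum; apply: eq_bigr => w _.
  by rewrite /= rmorphM /= conjCK mulrC.
have conj_dist (x y : C) : `|x^* - y^*| = `|x - y|.
  by rewrite -rmorphB /= !normc_normr normc_conj.
by move=> h; apply: le_lt_trans h; rewrite [leLHS]conj_dist.
Qed.

Lemma inner_self f : l2inner f f = (l2norm f ^+ 2)%:C.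
Proof.
apply: inner_unique.
by under eq_fun do rewrite mul_conjc; exact: cvg_sqr_normc.
Qed.

Lemma inner_deltar f w : l2inner f (l2delta R w) = f w.
Proof.
apply: inner_unique; apply/cvgrPdist_lt => e e0.
exists [fset w]%fset => // A /= /fsubsetP/(_ w); rewrite inE eqxx => /(_ isT) wA.
rewrite partial_sumE (bigD1_seq w) ?fset_uniq//=.
rewrite eqxx conjC1 mulr1 big1 ?addr0 ?subrr ?normr0// => v /negPf vw.
by rewrite vw conjC0 mulr0.
Qed.

Lemma innerDl f g h : l2inner (f + g) h = l2inner f h + l2inner g h.
Proof. by rewrite -[f]scale1r innerZDl mul1r scale1r. Qed.
Lemma inner0l h : l2inner 0 h = 0.
Proof. by have := innerDl 0 0 h; rewrite addr0 => /eqP; rewrite addrC -subr_eq subrr eq_sym => /eqP. Qed.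
Lemma innerZl a f h : l2inner (a *: f) h = a * l2inner f h.
Proof. by rewrite -[_ *: _]addr0 innerZDl inner0l addr0. Qed.
Lemma innerNl f h : l2inner (- f) h = - l2inner f h.
Proof. by rewrite -scaleN1r innerZl mulN1r. Qed.
Lemma innerDr f g h : l2inner h (f + g) = l2inner h f + l2inner h g.
Proof. by rewrite inner_conj innerDl rmorphD /= -!inner_conj. Qed.
Lemma innerZr a f h : l2inner h (a *: f) = a^* * l2inner h f.
Proof. by rewrite inner_conj innerZl rmorphM /= -inner_conj. Qed.
Lemma innerNr f h : l2inner h (- f) = - l2inner h f.
Proof. by rewrite inner_conj innerNl rmorphN /= -inner_conj. Qed.
Lemma inner0r h : l2inner h 0 = 0.
Proof. by rewrite inner_conj inner0l conjC0. Qed.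
Lemma inner_deltal f w : l2inner (l2delta R w) f = (f w)^*.
Proof. by rewrite inner_conj inner_deltar. Qed.

Lemma l2normZ a f : l2norm (a *: f) = normc a * l2norm f.
Proof.
apply/eqP; rewrite -(@eqrXn2 _ 2) ?mulr_ge0 ?normc_ge0 ?l2norm_ge0//.
apply/eqP; apply: (@complexI R); rewrite -inner_self innerZl innerZr inner_self.
by rewrite mulrA mul_conjc exprMn [RHS]realcM.
Qed.

Lemma l2normN f : l2norm (- f) = l2norm f.
Proof. by rewrite -scaleN1r l2normZ -(rmorphN1 (real_complex R)) normc_real normrN1 mul1r. Qed.

Lemma l2norm0 : l2norm (0 : H) = 0.
Proof. by rewrite -(scale0r 0) l2normZ normc0 mul0r. Qed.

Lemma l2norm_delta (w : W) : l2norm (l2delta R w) = 1.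
Proof.
apply/eqP; rewrite -(@eqrXn2 _ 2) ?l2norm_ge0 ?ler01//; apply/eqP/(@complexI R).
by rewrite -inner_self inner_deltar /= eqxx expr1n.
Qed.

Lemma sqr_l2normD f g :
  l2norm (f + g) ^+ 2 = l2norm f ^+ 2 + 2 * cRe (l2inner f g) + l2norm g ^+ 2.
Proof.
apply: (@complexI R); rewrite -inner_self innerDl !innerDr !inner_self (inner_conj f g).
case: (l2inner f g) => u v; apply/eqP; rewrite eq_complex /=.
by apply/andP; split; apply/eqP; ring.
Qed.

Lemma sqr_l2normB f g :
  l2norm (f - g) ^+ 2 = l2norm f ^+ 2 - 2 * cRe (l2inner f g) + l2norm g ^+ 2.
Proof. by rewrite sqr_l2normD l2normN innerNr; case: l2inner => u v /=; rewrite mulrN. Qed.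

Lemma cauchy_schwarz f g : normc (l2inner f g) <= l2norm f * l2norm g.
Proof.
have [g0|g0] := eqVneq (l2norm g) 0.
  by rewrite (l2norm_eq0 g0) inner0r normc0 l2norm0 mulr0.
have gp : 0 < l2norm g by rewrite lt_neqAle eq_sym g0 l2norm_ge0.
set z := l2inner f g.
have := sqr_ge0 (l2norm (f - (z / (l2norm g ^+ 2)%:C) *: g)).
rewrite sqr_l2normB innerZr l2normZ -/z.
rewrite -realcV rmorphM /= conjc_real -mulrA mulrCA (mulrC _ z) mul_conjc -realcM.
rewrite normcM normc_real ger0_norm ?invr_ge0 ?sqr_ge0//= => h.
rewrite -(@ler_pXn2r _ 2) ?nnegrE ?normc_ge0 ?mulr_ge0 ?l2norm_ge0//.
rewrite exprMn -ler_pdivrMr ?exprn_gt0// -subr_ge0.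
apply: le_trans h _; rewrite le_eqVlt; apply/orP; left; apply/eqP.
by field; rewrite g0.
Qed.

Lemma Re_le_normc z : cRe z <= normc z.
Proof.
apply: le_trans (ler_norm _) _; rewrite -sqrtr_sqr; case: z => u v /=.
by rewrite ler_wsqrtr// lerDl sqr_ge0.
Qed.

Lemma l2normD f g : l2norm (f + g) <= l2norm f + l2norm g.
Proof.
rewrite -(@ler_pXn2r _ 2) ?nnegrE ?addr_ge0 ?l2norm_ge0//.
rewrite sqr_l2normD sqrrD lerD2r lerD2l -[leRHS]mulr_natl ler_pM2l//.
exact: le_trans (Re_le_normc _) (cauchy_schwarz _ _).
Qed.

Lemma l2normB f g : l2norm (f - g) <= l2norm f + l2norm g.
Proof. by rewrite -(l2normN g) l2normD. Qed.

Lemma l2norm_distD f g h : l2norm (f - h) <= l2norm (f - g) + l2norm (g - h).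
Proof. by rewrite (_ : f - h = (f - g) + (g - h)) ?l2normD// addrA subrK. Qed.

Lemma l2norm_sum (I : Type) (r : seq I) (P : pred I) (F : I -> H) :
  l2norm (\sum_(i <- r | P i) F i) <= \sum_(i <- r | P i) l2norm (F i).
Proof.
elim/big_rec2: _ => [|i x y _ h]; first by rewrite l2norm0.
by rewrite (le_trans (l2normD _ _))// lerD2l.
Qed.

Lemma delta_dense f (e : R) : 0 < e -> exists2 X : seq W, uniq X &
  l2norm (f - \sum_(w <- X) f w *: l2delta R w) < e.
Proof.
move=> e0; have e20 : 0 < e ^+ 2 by rewrite exprn_gt0.
have [X hX] := l2_partial_sums f e20; exists X; first exact: fset_uniq.
set g := \sum_(_ <- _) _.
have fg : l2inner f g = (\sum_(w <- X) normc (f w) ^+ 2)%:C.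
  rewrite inner_conj /g; elim/big_rec2: _ => [|w x y _]; first by rewrite inner0l conjC0.
  move=> /(congr1 Num.conj); rewrite conjCK conjc_real => yx.
  by rewrite innerZDl yx inner_deltal mul_conjc -realcD conjc_real.
have gw w : g w = if w \in X then f w else 0.
  rewrite /g l2_sum; case: ifPn => wX.
    rewrite (bigD1_seq w) ?fset_uniq// l2Z l2deltaE eqxx mulr1 big1 => [|v vw].
      by rewrite /= addr0.
    by rewrite l2Z l2deltaE eq_sym (negPf vw) mulr0.
  rewrite big_seq big1// => v vX; rewrite l2Z l2deltaE.
  by case: eqVneq wX => [->|]; rewrite ?vX// mulr0.
have gg : l2norm g ^+ 2 <= \sum_(w <- X) normc (f w) ^+ 2.
  rewrite -lee_fin sqr_l2normE; apply: l2sqnorm_le_sum => Y uY.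
  rewrite (bigID (mem X))/= [X in _ + X]big1 ?addr0; last first.
    by move=> w /negPf wX; rewrite gw wX normc0 expr0n.
  rewrite -big_filter (eq_big_seq (fun w => normc (f w) ^+ 2)); last first.
    by move=> w; rewrite mem_filter gw => /andP[-> _].
  apply: sum_subseq_le => [w||w]; [exact: sqr_ge0|exact: filter_uniq|].
  by rewrite mem_filter => /andP[].
rewrite -(@ltr_pXn2r _ 2) ?nnegrE ?l2norm_ge0 ?ltW//.
rewrite sqr_l2normB fg /=; move: hX gg; lra.
Qed.

End L2Theory.

Section Operators.
Variables (R : realType) (W : choiceType).
Local Notation C := R[i].
Local Notation H := (l2 R W).
Local Notation op := (H -> H).
Local Notation cRe := (@complex.Re R).
Local Notation cIm := (@complex.Im R).
Implicit Types (f g h : H) (T U : op) (a : C).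

(** * Bounded operators *)

Lemma op_lin T : bounded_op T -> forall a f g, T (a *: f + g) = a *: T f + T g.
Proof. by case. Qed.
Lemma opD T : bounded_op T -> forall f g, T (f + g) = T f + T g.
Proof. by move=> /op_lin h f g; rewrite -[f]scale1r h !scale1r. Qed.
Lemma op0 T : bounded_op T -> T 0 = 0.
Proof. by move=> /opD/(_ 0 0); rewrite addr0 => /eqP; rewrite addrC -subr_eq subrr eq_sym => /eqP. Qed.
Lemma opZ T : bounded_op T -> forall a f, T (a *: f) = a *: T f.
Proof. by move=> bT a f; rewrite -[a *: f]addr0 (op_lin bT) (op0 bT) addr0. Qed.
Lemma opN T : bounded_op T -> forall f, T (- f) = - T f.
Proof. by move=> bT f; rewrite -scaleN1r (opZ bT) scaleN1r. Qed.
Lemma opB T : bounded_op T -> forall f g, T (f - g) = T f - T g.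
Proof. by move=> bT f g; rewrite (opD bT) (opN bT). Qed.
Lemma op_sum T (I : Type) (r : seq I) (P : pred I) (F : I -> H) : bounded_op T ->
  T (\sum_(i <- r | P i) F i) = \sum_(i <- r | P i) T (F i).
Proof. by move=> bT; apply: big_morph; [exact: opD|exact: op0]. Qed.

Definition bounded_by (M : R) T : Prop := forall f, l2norm (T f) <= M * l2norm f.

Lemma bounded_by_ge0 T : bounded_op T -> exists2 M, 0 <= M & bounded_by M T.
Proof.
move=> [_ [M hM]]; exists `|M| => // f; rewrite (le_trans (hM f))//.
by rewrite ler_wpM2r ?l2norm_ge0// ler_norm.
Qed.

Lemma bounded_by_le M M' T : M <= M' -> bounded_by M T -> bounded_by M' T.
Proof. by move=> le h f; rewrite (le_trans (h f))// ler_wpM2r// l2norm_ge0. Qed.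

Lemma bounded_by_comp M M' T U : 0 <= M -> bounded_by M T -> bounded_by M' U ->
  bounded_by (M * M') (T \o U).
Proof.
by move=> M0 hT hU f; rewrite (le_trans (hT _))// -mulrA ler_wpM2l//.
Qed.

Lemma bounded_byD M M' T U : bounded_by M T -> bounded_by M' U ->
  bounded_by (M + M') (T + U).
Proof.
by move=> hT hU f; rewrite (le_trans (l2normD _ _))// mulrDl lerD.
Qed.

Lemma bounded_byB M M' T U : bounded_by M T -> bounded_by M' U ->
  bounded_by (M + M') (T - U).
Proof.
by move=> hT hU f; rewrite (le_trans (l2normB _ _))// mulrDl lerD.
Qed.

Lemma bounded_byZ M a T : bounded_by M T -> bounded_by (normc a * M) (a *: T).
Proof.
by move=> hT f; rewrite [l2norm _]l2normZ -mulrA ler_wpM2l// normc_ge0.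
Qed.

Lemma bounded_id : bounded_op (idfun : op).
Proof. by split=> [a f g //|]; exists 1 => f; rewrite mul1r. Qed.

Lemma bounded_comp T U : bounded_op T -> bounded_op U -> bounded_op (T \o U).
Proof.
move=> bT bU; split=> [a f g|]; first by rewrite /= !op_lin.
have [M M0 hM] := bounded_by_ge0 bT; have [_ [M' hM']] := bU.
by exists (M * M'); exact: bounded_by_comp.
Qed.

Lemma bounded_lin a T U : bounded_op T -> bounded_op U -> bounded_op (a *: T + U).
Proof.
move=> bT bU; split=> [b f g|].
  rewrite /= -[LHS]/(a *: T (b *: f + g) + U (b *: f + g)) (op_lin bT) (op_lin bU).
  rewrite -[RHS]/(b *: (a *: T f + U f) + (a *: T g + U g)).
  by rewrite !scalerDr !scalerA (mulrC a b) addrACA.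
have [_ [M hM]] := bT; have [_ [M' hM']] := bU.
by exists (normc a * M + M'); apply: bounded_byD => //; exact: bounded_byZ.
Qed.

Lemma bounded_zero : bounded_op (0 : op).
Proof.
split=> [a f g|]; first by rewrite -[LHS]/(0 : H) -[RHS]/(a *: (0 : H) + 0) scaler0 addr0.
by exists 0 => f; rewrite mul0r [l2norm _]l2norm0.
Qed.

Lemma bounded_Z a T : bounded_op T -> bounded_op (a *: T).
Proof. by move=> bT; rewrite -[_ *: _]addr0; apply: bounded_lin => //; exact: bounded_zero. Qed.

Lemma bounded_D T U : bounded_op T -> bounded_op U -> bounded_op (T + U).
Proof. by move=> bT bU; rewrite -[T]scale1r; exact: bounded_lin. Qed.

Lemma bounded_N T : bounded_op T -> bounded_op (- T).
Proof. by rewrite -scaleN1r; exact: bounded_Z. Qed.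

Lemma bounded_B T U : bounded_op T -> bounded_op U -> bounded_op (T - U).
Proof. by move=> bT /bounded_N; exact: bounded_D. Qed.

Lemma le_opnorm T : bounded_op T -> bounded_by (opnorm T) T.
Proof.
move=> bT f; have [M M0 hM] := bounded_by_ge0 bT.
have ub : has_ubound [set l2norm (T f) | f in [set f : H | l2norm f <= 1]].
  exists M => _ [g /= g1 <-]; rewrite (le_trans (hM g))//.
  by rewrite -[leRHS]mulr1 ler_wpM2l.
have [f0|f0] := eqVneq (l2norm f) 0.
  by rewrite (l2norm_eq0 f0) (op0 bT) l2norm0 mulr0.
have fp : 0 < l2norm f by rewrite lt_neqAle eq_sym f0 l2norm_ge0.
rewrite -ler_pdivrMr//.
have sc g : l2norm (((l2norm f)^-1)%:C *: g) = l2norm g / l2norm f.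
  by rewrite l2normZ normc_real ger0_norm ?invr_ge0 ?l2norm_ge0// mulrC.
rewrite -sc -(opZ bT); apply: ub_le_sup => //.
by exists (((l2norm f)^-1)%:C *: f) => //=; rewrite sc divff.
Qed.

Lemma opnorm_le M T : 0 <= M -> bounded_by M T -> opnorm T <= M.
Proof.
move=> M0 hT; apply: ge_sup.
  by exists (l2norm (T 0)), 0 => //=; rewrite l2norm0.
move=> _ [g /= g1 <-]; rewrite (le_trans (hT g))//.
by rewrite -[leRHS]mulr1 ler_wpM2l.
Qed.

(** Norm closure expressed by Lipschitz bounds, which compose and add, instead of
    the supremum defining [opnorm]; see [op_closureP]. *)
Definition approximable (A : set op) : set op :=
  [set T | forall e : R, 0 < e -> exists2 U, A U & bounded_by e (T - U)].

Lemma op_closureP (A : set op) T : bounded_op T -> A `<=` @bounded_op R W ->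
  op_closure A T <-> approximable A T.
Proof.
move=> bT bA; split=> h e e0.
  have [U AU lt] := h e e0; exists U => //.
  by apply: (bounded_by_le (ltW lt)); apply/le_opnorm/bounded_B => //; exact: bA.
have [U AU hU] := h (e / 2) (divr_gt0 e0 (ltr0n _ 2)); exists U => //.
apply: le_lt_trans (opnorm_le _ hU) _; first by rewrite divr_ge0// ltW.
by rewrite ltr_pdivrMr// ltr_pMr// ltr1n.
Qed.

Lemma delta_ext T U : bounded_op T -> bounded_op U ->
  (forall w, T (l2delta R w) = U (l2delta R w)) -> T = U.
Proof.
move=> bT bU TU; apply/funext => f; apply/eqP; rewrite -subr_eq0; apply/eqP/l2norm_eq0.
have [M M0 hM] := bounded_by_ge0 (bounded_B bT bU).
apply/eqP; rewrite eq_le l2norm_ge0 andbT; apply/ler_addgt0Pl => e e0.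
rewrite addr0; have M1 : 0 < M + 1 by rewrite ltr_wpDl.
have [X _ hX] := @delta_dense R W f _ (divr_gt0 e0 M1).
set g := \sum_(_ <- _) _ in hX.
have Tg : T g = U g by rewrite (op_sum _ _ _ bT) (op_sum _ _ _ bU); apply: eq_bigr => w _; rewrite (opZ bT) (opZ bU) TU.
have -> : T f - U f = (T - U) (f - g).
  by rewrite -[RHS]/(T (f - g) - U (f - g)) (opB bT) (opB bU) Tg opprB addrA subrK.
rewrite (le_trans (hM _))// (@le_trans _ _ ((M + 1) * (e / (M + 1))))//; last first.
  by rewrite mulrCA divff ?mulr1// gt_eqF.
by rewrite ler_pM ?l2norm_ge0 ?lerDl// ltW.
Qed.

(** * Completeness *)

Lemma cvg_of_geometric (u : nat -> R) (c : R) :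
  (forall n m, `|u (n + m)%N - u n| <= c * 2^-1 ^+ n) -> cvgn u.
Proof.
move=> h; apply: cauchy_cvg; apply: cauchy_exP => e e0.
have : (fun n => c * 2^-1 ^+ n) @ \oo --> (0 : R).
  by apply: (@cvg_geometric R); rewrite ger0_norm ?invr_ge0// invf_lt1// ltr1n.
move=> /cvgrPdist_lt/(_ e e0)[N _ hN]; exists (u N), N => // n /= Nn.
rewrite /ball /= -(subnKC Nn) distrC; apply: le_lt_trans (h _ _) _.
have := hN N (leqnn _); rewrite sub0r normrN /=.
exact: le_lt_trans (ler_norm _).
Qed.

Lemma half_pow_gt0 n : 0 < 2^-1 ^+ n :> R.
Proof. by rewrite exprn_gt0// invr_gt0. Qed.

Lemma geometric_dist (f : nat -> H) (c : R) :
  (forall n, l2norm (f n.+1 - f n) <= c * 2^-1 ^+ n) ->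
  forall n m, l2norm (f (n + m)%N - f n) <= 2 * c * 2^-1 ^+ n.
Proof.
move=> h; have c0 : 0 <= c.
  by have := h 0%N; rewrite expr0 mulr1; apply: le_trans; exact: l2norm_ge0.
suff H n m : l2norm (f (n + m)%N - f n) <= 2 * c * 2^-1 ^+ n * (1 - 2^-1 ^+ m).
  move=> n m; rewrite (le_trans (H n m))//.
  rewrite -[leRHS]mulr1; apply: ler_wpM2l; first by rewrite !mulr_ge0// ltW// half_pow_gt0.
  by rewrite gerBl ltW// half_pow_gt0.
elim: m => [|m IH]; first by rewrite addn0 subrr l2norm0 expr0 subrr mulr0.
rewrite (le_trans (l2norm_distD _ (f (n + m)%N) _))// addnS.
rewrite (le_trans (lerD (h _) IH))// exprD exprS le_eqVlt; apply/orP; left.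
by apply/eqP; field.
Qed.

(** The limit is taken coordinatewise; the estimate survives on every finite set
    of coordinates, hence in norm. *)
Lemma l2_complete (f : nat -> H) (c : R) :
  (forall n, l2norm (f n.+1 - f n) <= c * 2^-1 ^+ n) ->
  exists g, forall n, l2norm (g - f n) <= 2 * c * 2^-1 ^+ n.
Proof.
move=> h; have d := geometric_dist h.
have c0 : 0 <= c.
  by have := h 0%N; rewrite expr0 mulr1; apply: le_trans; exact: l2norm_ge0.
have coord w n m : normc (f (n + m)%N w - f n w) <= 2 * c * 2^-1 ^+ n.
  exact: le_trans (normc_le_l2norm (f (n + m)%N - f n) w) (d n m).
have absRe (z : C) : `|cRe z| <= normc z.
  rewrite -sqrtr_sqr; case: z => u v /=.
  by rewrite ler_wsqrtr// lerDl sqr_ge0.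
have absIm (z : C) : `|cIm z| <= normc z.
  rewrite -sqrtr_sqr; case: z => u v /=.
  by rewrite ler_wsqrtr// lerDr sqr_ge0.
have cR w : cvgn (fun n => cRe (f n w)).
  apply: (@cvg_of_geometric _ (2 * c)) => n m; apply: le_trans (coord w n m).
  by apply: le_trans (absRe _); case: (f (n + m)%N w) (f n w) => [u v] [u' v'].
have cI w : cvgn (fun n => cIm (f n w)).
  apply: (@cvg_of_geometric _ (2 * c)) => n m; apply: le_trans (coord w n m).
  by apply: le_trans (absIm _); case: (f (n + m)%N w) (f n w) => [u v] [u' v'].
pose g w : C := limn (fun n => cRe (f n w)) +i* limn (fun n => cIm (f n w)).
have close n (X : seq W) : uniq X ->
    \sum_(w <- X) normc (g w - f n w) ^+ 2 <= (2 * c * 2^-1 ^+ n) ^+ 2.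
  move=> uX; pose F m := \sum_(w <- X) normc (f m w - f n w) ^+ 2.
  have FE : F @ \oo --> \sum_(w <- X) normc (g w - f n w) ^+ 2.
    rewrite /F; elim: X {uX F} => [|w X IH].
      by under eq_fun do rewrite big_nil; rewrite big_nil; exact: cvg_cst.
    under eq_fun do rewrite big_cons; rewrite big_cons; apply: cvgD => //.
    have nE (z z' : C) : normc (z - z') ^+ 2 = (cRe z - cRe z') ^+ 2 + (cIm z - cIm z') ^+ 2.
      by rewrite sqr_normcE; case: z z' => u v [u' v'].
    under eq_fun do rewrite nE; rewrite nE.
    have sq (u : nat -> R) (l k : R) : u @ \oo --> l -> (fun m => (u m - k) ^+ 2) @ \oo --> (l - k) ^+ 2.
      by move=> ul; apply: cvgM; apply: cvgB => //; exact: cvg_cst.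
    by apply: cvgD; apply: sq; [exact: cR|exact: cI].
  apply: (cvgr_to_le FE); exists n => // m /= nm.
  rewrite /F -(subnKC nm); apply: le_trans (sum_le_l2norm (f (n + (m - n))%N - f n) uX) _.
  by rewrite lerXn2r ?nnegrE ?l2norm_ge0// !mulr_ge0// ltW// half_pow_gt0.
have [g0 [g0E _]] := l2_of_sums (close 0%N).
have gE n : exists k : H, (forall w, k w = g w - f n w) /\ l2norm k <= 2 * c * 2^-1 ^+ n.
  have [k [kE kn]] := l2_of_sums (close n); exists k; split=> //.
  rewrite -(@ler_pXn2r _ 2) ?nnegrE ?l2norm_ge0// !mulr_ge0// ltW// half_pow_gt0.
exists (g0 + f 0%N) => n; have [k [kE kn]] := gE n.
suff -> : g0 + f 0%N - f n = k by [].
by apply: l2_eq => w; rewrite !l2D l2N g0E kE subrK.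
Qed.

Lemma op_complete (T : nat -> op) (c : R) : (forall n, bounded_op (T n)) ->
  (forall n, bounded_by (c * 2^-1 ^+ n) (T n.+1 - T n)) ->
  exists2 U, bounded_op U & forall n, bounded_by (2 * c * 2^-1 ^+ n) (U - T n).
Proof.
move=> bT h.
have ex f : exists g, forall n, l2norm (g - T n f) <= 2 * c * 2^-1 ^+ n * l2norm f.
  have [|g hg] := @l2_complete (fun n => T n f) (c * l2norm f).
    by move=> n; rewrite mulrAC; exact: h.
  by exists g => n; apply: le_trans (hg n) _; rewrite mulrA mulrAC.
pose U f := sval (cid (ex f)).
have hU n f : l2norm (U f - T n f) <= 2 * c * 2^-1 ^+ n * l2norm f.
  by rewrite /U; case: cid.
have uniq_lim (g g' : H) (k : R) :
    (forall n, l2norm (g - g') <= k * 2^-1 ^+ n) -> g = g'.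
  move=> hg; apply/eqP; rewrite -subr_eq0; apply/eqP/l2norm_eq0/eqP.
  rewrite eq_le l2norm_ge0 andbT.
  have : (fun n => k * 2^-1 ^+ n) @ \oo --> (0 : R).
    by apply: (@cvg_geometric R); rewrite ger0_norm ?invr_ge0// invf_lt1// ltr1n.
  by move=> /cvgr_to_ge; apply; exists 0%N.
have [M M0 hM] := bounded_by_ge0 (bT 0%N).
exists U; last by move=> n f; exact: hU.
split=> [a f g|]; last first.
  exists (2 * c * 2^-1 ^+ 0 + M) => f; rewrite mulrDl.
  rewrite -{1}(subrK (T 0%N f) (U f)) (le_trans (l2normD _ _))//.
  by rewrite lerD.
apply: (uniq_lim _ _ (2 * c * l2norm (a *: f + g) + (normc a * (2 * c * l2norm f) + 2 * c * l2norm g))) => n.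
rewrite (le_trans (l2norm_distD _ (T n (a *: f + g)) _))// mulrDl lerD//.
  by rewrite mulrAC.
rewrite -l2normN opprB (op_lin (bT n)) opprD addrACA -scalerBr.
rewrite (le_trans (l2normD _ _))// mulrDl; apply: lerD; last by rewrite mulrAC.
rewrite l2normZ -[leRHS]mulrA; apply: ler_wpM2l; first exact: normc_ge0.
by rewrite mulrAC.
Qed.

(** * Adjoints *)

Lemma adj_sym T U : is_adjoint T U -> is_adjoint U T.
Proof. by move=> h f g; rewrite inner_conj -h -inner_conj. Qed.

Lemma adj_comp T T' U U' : is_adjoint T T' -> is_adjoint U U' ->
  is_adjoint (T \o U) (U' \o T').
Proof. by move=> hT hU f g; rewrite /= hT hU. Qed.

Lemma adj_lin a T T' U U' : is_adjoint T T' -> is_adjoint U U' ->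
  is_adjoint (a *: T + U) (a^* *: T' + U').
Proof.
move=> hT hU f g; rewrite -[(_ + _) f]/(a *: T f + U f).
rewrite -[(_ + _) g]/(a^* *: T' g + U' g) innerZDl innerDr innerZr hT hU.
by rewrite conjCK.
Qed.

Lemma adj_id : is_adjoint (idfun : op) idfun. Proof. by []. Qed.

Lemma adj_zero : is_adjoint (0 : op) 0.
Proof. by move=> f g; rewrite -[LHS]/(l2inner 0 g) -[RHS]/(l2inner f 0) inner0l inner0r. Qed.

Lemma adjZ a T T' : is_adjoint T T' -> is_adjoint (a *: T) (a^* *: T').
Proof.
by move=> h; rewrite -[a *: T]addr0 -[_ *: T']addr0; apply: adj_lin => //; exact: adj_zero.
Qed.

Lemma adjD T T' U U' : is_adjoint T T' -> is_adjoint U U' ->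
  is_adjoint (T + U) (T' + U').
Proof.
by move=> h h' f g; rewrite -[(T + U) f]/(T f + U f) innerDl h h' -innerDr.
Qed.

Lemma adjB T T' U U' : is_adjoint T T' -> is_adjoint U U' ->
  is_adjoint (T - U) (T' - U').
Proof.
by move=> h h' f g; rewrite -[(T - U) f]/(T f - U f) innerDl innerNl h h' -innerNr -innerDr.
Qed.

Lemma adj_bounded_by M T T' : 0 <= M -> is_adjoint T T' -> bounded_by M T -> bounded_by M T'.
Proof.
move=> M0 h hM f; have [->|n0] := eqVneq (l2norm (T' f)) 0.
  by rewrite mulr_ge0// l2norm_ge0.
have p0 : 0 < l2norm (T' f) by rewrite lt_neqAle eq_sym n0 l2norm_ge0.
rewrite -(ler_pM2r p0) -expr2 -(ger0_norm (sqr_ge0 _)) -normc_real -inner_self.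
rewrite -(h (T' f) f) (le_trans (cauchy_schwarz _ _))// mulrAC.
by rewrite ler_wpM2r ?l2norm_ge0.
Qed.

Lemma adj_limit T T' (U U' : nat -> op) (c : R) :
  (forall n, is_adjoint (U n) (U' n)) ->
  (forall n, bounded_by (c * 2^-1 ^+ n) (T - U n)) ->
  (forall n, bounded_by (c * 2^-1 ^+ n) (T' - U' n)) -> is_adjoint T T'.
Proof.
move=> h hT hT' f g; apply/eqP; rewrite -subr_eq0; apply/eqP/eq0_normc/eqP.
rewrite eq_le normc_ge0 andbT.
have : (fun n => (2 * c * l2norm f * l2norm g) * 2^-1 ^+ n) @ \oo --> (0 : R).
  by apply: (@cvg_geometric R); rewrite ger0_norm ?invr_ge0// invf_lt1// ltr1n.
move=> /cvgr_to_ge; apply; exists 0%N => // n _.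
have -> : l2inner (T f) g - l2inner f (T' g) =
    l2inner ((T - U n) f) g - l2inner f ((T' - U' n) g).
  rewrite -[(T - _) f]/(T f - U n f) -[(T' - _) g]/(T' g - U' n g).
  by rewrite innerDl innerNl innerDr innerNr h opprB addrA subrK.
have normcB (x y : C) : normc (x - y) <= normc x + normc y.
  by rewrite (le_trans (le_normcD _ _))// -mulN1r normcM -(rmorphN1 (real_complex R)) normc_real normrN1 mul1r.
rewrite (le_trans (normcB _ _))//.
rewrite (le_trans (lerD (cauchy_schwarz _ _) (cauchy_schwarz _ _)))//.
have -> : 2 * c * l2norm f * l2norm g * 2^-1 ^+ n =
  c * 2^-1 ^+ n * l2norm f * l2norm g + l2norm f * (c * 2^-1 ^+ n * l2norm g) by ring.
apply: lerD; first exact: ler_wpM2r (l2norm_ge0 _) _ _ (hT n f).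
exact: ler_wpM2l (l2norm_ge0 _) _ _ (hT' n g).
Qed.

End Operators.

(** * Tracial states are bounded *)
Section PositiveTraces.
Variables (R : realType) (W : choiceType).
Local Notation C := R[i].
Local Notation H := (l2 R W).
Local Notation op := (H -> H).
Variable A : set op.
Hypothesis Acstar : unital_cstar_subalgebra A.

Lemma cstar0 : A 0.
Proof.
have := cstar_lin Acstar (-1) (cstar_unit Acstar) (cstar_unit Acstar).
by rewrite scaleN1r addNr.
Qed.

Lemma cstarZ (a : C) T : A T -> A (a *: T).
Proof. by move=> AT; rewrite -[_ *: _]addr0; apply: (cstar_lin Acstar) => //; exact: cstar0. Qed.

Lemma cstarD T U : A T -> A U -> A (T + U).
Proof. by move=> AT; rewrite -[T]scale1r; exact: (cstar_lin Acstar). Qed.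

Lemma cstarB T U : A T -> A U -> A (T - U).
Proof. by move=> AT AU; apply: cstarD => //; rewrite -scaleN1r; exact: cstarZ. Qed.

Lemma cstar_approx T : bounded_op T -> approximable A T -> A T.
Proof.
move=> bT h; apply: (cstar_closed Acstar bT).
by apply/op_closureP => //; exact: (cstar_bounded Acstar).
Qed.

Lemma limit_approx (U : nat -> op) (c : R) T : (forall n, A (U n)) ->
  (forall n, bounded_by (c * 2^-1 ^+ n) (T - U n)) -> approximable A T.
Proof.
move=> AU h e e0.
have : (fun n => c * 2^-1 ^+ n) @ \oo --> (0 : R).
  by apply: (@cvg_geometric R); rewrite ger0_norm ?invr_ge0// invf_lt1// ltr1n.
move=> /cvgrPdist_lt/(_ e e0)[N _ hN]; exists (U N) => //.
apply: bounded_by_le (h N); have := hN N (leqnn _); rewrite sub0r normrN /= => lt.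
exact: le_trans (ler_norm _) (ltW lt).
Qed.

Definition chalf : C := (2^-1 : R)%:C.

Lemma normc_half : normc chalf = 2^-1 :> R.
Proof. by rewrite normc_real ger0_norm// invr_ge0. Qed.

Lemma conj_half : chalf^* = chalf. Proof. exact: conjc_real. Qed.

Lemma half_double (V : lmodType C) (v : V) : chalf *: (v + v) = v.
Proof.
rewrite -mulr2n -scaler_nat scalerA /chalf -(rmorph_nat (real_complex R)) -realcM.
by rewrite mulVf ?pnatr_eq0// scale1r.
Qed.

(** A square root [1 - Z] of [1 - T] is given by a fixed point of
    [Z |-> (T + Z^2) / 2], a contraction of the ball of radius 1/2 on which the
    iterates of 0 converge geometrically. *)
Fixpoint sqrt_iter (T : op) (n : nat) : op :=
  if n is n'.+1 then chalf *: (T + (sqrt_iter T n' \o sqrt_iter T n')) else 0.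

Lemma sqrt_iterS T n : sqrt_iter T n.+1 = chalf *: (T + (sqrt_iter T n \o sqrt_iter T n)).
Proof. by []. Qed.

Lemma adj_half (T T' : op) : is_adjoint T T' ->
  is_adjoint (chalf *: T) (chalf *: T').
Proof. by move=> /(adjZ chalf); rewrite conj_half. Qed.

Lemma sqrt_exists T : A T -> is_adjoint T T -> bounded_by 2^-1 T ->
  exists Y, [/\ A Y, is_adjoint Y Y & Y \o Y = idfun - T].
Proof.
move=> AT sT T2; pose Z := sqrt_iter T.
have bA U : A U -> bounded_op U by exact: (cstar_bounded Acstar).
have AZ n : A (Z n).
  elim: n => [|n IH] /=; first exact: cstar0.
  by apply/cstarZ/cstarD => //; exact: (cstar_mul Acstar).
have sZ n : is_adjoint (Z n) (Z n).
  elim: n => [|n IH]; first exact: adj_zero.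
  rewrite /Z sqrt_iterS -/Z.
  have h1 : is_adjoint (Z n \o Z n) (Z n \o Z n) by exact: adj_comp.
  have h2 : is_adjoint (T + (Z n \o Z n)) (T + (Z n \o Z n)) by exact: adjD.
  exact: adj_half.
have h0 : 0 <= 2^-1 :> R by rewrite invr_ge0.
have Z2 n : bounded_by 2^-1 (Z n).
  elim: n => [|n IH] f; first by rewrite [l2norm _]l2norm0 mulr_ge0// l2norm_ge0.
  have := bounded_byZ chalf (bounded_byD T2 (bounded_by_comp h0 IH IH)) f.
  rewrite normc_half => h; apply: le_trans h _; rewrite ler_wpM2r ?l2norm_ge0//.
  lra.
have stepZ n : bounded_by (2^-1 * 2^-1 ^+ n) (Z n.+1 - Z n).
  elim: n => [|n IH].
    have -> : Z 1%N - Z 0%N = Z 1%N by exact: subr0.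
    by rewrite expr0 mulr1; exact: Z2.
  have -> : Z n.+2 - Z n.+1 = chalf *:
      ((Z n.+1 \o (Z n.+1 - Z n)) + ((Z n.+1 - Z n) \o Z n)).
    rewrite /Z !sqrt_iterS -/Z -scalerBr; congr (_ *: _); rewrite opprD addrACA subrr add0r.
    apply/funext => f.
    rewrite -[LHS]/(Z n.+1 (Z n.+1 f) - Z n (Z n f)).
    rewrite -[RHS]/(Z n.+1 (Z n.+1 f - Z n f) + (Z n.+1 (Z n f) - Z n (Z n f))).
    by rewrite (opB (bA _ (AZ n.+1))) addrA subrK.
  have d0 : 0 <= 2^-1 * 2^-1 ^+ n :> R by rewrite mulr_ge0// exprn_ge0.
  have := bounded_byZ chalf (bounded_byD (bounded_by_comp h0 (Z2 n.+1) IH)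
    (bounded_by_comp d0 IH (Z2 n))).
  by rewrite normc_half; apply: bounded_by_le; rewrite exprS; lra.
have [Zl bZl hZl] := op_complete (fun n => bA _ (AZ n)) stepZ.
have AZl : A Zl by apply: cstar_approx => //; exact: limit_approx AZ hZl.
have sZl : is_adjoint Zl Zl by exact: (adj_limit sZ hZl hZl).
have [M M0 hM] := bounded_by_ge0 bZl.
have fixZ : Zl = chalf *: (T + (Zl \o Zl)).
  have bZZ : bounded_op (chalf *: (T + (Zl \o Zl))).
    by apply: bA; apply/cstarZ/cstarD => //; exact: (cstar_mul Acstar).
  apply: delta_ext => // w; set f := l2delta R w.
  apply/eqP; rewrite -subr_eq0; apply/eqP/l2norm_eq0/eqP.
  rewrite eq_le l2norm_ge0 andbT.
  have : (fun n => (2 + M) * l2norm f * 2^-1 ^+ n) @ \oo --> (0 : R).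
    by apply: (@cvg_geometric R); rewrite ger0_norm ?invr_ge0// invf_lt1// ltr1n.
  move=> /cvgr_to_ge; apply; exists 0%N => // n _.
  rewrite (le_trans (l2norm_distD _ (Z n.+1 f) _))//.
  have e1 : l2norm (Zl f - Z n.+1 f) <= _ := hZl n.+1 f.
  have d0 : 0 <= 2 * 2^-1 * 2^-1 ^+ n :> R by rewrite !mulr_ge0// exprn_ge0.
  have := bounded_byZ chalf (bounded_byD (bounded_by_comp d0 (hZl n) (Z2 n))
     (bounded_by_comp M0 hM (hZl n))) f.
  have -> : (chalf *: (((Zl - Z n) \o Z n) + (Zl \o (Zl - Z n)))) f =
      (chalf *: (T + (Zl \o Zl))) f - Z n.+1 f.
    rewrite -[LHS]/(chalf *: ((Zl (Z n f) - Z n (Z n f)) + Zl (Zl f - Z n f))).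
    rewrite -[RHS]/(chalf *: (T f + Zl (Zl f)) - chalf *: (T f + Z n (Z n f))).
    rewrite -scalerBr (opB bZl); congr (_ *: _).
    by rewrite [in RHS]opprD [RHS]addrACA subrr add0r [LHS]addrC [LHS]addrA subrK.
  rewrite normc_half => e2; rewrite -[l2norm (Z n.+1 f - _)]l2normN opprB.
  apply: le_trans (lerD e1 e2) _.
  rewrite -mulrDl (mulrAC (2 + M)); apply: ler_wpM2r; first exact: l2norm_ge0.
  rewrite exprS.
  have p0 : 0 <= 2^-1 ^+ n :> R by rewrite exprn_ge0.
  have pM : 0 <= M * 2^-1 ^+ n by rewrite mulr_ge0.
  by clear -p0 pM; lra.
have bY : bounded_op (idfun - Zl) by apply: bounded_B => //; exact: bounded_id.
exists (idfun - Zl); split.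
- by apply: cstarB => //; exact: (cstar_unit Acstar).
- by apply: adjB => //; exact: adj_id.
apply/funext => f; rewrite -[LHS]/((f - Zl f) - Zl (f - Zl f)) -[RHS]/(f - T f).
have fE : T f = Zl f + Zl f - Zl (Zl f).
  have ZE : Zl f = chalf *: (T f + Zl (Zl f)) by rewrite {1}fixZ.
  by rewrite {1 2}ZE -scalerDr half_double addrK.
by rewrite (opB bZl) fE -[LHS]addrA -opprD addrA.
Qed.

(** Both [1 - T] and [1 + T] are squares of self-adjoint elements, so the state
    is nonnegative on them. *)
Lemma state_real_bound (tau : op -> C) T : tracial_state A tau ->
  A T -> is_adjoint T T -> bounded_by 2^-1 T -> normc (tau T) <= 1.
Proof.
move=> st.
have half U : A U -> is_adjoint U U -> bounded_by 2^-1 U -> 0 <= 1 - tau U.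
  move=> AU sU bU; have [Y [AY sY YY]] := sqrt_exists AU sU bU.
  have := state_pos st AY AY sY; rewrite YY.
  have -> : idfun - U = (-1) *: U + idfun by rewrite scaleN1r addrC.
  rewrite (state_lin st)//; last exact: (cstar_unit Acstar).
  by rewrite (state_unit st) mulN1r addrC.
move=> AT sT bT; have := half _ AT sT bT.
have /half : A ((-1) *: T) by exact: cstarZ.
have : is_adjoint ((-1) *: T) ((-1) *: T).
  by have := adjZ (-1) sT; rewrite rmorphN1.
move=> sNT /(_ sNT).
have bN : bounded_by 2^-1 ((-1) *: T).
  by move=> f; rewrite scaleN1r [l2norm _]l2normN.
move=> /(_ bN); rewrite -[_ *: T]addr0 (state_lin st)//; last exact: cstar0.
have -> : tau 0 = 0.
  have := state_lin st 1 cstar0 cstar0; rewrite scale1r addr0 mul1r => /eqP.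
  by rewrite addrC -subr_eq subrr eq_sym => /eqP.
rewrite addr0 mulN1r opprK; case: (tau T) => u v; rewrite !lecE /=.
rewrite !add0r oppr_eq0 => /andP[/eqP-> h1] /andP[_ h2].
by rewrite expr0n addr0 sqrtr_sqr ler_norml; apply/andP; split; lra.
Qed.

(** Real and imaginary parts reduce to the self-adjoint case, where one rescales
    to norm 1/2; hence the constant [4 = 2 + 2]. *)
Lemma state_bound (tau : op -> C) T T' (M : R) : tracial_state A tau -> 0 < M ->
  A T -> A T' -> is_adjoint T T' -> bounded_by M T -> normc (tau T) <= 4 * M.
Proof.
move=> st M0 AT AT' adj bT; have M0' := ltW M0.
have bT' := adj_bounded_by M0' adj bT; have adj' := adj_sym adj.
have real U : A U -> is_adjoint U U -> bounded_by M U -> normc (tau U) <= 2 * M.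
  move=> AU sU bU; set c := ((2 * M)^-1)%:C.
  have c0 : 0 <= (2 * M)^-1 by rewrite invr_ge0 mulr_ge0.
  have nc : normc c = (2 * M)^-1 by rewrite normc_real ger0_norm.
  have := @state_real_bound tau (c *: U) st (cstarZ c AU).
  rewrite -[_ *: U]addr0 (state_lin st)//; last exact: cstar0.
  have -> : tau 0 = 0.
    have := state_lin st 1 cstar0 cstar0; rewrite scale1r addr0 mul1r => /eqP.
    by rewrite addrC -subr_eq subrr eq_sym => /eqP.
  rewrite !addr0 normcM nc => h; rewrite -[leRHS]mulr1 -ler_pdivrMl ?mulr_gt0//.
  apply: h; first by have := adjZ c sU; rewrite conjc_real.
  have := bounded_byZ c bU; apply: bounded_by_le; rewrite nc invfM -mulrA mulVf ?mulr1//.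
  by rewrite gt_eqF.
pose X := chalf *: (T + T'); pose Y := (chalf * 'i%C) *: (T' - T).
have AX : A X by apply/cstarZ/cstarD.
have AY : A Y by apply/cstarZ/cstarB.
have sX : is_adjoint X X.
  have := adjZ chalf (adjD adj adj'); rewrite conj_half.
  by rewrite [T' + T]addrC.
have sY : is_adjoint Y Y.
  have := adjZ (chalf * 'i%C) (adjB adj' adj); rewrite rmorphM /= conj_half.
  have -> : ('i%C : C)^* = - 'i%C by rewrite conjE; apply/eqP; rewrite eq_complex /= oppr0 !eqxx.
  by rewrite mulrN scaleNr -scalerN opprB.
have ni : normc ('i%C : C) = 1 by rewrite /= expr0n expr1n add0r sqrtr1.
have bX : bounded_by M X.
  have := bounded_byZ chalf (bounded_byD bT bT'); apply: bounded_by_le.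
  by rewrite normc_half; lra.
have bY : bounded_by M Y.
  have := bounded_byZ (chalf * 'i%C) (bounded_byB bT' bT); apply: bounded_by_le.
  by rewrite normcM normc_half ni; lra.
have TE : T = 'i%C *: Y + X.
  apply/funext => f; rewrite -[RHS]/('i%C *: ((chalf * 'i%C) *: (T' f - T f)) + chalf *: (T f + T' f)).
  rewrite scalerA mulrCA -expr2 sqr_i mulrN1 scaleNr -scalerN opprB -scalerDr.
  by rewrite addrACA addNr addr0 half_double.
rewrite {1}TE (state_lin st)// (le_trans (le_normcD _ _))// normcM ni mul1r.
have := lerD (real _ AY sY bY) (real _ AX sX bX); lra.
Qed.

End PositiveTraces.

(** * The group of bijections of a type *)
Section Bijections.
Variable X : Type.

(** Homomorphisms into this group are actions on [X], so the universal property
    of a Coxeter system produces actions from involutions of [X] that satisfy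
    the relations. *)
Record bij := Bij {
  bij_fun :> X -> X ;
  bij_inv : X -> X ;
  bij_funK : cancel bij_fun bij_inv ;
  bij_invK : cancel bij_inv bij_fun }.

HB.instance Definition _ := gen_eqMixin bij.
HB.instance Definition _ := gen_choiceMixin bij.

Lemma bij_eq (f g : bij) : f =1 g -> f = g.
Proof.
case: f g => [f f' fK f'K] [g g' gK g'K] /= /funext fg; move: fK f'K.
rewrite fg => fK f'K; have f'g' : f' = g'.
  by apply/funext => x; rewrite -[x]g'K fK gK.
move: fK f'K; rewrite f'g' => fK f'K.
by rewrite (Prop_irrelevance fK gK) (Prop_irrelevance f'K g'K).
Qed.

Definition bij1 : bij := @Bij id id (fun=> erefl) (fun=> erefl).

Definition bij_mul (f g : bij) : bij :=
  Bij (can_comp (bij_funK f) (bij_funK g)) (can_comp (bij_invK g) (bij_invK f)).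

Definition bijV (f : bij) : bij := Bij (bij_invK f) (bij_funK f).

Lemma bij_mulA : associative bij_mul. Proof. by move=> f g h; exact: bij_eq. Qed.
Lemma bij_mul1 : left_id bij1 bij_mul. Proof. by move=> f; exact: bij_eq. Qed.
Lemma bij_mulr1 : right_id bij1 bij_mul. Proof. by move=> f; exact: bij_eq. Qed.
Lemma bij_mulV : left_inverse bij1 bijV bij_mul.
Proof. by move=> f; apply: bij_eq => x /=; rewrite bij_funK. Qed.
Lemma bij_mulrV : right_inverse bij1 bijV bij_mul.
Proof. by move=> f; apply: bij_eq => x /=; rewrite bij_invK. Qed.

HB.instance Definition _ :=
  isGroup.Build bij bij_mulA bij_mul1 bij_mulr1 bij_mulV bij_mulrV.

Lemma bijM (f g : bij) x : (f * g)%g x = f (g x). Proof. by []. Qed.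
Lemma bijE1 x : (1%g : bij) x = x. Proof. by []. Qed.

Definition bij_of_invol (f : X -> X) (fK : involutive f) : bij := Bij fK fK.

End Bijections.

Lemma multiplicative1 (G H : groupType) (f : {multiplicative G -> H}) : f 1%g = 1%g.
Proof. by apply: (@mulgI _ (f 1%g)); rewrite -gmulfM !mulg1. Qed.

Lemma cat_eq_cat (T : Type) (a b c d : seq T) : a ++ b = c ++ d ->
  (size c <= size a)%N -> exists e, a = c ++ e /\ d = e ++ b.
Proof.
elim: c a => [|x c IH] [|y a] //=; [by exists [::]|by exists (y :: a)|].
by case=> -> /IH{}IH /IH[e [-> ->]]; exists e.
Qed.

(** * Length, descents and exchange *)
Section RightAngled.
Variables (W : groupType) (S : finType) (gen : S -> W) (m : S -> S -> option nat).
Hypothesis cox : coxeter_system gen m.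
Hypothesis ra : right_angled m.

Local Notation len := (word_length gen).
Local Notation prod := (word_prod gen).
Local Open Scope group_scope.

Lemma m1 s : m s s = Some 1%N. Proof. by have [[]] := cox. Qed.
Lemma msym s t : m s t = m t s. Proof. by have [[]] := cox. Qed.
Lemma gen_rel s t k : m s t = Some k -> (gen s * gen t) ^+ k = 1.
Proof. by have [_ _ _ rel _] := cox; exact: rel. Qed.
Lemma gen2 s : gen s * gen s = 1. Proof. exact: (gen_rel (m1 s)). Qed.
Lemma genK s w : gen s * (gen s * w) = w. Proof. by rewrite mulgA gen2 mul1g. Qed.
Lemma genKr s w : w * gen s * gen s = w. Proof. by rewrite -mulgA gen2 mulg1. Qed.
Lemma genLR s x y : gen s * x = y -> x = gen s * y.
Proof. by move=> <-; rewrite genK. Qed.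
Lemma genRL s x y : x * gen s = y -> x = y * gen s.
Proof. by move=> <-; rewrite genKr. Qed.
Lemma genV s : (gen s)^-1 = gen s. Proof. by apply: mulg1_eq; exact: gen2. Qed.
Lemma gen_inj : injective gen. Proof. by have [] := cox. Qed.

Lemma prod_nil : prod [::] = 1. Proof. by rewrite /word_prod big_nil. Qed.
Lemma prod_cons s r : prod (s :: r) = gen s * prod r.
Proof. by rewrite /word_prod big_cons. Qed.
Lemma prod_cat r1 r2 : prod (r1 ++ r2) = prod r1 * prod r2.
Proof. by rewrite /word_prod big_cat. Qed.
Lemma prod_rev r : prod (rev r) = (prod r)^-1.
Proof.
elim: r => [|s r IH]; first by rewrite prod_nil invg1.
by rewrite rev_cons -cats1 prod_cat IH !prod_cons prod_nil mulg1 invgM genV.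
Qed.

Lemma len_spec w : (exists2 r, size r = len w & prod r = w) /\
  (forall r, prod r = w -> (len w <= size r)%N).
Proof.
rewrite /word_length; set P := (X in get X).
suff : exists n, P n by move=> /getPex.
have [_ _ gens _ _] := cox; have [r0 r0w] := gens w.
have ex : exists n, `[< exists2 r, size r = n & prod r = w >].
  by exists (size r0); apply/asboolP; exists r0.
case: (ex_minnP ex) => n /asboolP[r rn rw] nmin.
exists n; split; first by exists r.
by move=> r' r'w; apply: nmin; apply/asboolP; exists r'.
Qed.

Lemma red_word w : exists2 r, size r = len w & prod r = w.
Proof. by case: (len_spec w). Qed.

Lemma len_prod r : (len (prod r) <= size r)%N.
Proof. by have [_] := len_spec (prod r); exact. Qed.

Lemma len1 : len 1 = 0%N.
Proof. by apply/eqP; rewrite -leqn0 -[X in (_ <= X)%N]/(size (@nil S)) -prod_nil len_prod. Qed.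

Lemma lenM x y : (len (x * y) <= len x + len y)%N.
Proof.
have [r <- <-] := red_word x; have [r' <- <-] := red_word y.
by rewrite -prod_cat -size_cat len_prod.
Qed.

Lemma lenV w : len w^-1 = len w.
Proof.
suff le v : (len v^-1 <= len v)%N by apply/eqP; rewrite eqn_leq le -{1}[w]invgK le.
by have [r <- <-] := red_word v; rewrite -prod_rev -(size_rev r) len_prod.
Qed.

Lemma len_gen_le s : (len (gen s) <= 1)%N.
Proof. by have := len_prod [:: s]; rewrite prod_cons prod_nil mulg1. Qed.

Lemma len_mulgen_le s w : (len (gen s * w) <= (len w).+1)%N.
Proof. by rewrite (leq_trans (lenM _ _))// -add1n leq_add2r len_gen_le. Qed.

Lemma len_mulgen_ge s w : (len w <= (len (gen s * w)).+1)%N.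
Proof. by rewrite -{1}(genK s w) len_mulgen_le. Qed.

(** The action on pairs of an element and a sign behind the exchange property:
    conjugate the element and flip the sign when the element is the generator
    itself. Along a word of [w] the sign of [x] records the parity of the number
    of times [x] occurs as a reflection of the word; that this comes from an
    action shows that the parity depends on [w] only. *)
Definition refl_step (s : S) (z : W * bool) : W * bool :=
  (gen s * z.1 * gen s, z.2 (+) (z.1 == gen s)).

Lemma refl_stepK s : involutive (refl_step s).
Proof.
case=> x b; rewrite /refl_step /=; congr (_, _).
  by rewrite -!mulgA gen2 mulg1 genK.
have -> : (gen s * x * gen s == gen s) = (x == gen s).
  apply/eqP/eqP => [h|->]; last by rewrite gen2 mul1g.
  by move: h => /genRL; rewrite gen2 => /genLR; rewrite mulg1.
by rewrite addbK.
Qed.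

Lemma gen_comm s t : m s t = Some 2%N -> gen s * gen t = gen t * gen s.
Proof.
move=> /gen_rel; rewrite expg2 => h.
by move: h; rewrite -mulgA => /genLR /genLR ->; rewrite mulg1.
Qed.

Lemma m_eq1 s t : m s t = Some 1%N -> s = t.
Proof.
by move=> /gen_rel; rewrite expg1 => /genRL; rewrite mul1g => /gen_inj.
Qed.

Lemma refl_rel : coxeter_relations m (fun s => bij_of_invol (refl_stepK s)).
Proof.
have conjE s t x : gen s * gen t = gen t * gen s ->
    (gen s * x * gen s == gen t) = (x == gen t).
  move=> st; apply/eqP/eqP => [h|->]; last by rewrite st -mulgA gen2 mulg1.
  by move: h => /genRL; rewrite -st => /genLR; rewrite genK.
move=> s t k mst; apply: bij_eq => -[x b].
case: (ra s t) => e; move: mst; rewrite e => // -[<-].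
  by rewrite -(m_eq1 e) bijM bijE1 /= refl_stepK.
have st := gen_comm e.
rewrite expg2 !bijM bijE1 /= /refl_step /=; congr (_, _).
  have c y : gen s * (gen t * y * gen t) * gen s = gen t * (gen s * y * gen s) * gen t.
    by rewrite !mulgA st -!mulgA st.
  rewrite c (_ : gen s * _ * _ = gen t * x * gen t).
    by rewrite -!mulgA gen2 mulg1 genK.
  by rewrite -!mulgA gen2 mulg1 genK.
rewrite !conjE//.
by case: (x == gen t); case: (x == gen s); case: b.
Qed.

Definition inv_hom := projT1 (cid (let: And5 _ _ _ _ h := cox in h _ _ refl_rel)).
Lemma inv_homE s : inv_hom (gen s) = bij_of_invol (refl_stepK s).
Proof. exact: (projT2 (cid (let: And5 _ _ _ _ h := cox in h _ _ refl_rel)) s). Qed.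

Definition inversion (w x : W) : bool := (inv_hom w^-1 (x, false)).2.

Lemma inv_hom_addb w x b : (inv_hom w (x, b)).1 = w * x * w^-1 /\
  (inv_hom w (x, b)).2 = b (+) (inv_hom w (x, false)).2.
Proof.
have [r _ <-] := red_word w.
elim: r x b => [|s r IH] x b; first by rewrite prod_nil multiplicative1 !bijE1 /= invg1 mulg1 mul1g addbF.
rewrite prod_cons gmulfM !bijM inv_homE /=.
have [h1 h2] := IH x b; have [h1' _] := IH x false.
rewrite h1 h2 h1' invgM genV !mulgA; split => //.
by rewrite addbA.
Qed.

Lemma inversion1 x : inversion 1 x = false.
Proof. by rewrite /inversion invg1 multiplicative1. Qed.

Lemma inversionM s w x :
  inversion (gen s * w) x = (x == gen s) (+) inversion w (gen s * x * gen s).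
Proof.
rewrite /inversion invgM genV gmulfM bijM inv_homE /=.
by rewrite [LHS](inv_hom_addb _ _ _).2 addFb.
Qed.

(** A reflection occurring an odd number of times occurs at some letter, and
    multiplying by it deletes that letter. *)
Lemma exchange_word r x : inversion (prod r) x ->
  exists r1 t r2, r = r1 ++ t :: r2 /\ x * prod r = prod (r1 ++ r2).
Proof.
elim: r x => [|t r IH] x; first by rewrite prod_nil inversion1.
rewrite prod_cons inversionM; have [->|xt] /= := eqVneq x (gen t).
  by move=> _; exists [::], t, r; rewrite genK.
move=> /IH[r1 [u [r2 [-> h]]]]; exists (t :: r1), u, r2; split => //.
by rewrite cat_cons prod_cons -h -!mulgA genK.
Qed.

Definition desc (s : S) (w : W) : bool := (len (gen s * w) < len w)%N.

(** If [gen s] is not an inversion of [w], it is one of [gen s * w], and the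
    exchange property makes [w] shorter than [gen s * w]. *)
Lemma descE s w : desc s w = inversion w (gen s).
Proof.
have imp v : inversion v (gen s) -> desc s v.
  have [r rv rE] := red_word v; rewrite -{1}rE => /exchange_word[r1 [t [r2 [er e]]]].
  rewrite /desc -rv -{1}rE e (leq_ltn_trans (len_prod _))//.
  by rewrite er !size_cat /= addnS.
apply/idP/idP => [|/imp//]; apply: contraTT => ni.
have : inversion (gen s * w) (gen s).
  by rewrite inversionM eqxx gen2 mul1g (negPf ni).
by move=> /imp; rewrite /desc genK -leqNgt => /ltnW.
Qed.

Lemma len_desc s w : desc s w -> len w = (len (gen s * w)).+1.
Proof.
by move=> d; apply/eqP; rewrite eqn_leq len_mulgen_ge/=.
Qed.

Lemma desc_gen s w : desc s (gen s * w) = ~~ desc s w.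
Proof. by rewrite !descE inversionM eqxx gen2 mul1g. Qed.

Lemma len_ndesc s w : ~~ desc s w -> len (gen s * w) = (len w).+1.
Proof. by rewrite -desc_gen => /len_desc; rewrite genK. Qed.

Lemma desc1 s : desc s 1 = false.
Proof. by rewrite /desc len1 ltn0. Qed.

Lemma len_gen s : len (gen s) = 1%N.
Proof. by rewrite -[gen s]mulg1 len_ndesc ?desc1 ?len1. Qed.

Lemma desc_comm s t w : m s t = Some 2%N -> desc t (gen s * w) = desc t w.
Proof.
move=> st; rewrite !descE inversionM; have c := gen_comm st.
have -> : (gen t == gen s) = false.
  by apply/eqP => /gen_inj ts; move: st; rewrite ts m1.
by rewrite c genKr.
Qed.

(** Two generators without relation act on the integers as the reflections in
    -1/2 and 1/2, all the others trivially. The distance from 0 bounds word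
    lengths from below, so alternating words are reduced. *)
Section Dihedral.
Variables (s t : S).
Hypothesis st : m s t = None.

Definition dih_step (r : S) (x : int) : int :=
  if r == s then (- 1 - x)%R else if r == t then (1 - x)%R else x.

Lemma dih_stepK r : involutive (dih_step r).
Proof.
by rewrite /dih_step => x; case: (r == s); case: (r == t) => //; rewrite subKr.
Qed.

Lemma dih_rel : coxeter_relations m (fun r => bij_of_invol (dih_stepK r)).
Proof.
move=> a b k; case: (ra a b) => e; rewrite e => // -[<-]; apply: bij_eq => x.
  by rewrite -(m_eq1 e) expg1 bijM bijE1 /= dih_stepK.
rewrite expg2 !bijM bijE1 /=.
have : (a != s) && (a != t) || (b != s) && (b != t).
  rewrite -!negb_or -negb_and; apply/negP.
  by case/andP => /orP[]/eqP ea /orP[]/eqP eb; move: e; rewrite ea eb ?m1 ?st// msym st.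
case/orP => /andP[/negPf n1 /negPf n2].
  by rewrite {1 3}/dih_step n1 n2 dih_stepK.
by rewrite {2 4}/dih_step n1 n2 dih_stepK.
Qed.

Definition dih_hom := projT1 (cid (let: And5 _ _ _ _ h := cox in h _ _ dih_rel)).
Lemma dih_homE r : dih_hom (gen r) = bij_of_invol (dih_stepK r).
Proof. exact: (projT2 (cid (let: And5 _ _ _ _ h := cox in h _ _ dih_rel)) r). Qed.

Fixpoint alternating (n : nat) (a b : S) : seq S :=
  if n is n'.+1 then a :: alternating n' b a else [::].

Lemma size_alternating n a b : size (alternating n a b) = n.
Proof. by elim: n a b => //= n IH a b; rewrite IH. Qed.

Lemma dih_alternating n : dih_hom (prod (alternating n s t)) 0 = (- (n%:Z))%R /\
  dih_hom (prod (alternating n t s)) 0 = n%:Z.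
Proof.
have ts : t == s = false by apply/eqP => ts; move: st; rewrite ts m1.
elim: n => [|n [IH1 IH2]] /=; first by rewrite prod_nil multiplicative1.
rewrite !prod_cons !gmulfM !bijM IH1 IH2 !dih_homE /= /dih_step ts !eqxx.
by split; lia.
Qed.

Lemma dih_bound r : (`|dih_hom (prod r) 0| <= (size r)%:Z)%R.
Proof.
elim: r => [|a r IH]; first by rewrite prod_nil multiplicative1.
rewrite prod_cons gmulfM bijM dih_homE /= /dih_step.
by move: IH; case: ifP => _; [|case: ifP => _]; lia.
Qed.

Lemma alternating_size r n : prod r = prod (alternating n s t) \/
  prod r = prod (alternating n t s) -> (n <= size r)%N.
Proof.
have [h1 h2] := dih_alternating n.
by move=> [] e; have := dih_bound r; rewrite e ?h1 ?h2; lia.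
Qed.

(** Two common descents would make [w] divisible by arbitrarily long alternating
    words. *)
Lemma no_common_desc w : desc s w -> desc t w -> False.
Proof.
move=> ds dt.
suff H : forall n, (exists2 v, w = prod (alternating n s t) * v & len w = (n + len v)%N) /\
   (exists2 v, w = prod (alternating n t s) * v & len w = (n + len v)%N).
  by have [[v _ e] _] := H (len w).+1; move: e; lia.
have step a b n : desc a w -> (a = s /\ b = t) \/ (a = t /\ b = s) ->
    (exists2 v, w = prod (alternating n b a) * v & len w = (n + len v)%N) ->
    exists2 v, w = prod (alternating n.+1 a b) * v & len w = (n.+1 + len v)%N.
  move=> da ab [v wE lw]; have [rv rvs rvE] := red_word v.
  have wE' : w = prod (alternating n b a ++ rv) by rewrite prod_cat rvE.
  have : inversion (prod (alternating n b a ++ rv)) (gen a) by rewrite -wE' -descE.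
  move=> /exchange_word[r1 [c [r2 [rE]]]]; rewrite -wE' => h.
  have [r1n|r1n] := ltnP (size r1) n.
    have : exists r3, alternating n b a = r1 ++ c :: r3 /\ r2 = r3 ++ rv.
      have [||r3 [e1 e2]] := @cat_eq_cat _ (alternating n b a) rv (rcons r1 c) r2.
      - by rewrite rE cat_rcons.
      - by rewrite size_rcons size_alternating.
      by exists r3; rewrite -cat_rcons.
    move=> [r3 [aE r2E]].
    have : prod (r1 ++ r3) = prod (alternating n.+1 a b).
      apply: (@mulIg _ v); rewrite -rvE -!prod_cat -catA -r2E -h [RHS]prod_cat rvE.
      by rewrite prod_cons -mulgA -wE.
    have := congr1 size aE; rewrite size_alternating size_cat /= => sE e.
    have : (n.+1 <= size (r1 ++ r3))%N.
      by apply: alternating_size; case: ab => -[<- <-]; [left|right].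
    by rewrite size_cat; lia.
  have : exists r3, r1 = alternating n b a ++ r3 /\ rv = r3 ++ c :: r2.
    by apply: (cat_eq_cat (esym rE)); rewrite size_alternating.
  move=> [r3 [r1E rvE']]; exists (prod (r3 ++ r2)).
    by rewrite prod_cons -mulgA -prod_cat catA -r1E -h genK.
  have le : (len (prod (r3 ++ r2)) < len v)%N.
    rewrite (leq_ltn_trans (len_prod _))// -rvs rvE' !size_cat /=; lia.
  have : (len w <= n.+1 + len (prod (r3 ++ r2)))%N.
    rewrite -{1}(genK a w) h r1E -catA prod_cat mulgA -prod_cons.
    rewrite (leq_trans (lenM _ _))// leq_add2r (leq_trans (len_prod _))//=.
    by rewrite size_alternating.
  by move: le; rewrite lw; lia.
elim=> [|n [IH1 IH2]]; first by split; exists w; rewrite ?prod_nil ?mul1g.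
by split; apply: step => //; [left|right].
Qed.

End Dihedral.

Lemma common_desc s t w : s != t -> desc s w -> desc t w -> m s t = Some 2%N.
Proof.
move=> st ds dt; case: (ra s t) => e //; last by case: (no_common_desc e ds dt).
by move: st; rewrite (m_eq1 e) eqxx.
Qed.

(** * Reduced products, letter counts, prefixes *)

Definition linked : rel S := fun s t => m s t == None.

Lemma linked_sym s t : linked s t = linked t s. Proof. by rewrite /linked msym. Qed.

Lemma linked_irrefl s : linked s s = false. Proof. by rewrite /linked m1. Qed.

Lemma linked_ndesc s t w : linked s t -> desc t w -> ~~ desc s w.
Proof. by move=> /eqP st dt; apply/negP => ds; exact: (no_common_desc st ds dt). Qed.

Lemma desc_red s x y : len (x * y) = (len x + len y)%N -> desc s x -> desc s (x * y).
Proof.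
by move=> xy dx; rewrite /desc xy mulgA (leq_ltn_trans (lenM _ _))// ltn_add2r.
Qed.

Lemma ex_desc w : w <> 1 -> exists s, desc s w.
Proof.
have [[|s r] rw rE] := red_word w => [|_]; first by rewrite -rE prod_nil.
exists s; rewrite /desc -rw -rE prod_cons genK /=.
by rewrite ltnS len_prod.
Qed.

Lemma len_ind (P : W -> Prop) : P 1 ->
  (forall s w, ~~ desc s w -> P w -> P (gen s * w)) -> forall w, P w.
Proof.
move=> P1 PS w; have [n] := ubnP (len w); elim: n w => // n IH w wn.
have [->//|/eqP/ex_desc[s ds]] := eqVneq w 1.
rewrite -(genK s w); apply: PS; first by rewrite desc_gen ds.
by apply: IH; rewrite (leq_trans ds).
Qed.

Definition reduced r := size r == len (prod r).

Lemma reduced_cons s r : reduced (s :: r) -> reduced r /\ ~~ desc s (prod r).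
Proof.
rewrite /reduced prod_cons /= /desc => /eqP e.
have := len_prod r; have := len_mulgen_le s (prod r).
by split; [apply/eqP|]; lia.
Qed.

Lemma cons_reduced s r : reduced r -> ~~ desc s (prod r) -> reduced (s :: r).
Proof. by move=> /eqP e /len_ndesc h; rewrite /reduced prod_cons h /= e. Qed.

(** If two reduced words of one element start with different letters [s] and [t],
    both are descents, hence commute, and the words are compared through reduced
    words starting with [s t] and [t s]. *)
Lemma count_reduced u v : reduced u -> reduced v -> prod u = prod v ->
  forall x, count_mem x u = count_mem x v.
Proof.
have [n] := ubnP (size u); elim: n u v => // n IH [|s u] [|t v] /= un.
- by [].
- by move=> _ /eqP /= e p; move: e; rewrite -p prod_nil len1.
- by move=> /eqP /= e _ p; move: e; rewrite p prod_nil len1.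
move=> ru rv; have [ru' nu] := reduced_cons ru; have [rv' nv] := reduced_cons rv.
rewrite !prod_cons => p x; have [st|st] := eqVneq s t.
  by rewrite st; congr addn; apply: IH => //; move: p; rewrite st => /mulgI.
set w := gen s * prod u in p.
have ds : desc s w by rewrite desc_gen.
have dt : desc t w by rewrite p desc_gen.
have c := common_desc st ds dt; have ts := c; rewrite msym in ts.
have [z zn zE] := red_word (gen t * prod u).
have dtu : desc t (prod u) by rewrite -(desc_comm _ c).
have rz : reduced z by rewrite /reduced zE zn.
have rtz : reduced (t :: z) by apply: cons_reduced; rewrite // zE desc_gen dtu.
have zE' : prod z = gen s * prod v.
  by rewrite zE; apply/genLR; rewrite mulgA (gen_comm c) -mulgA -/w p genK.
have rsz : reduced (s :: z).
  apply: cons_reduced; rewrite // zE' desc_gen negbK.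
  by rewrite -(desc_comm _ ts) -p.
rewrite (IH u (t :: z))// ?prod_cons ?zE ?genK// -(IH (s :: z) v) //=.
- by rewrite !addnA [((t == x) + _)%N]addnC.
- have suv : size u = size v.
    by apply: succn_inj; have := eqP rv; have := eqP ru; rewrite !prod_cons -/w -p /= => -> ->.
  by move: (eqP rsz); rewrite /= prod_cons zE' genK -(eqP rv') => ->; rewrite -suv.
- by rewrite prod_cons zE' genK.
Qed.

Definition redword w : seq S := sval (cid2 (red_word w)).
Lemma prod_redword w : prod (redword w) = w.
Proof. by rewrite /redword; case: cid2. Qed.
Lemma reduced_redword w : reduced (redword w).
Proof. by rewrite /reduced prod_redword /redword; case: cid2 => /= r ->. Qed.
Lemma size_redword w : size (redword w) = len w.
Proof. by rewrite (eqP (reduced_redword w)) prod_redword. Qed.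

Definition cnt (x : S) (w : W) : nat := count_mem x (redword w).

Lemma cnt_prod r x : reduced r -> cnt x (prod r) = count_mem x r.
Proof.
by move=> rr; apply: count_reduced; rewrite ?reduced_redword// prod_redword.
Qed.

Lemma cntM x y z : len (x * y) = (len x + len y)%N ->
  cnt z (x * y) = (cnt z x + cnt z y)%N.
Proof.
move=> xy; have e : x * y = prod (redword x ++ redword y).
  by rewrite prod_cat !prod_redword.
rewrite {1}e cnt_prod ?count_cat// /reduced -e size_cat.
by rewrite !size_redword xy.
Qed.

Lemma cnt1 x : cnt x 1 = 0%N.
Proof. by rewrite -prod_nil cnt_prod // /reduced prod_nil len1. Qed.

Lemma cnt_gen x s : cnt x (gen s) = (s == x).
Proof.
have e : gen s = prod [:: s] by rewrite prod_cons prod_nil mulg1.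
by rewrite e cnt_prod /= ?addn0// /reduced -e len_gen.
Qed.

Lemma cnt_ndesc x s w : ~~ desc s w -> cnt x (gen s * w) = ((s == x) + cnt x w)%N.
Proof. by move=> h; rewrite cntM ?cnt_gen// len_ndesc// len_gen add1n. Qed.

Lemma cntV x w : cnt x w^-1 = cnt x w.
Proof.
rewrite -{1}[w]prod_redword -prod_rev cnt_prod ?count_rev//.
by rewrite /reduced prod_rev lenV prod_redword size_rev size_redword.
Qed.

Lemma cnt_le x w : (cnt x w <= len w)%N.
Proof. by rewrite -size_redword count_size. Qed.

Lemma cnt_desc s w : desc s w -> (0 < cnt s w)%N.
Proof. by move=> d; rewrite -(genK s w) cnt_ndesc ?desc_gen ?d// eqxx. Qed.

(** Both [s] and the first letter of [x] are descents of [x * y], so they commute;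
    inductively [s] passes through [x] and has to come from [y]. *)
Lemma slide s x y : len (x * y) = (len x + len y)%N ->
  ~~ desc s x -> desc s (x * y) ->
  [/\ gen s * x = x * gen s, desc s y, cnt s x = 0%N &
      forall t, (0 < cnt t x)%N -> m s t = Some 2%N].
Proof.
elim/len_ind: x => [|t x dtx IH] xy nd d.
  by rewrite mul1g mulg1 cnt1; split; [|move: d; rewrite mul1g| |move=> u; rewrite cnt1].
have tx : len (gen t * x) = (len x).+1 by exact: len_ndesc.
have dt : desc t (gen t * x * y) by apply: desc_red; rewrite // desc_gen.
have st : s != t by apply: contraNneq nd => ->; rewrite desc_gen.
have c := common_desc st d dt; have c' := c; rewrite msym in c'.
have nd' : ~~ desc s x by rewrite -(desc_comm _ c').
have xy' : len (x * y) = (len x + len y)%N.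
  have := lenM x y; have := len_mulgen_le t (x * y); rewrite mulgA xy tx; lia.
have [e1 e2 e3 e4] := IH xy' nd' (etrans (etrans (esym (desc_comm _ c')) (congr1 _ (mulgA _ _ _))) d).
split=> //.
- by rewrite mulgA (gen_comm c) -mulgA e1 mulgA.
- by rewrite cnt_ndesc// e3 eq_sym (negPf st).
- by move=> u; rewrite cnt_ndesc//; have [<-//|_] := eqVneq t u; exact: e4.
Qed.

(** Left and right multiplication by generators do not see each other unless they
    coincide: the reason why left and right Hecke operators commute. *)
Lemma desc_mulr s t v :
  (desc s (v * gen t) = desc s v /\ desc t (gen s * v)^-1 = desc t v^-1) \/
  (s = t /\ gen s * v = v * gen t).
Proof.
have aux a b w : ~~ desc a w -> desc a (w * gen b) -> a = b /\ gen a * w = w * gen b.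
  move=> nd d; have lw : len (w * gen b) = (len w + len (gen b))%N.
    have := lenM w (gen b); rewrite len_gen addn1 leq_eqVlt => /orP[/eqP//|lt].
    have le : (len w <= (len (w * gen b)).+1)%N.
      by rewrite -{1}(genKr b w) (leq_trans (lenM _ _))// len_gen addn1.
    have e : len w = (len (w * gen b) + len (gen b))%N.
      have : len (w * gen b) <> len w.
        move=> e; have := len_mulgen_le b w^-1.
        have [/len_desc|/len_ndesc] := boolP (desc b w^-1);
          by rewrite -{1 2}genV -invgM !lenV e; lia.
      by rewrite len_gen; lia.
    have := @desc_red a (w * gen b) (gen b); rewrite genKr => /(_ e d).
    by rewrite (negPf nd).
  have [e1 d' _ _] := slide lw nd d.
  suff ab : a = b by rewrite -ab.
  have := cnt_desc d'; rewrite cnt_gen; by have [->|] := eqVneq b a.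
have both a b w : desc a (w * gen b) = desc a w \/ (a = b /\ gen a * w = w * gen b).
  have [d1|d1] := boolP (desc a w); have [d2|d2] := boolP (desc a (w * gen b)).
  - by left.
  - have [|ab e] := aux a b _ d2; first by rewrite genKr.
    by right; split=> //; move: e; rewrite genKr mulgA => /genRL.
  - by right; apply: aux.
  - by left.
case: (both s t v) => [e1|]; last by right.
case: (both t s v^-1) => [e2|[ts e2]]; first by left; rewrite invgM genV.
right; split=> //; apply: invg_inj.
by rewrite !invgM !genV e2.
Qed.

(** Reduced prefixes are determined by their letter counts: a first letter of [v]
    that does not start [v'] would, by [slide], not occur in [v'] at all. *)
Lemma prefix_uniq v v' x x' : v * x = v' * x' ->
  len (v * x) = (len v + len x)%N -> len (v' * x') = (len v' + len x')%N ->
  (forall r, cnt r v = cnt r v') -> v = v'.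
Proof.
elim/len_ind: v v' => [|t v dtv IH] v' e l l' c.
  apply/eqP; rewrite eq_sym; apply/eqP.
  have [//|/eqP/ex_desc[s /cnt_desc]] := eqVneq v' 1.
  by rewrite -c cnt1.
have dt : desc t (gen t * v * x) by apply: desc_red; rewrite // desc_gen.
have [dt'|dt'] := boolP (desc t v'); last first.
  rewrite e in dt; have [_ _ h _] := slide l' dt' dt.
  by have := c t; rewrite h cnt_ndesc// eqxx.
have lv := len_ndesc dtv; have lv' := len_desc dt'.
suff -> : v = gen t * v' by rewrite genK.
apply: IH.
- by rewrite -mulgA -e -mulgA genK.
- have := lenM v x; have := len_mulgen_le t (v * x); rewrite mulgA l lv; lia.
- have := lenM (gen t * v') x'; have := len_mulgen_ge t (v' * x').
  rewrite mulgA l' lv' addSn ltnS => h1 h2.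
  by apply/eqP; rewrite eqn_leq h1 h2.
- move=> r; have := c r; rewrite cnt_ndesc//.
  by rewrite -{1}(genK t v') [X in _ = X]cnt_ndesc ?desc_gen ?dt'// => /addnI.
Qed.

(** * Walks in the non-commutation graph *)

(** Consecutive letters of a walk have no common descent, so nothing can cancel
    beyond the last letter. *)
Lemma walk_reduced s p w : path linked s p -> ~~ desc (last s p) w ->
  len (prod (s :: p) * w) = (size (s :: p) + len w)%N.
Proof.
elim: p s => [|t p IH] s; first by rewrite /= prod_cons prod_nil mulg1 => _ /len_ndesc ->.
move=> /= /andP[st pp] /(IH _ pp) e; rewrite prod_cons -mulgA len_ndesc ?e//.
apply: (linked_ndesc st).
rewrite /desc e prod_cons -mulgA genK.
by rewrite /= addSn ltnS (leq_trans (lenM _ _))// leq_add2r len_prod.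
Qed.

Lemma walk_len s p : path linked s p -> len (prod (s :: p)) = size (s :: p).
Proof.
move=> pp; have := @walk_reduced s p 1 pp.
by rewrite mulg1 len1 addn0; apply; rewrite desc1.
Qed.

Lemma walk_desc s t p : path linked t p -> desc s (prod (t :: p)) -> s = t.
Proof.
elim: p t => [|u p IH] t; rewrite prod_cons.
  rewrite prod_nil mulg1 => _ /cnt_desc; rewrite cnt_gen.
  by have [->|] := eqVneq t s.
move=> /= /andP[tu pp] d; have [//|st] := eqVneq s t.
have dt : desc t (gen t * prod (u :: p)).
  rewrite desc_gen; apply: (linked_ndesc tu).
  by rewrite /desc prod_cons genK -prod_cons walk_len//= ltnS len_prod.
have c := common_desc st d dt; rewrite msym in c.
have su : s = u by apply: IH => //; rewrite -(desc_comm _ c).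
by move: tu; rewrite /linked -su c.
Qed.

(** Peeling first letters: each letter of the walk [s :: p] fails to start [y],
    so by [slide] it commutes with every letter of [y] and equals the first
    remaining letter of [c]. *)
Lemma walk_cancel s p c w y : path linked s p -> sorted linked c ->
  prod (s :: p) * w = y * prod c ->
  len (prod (s :: p) * w) = (size (s :: p) + len w)%N ->
  len (y * prod c) = (len y + size c)%N -> (size c <= (size p).+1)%N ->
  ~~ desc s y ->
  w = y /\ forall r r', r \in s :: p -> (0 < cnt r' w)%N -> m r r' = Some 2%N.
Proof.
elim: p s c => [|s' p IH] s [|t c] pp sc e lw ly le nd.
- case/negP: nd; move: e; rewrite prod_nil mulg1 => <-.
  by rewrite /desc lw prod_cons prod_nil mulg1 genK /= add1n.
- case: c sc e ly le => // sc e ly le.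
  have lc : len (prod [:: t]) = 1%N by rewrite walk_len.
  have d : desc s (y * prod [:: t]).
    by rewrite -e /desc lw prod_cons prod_nil mulg1 genK /= add1n.
  have [|c1 c2 _ c4] := slide _ nd d; first by rewrite ly lc.
  have st := walk_desc sc c2.
  have wy : w = y.
    apply: (mulgI (gen s)); move: e; rewrite !prod_cons !prod_nil !mulg1 => ->.
    by rewrite -st c1.
  by split=> // r r'; rewrite inE wy => /eqP->; exact: c4.
- case/negP: nd; move: e; rewrite prod_nil mulg1 => <-.
  rewrite /desc lw [prod (s :: _)]prod_cons -mulgA genK.
  by rewrite (leq_ltn_trans (lenM _ _))// ltn_add2r ltnS len_prod.
move: pp => /= /andP[ss' pp].
have lc : len (prod (t :: c)) = size (t :: c) by rewrite walk_len.
have d : desc s (y * prod (t :: c)).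
  rewrite -e /desc lw [prod (s :: _)]prod_cons -mulgA genK.
  by rewrite (leq_ltn_trans (lenM _ _))// ltn_add2r ltnS len_prod.
have [|c1 c2 _ c4] := slide _ nd d; first by rewrite ly lc.
have st := walk_desc sc c2.
have e' : prod (s' :: p) * w = y * prod c.
  apply: (mulgI (gen s)); rewrite mulgA -prod_cons e prod_cons -st.
  by rewrite !mulgA c1.
have lw' : len (prod (s' :: p) * w) = (size (s' :: p) + len w)%N.
  apply/eqP; rewrite eqn_leq (leq_trans (lenM _ _)) ?leq_add2r ?len_prod//=.
  have := len_mulgen_le s (prod (s' :: p) * w).
  by rewrite mulgA -prod_cons lw /= !addSn ltnS.
have nd' : ~~ desc s' y.
  by apply: contraL ss' => /cnt_desc/c4; rewrite /linked => ->.
have sub : sorted linked c by move: sc => /=; exact: path_sorted.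
have ly' : len (y * prod c) = (len y + size c)%N.
  by rewrite -e' lw' /=; move: lw; rewrite e ly /= addnS addSn => -[].
have [wy h] := IH s' c pp sub e' lw' ly' le nd'; split=> // r r'.
by rewrite in_cons => /orP[/eqP->|]; [rewrite wy; exact: c4|exact: h].
Qed.

(** Last letters of [a] are cancelled as long as they end [z]; once one does not,
    the rest of the walk is appended freely, by [walk_reduced]. *)
Lemma walk_max_cancel z a : sorted linked a ->
  exists b c y, [/\ a = b ++ c, z = y * prod c, len z = (len y + size c)%N &
    len (y * (prod b)^-1) = (len y + size b)%N].
Proof.
elim/last_ind: a z => [|a s IH] z sa.
  by exists [::], [::], z; rewrite prod_nil invg1 mulg1 /= addn0.
have ps : prod [:: s] = gen s by rewrite prod_cons prod_nil mulg1.
have [d|nd] := boolP (desc s z^-1).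
  have [|b [c [y [-> e l l']]]] := IH (z * gen s).
    by move: sa; rewrite -cats1 => /cat_sorted2[].
  exists b, (rcons c s), y; split=> //.
  - by rewrite -rcons_cat.
  - by rewrite -cats1 prod_cat mulgA -e ps genKr.
  - move: (len_desc d); rewrite -{1}genV -invgM !lenV l => ->.
    by rewrite size_rcons addnS.
exists (rcons a s), [::], z; rewrite cats0 prod_nil mulg1 addn0; split=> //.
rewrite -[LHS]lenV invgM invgK.
case: a sa {IH} => [|t a] /= sa; first by rewrite ps len_ndesc// lenV addn1.
by rewrite walk_reduced ?last_rcons// lenV addnC.
Qed.

Definition starts2 (x y : S) (w : W) : bool := desc x w && desc y (gen x * w).

(** With [a] the walk, [a * w] is a reduced product. If cancellation with
    [a^-1] destroyed one of the first two letters of [a], then by [walk_cancel]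
    the letters of [w] would commute, with order 2, with every letter of [y :: p],
    that is with all generators, including themselves; and if all of [a] cancelled,
    [a] would start with both [x] and [y]. *)
Lemma conj_walk_desc x y p w : path linked x (y :: p) -> (forall r, r \in y :: p) ->
  w <> 1 -> ~~ desc (last y p) w ->
  starts2 x y (prod [:: x, y & p] * w * (prod [:: x, y & p])^-1).
Proof.
move=> pw full w1 nd; rewrite /starts2; set a := prod [:: x, y & p].
have [xy py] := andP (pw : linked x y && path linked y p).
have lz : len (a * w) = (size [:: x, y & p] + len w)%N by apply: walk_reduced.
have lz' : len (prod (y :: p) * w) = (size (y :: p) + len w)%N by apply: walk_reduced.
have no_full (P : Prop) : (forall r r', r \in y :: p -> (0 < cnt r' w)%N -> m r r' = Some 2%N) -> P.
  move=> h; have [r /cnt_desc rw] := ex_desc w1.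
  by have := h r r (full r) rw; rewrite m1.
have [b [c [Y [aE zE lY lYb]]]] := walk_max_cancel (a * w) (pw : sorted linked [:: x, y & p]).
have sc : sorted linked c by move: pw; rewrite -/(sorted linked [:: x, y & p]) aE => /cat_sorted2[].
have size_c : (size c <= (size p).+2)%N.
  by rewrite -[(size p).+2]/(size [:: x, y & p]) aE size_cat leq_addl.
have lc : len (prod c) = size c.
  by case: (c) sc => [|t c'] /= h; rewrite ?prod_nil ?len1// walk_len.
have wE : a * w * a^-1 = Y * (prod b)^-1.
  by rewrite zE /a aE prod_cat invgM mulgA mulgK.
have lbV : len (prod b)^-1 = size b.
  have := lenM Y (prod b)^-1; rewrite lYb leq_add2l lenV => h.
  by apply/eqP; rewrite eqn_leq len_prod h.
have dxY : desc x Y.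
  apply/negPn/negP => ndx.
  have [] := walk_cancel pw sc zE lz _ _ ndx; rewrite -?zE//.
  by move=> _ h; apply: no_full => r r' ry; apply: h; rewrite in_cons ry orbT.
have lxY := len_desc dxY.
have dyY : desc y (gen x * Y).
  apply/negPn/negP => ndy.
  have zE' : prod (y :: p) * w = gen x * Y * prod c.
    by apply: (mulgI (gen x)); rewrite mulgA -prod_cons -/a zE -mulgA genK.
  have lY' : len (gen x * Y * prod c) = (len (gen x * Y) + size c)%N.
    by rewrite -zE' lz'; move: lY; rewrite lz lxY /=; lia.
  have [le|gt] := leqP (size c) (size p).+1.
    by have [_] := walk_cancel py sc zE' lz' lY' le ndy; exact: no_full.
  have dy : desc y (gen x * Y * prod c).
    rewrite -zE' /desc lz' prod_cons -mulgA genK.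
    by rewrite (leq_ltn_trans (lenM _ _))// ltn_add2r ltnS len_prod.
  have [|_ dyc _ _] := slide _ ndy dy; first by rewrite lY' lc.
  have ca : c = [:: x, y & p].
    case: (b) aE => [->//|t b'] /(congr1 size); rewrite size_cat /= => -[e].
    by move: gt; rewrite e ltnNge leq_addl.
  have yx : y = x by move: dyc; rewrite ca; exact: walk_desc.
  by move: xy; rewrite yx linked_irrefl.
rewrite wE; apply/andP; split.
  by apply: desc_red => //; rewrite lYb lbV.
rewrite mulgA; apply: desc_red => //.
have h1 := len_mulgen_ge x (Y * (prod b)^-1); rewrite mulgA lYb lxY addSn ltnS in h1.
by apply/eqP; rewrite eqn_leq lenM lbV.
Qed.

(** * Irreducibility *)

Hypothesis irr : coxeter_irreducible m.
Hypothesis S3 : (3 <= #|S|)%N.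

Lemma linkedE : coxeter_edge m =2 linked.
Proof. by move=> s t; rewrite /coxeter_edge /linked; case: (ra s t) => ->. Qed.

Lemma connect_linked s t : connect linked s t.
Proof. by rewrite -(eq_connect linkedE); exact: irr. Qed.

(** Concatenating walks; a prescribed letter equal to the starting point is
    reached by leaving and coming back. *)
Lemma walk_through s t (l : seq S) :
  exists p, [/\ path linked s p, last s p = t & forall r, r \in l -> r \in p].
Proof.
elim: l s => [|r l IH] s; first by have /connectP[p pp ->] := connect_linked s t; exists p.
have [sr|sr] := eqVneq s r.
  have /card_gt0P[u us] : (0 < #|predC1 s|)%N by rewrite cardC1; lia.
  have /connectP[p pp up] := connect_linked s u.
  have [p' [pp' pt pl]] := IH u.
  have /connectP[q pq rq] := connect_linked u s.
  have [q' [pq' qt ql]] := IH s.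
  exists (p ++ q ++ q'); rewrite !cat_path !last_cat -up -rq pp pq pq' qt; split=> //.
  move=> x; rewrite in_cons !mem_cat => /orP[/eqP->|/ql->]; last by rewrite !orbT.
  suff -> : r \in q by rewrite !orbT.
  case: q pq rq => [|v q] _ rq /=; first by move: us; rewrite inE rq /= eqxx.
  by rewrite -sr rq /= mem_last.
have /connectP[p pp rp] := connect_linked s r.
have [q [pq qt ql]] := IH r.
exists (p ++ q); rewrite cat_path last_cat -rp pp pq qt; split=> // x.
rewrite in_cons mem_cat => /orP[/eqP->|/ql->]; last by rewrite orbT.
case: p pp rp => [|v p] _ rp /=; first by move: sr; rewrite rp eqxx.
by rewrite {1}rp /= mem_last.
Qed.

Lemma full_walk x y t : linked x y -> exists p,
  [/\ path linked x (y :: p), forall r, r \in y :: p & last y p = t].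
Proof.
move=> xy; have [p [pp pt pl]] := walk_through y t (enum S).
exists p; split=> //=; first by rewrite xy.
by move=> r; rewrite in_cons pl ?orbT// mem_enum.
Qed.

Lemma ex_two_neighbours : exists s t r, [/\ linked t s, linked t r & s != r].
Proof.
have /card_gt0P[x _] : (0 < #|S|)%N by lia.
have /card_gt0P[u] : (0 < #|predC1 x|)%N by rewrite cardC1; lia.
rewrite !inE => ux; have /connectP[[|y p] /= pp up] := connect_linked x u.
  by move: ux; rewrite up eqxx.
have {pp} xy : linked x y by case/andP: pp.
have /card_gt0P[z] : (0 < #|predC (pred2 x y)|)%N.
  by rewrite -(ltn_add2l #|pred2 x y|) cardC addn0 card2; case: (x != y); lia.
rewrite !inE negb_or => /andP[zx zy].
have /connectP[q pq zq] := connect_linked x z.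
suff [a [b [h ab bx bY]]] : exists a b, [/\ (a == x) || (a == y), linked a b, b != x & b != y].
  case/orP: h => /eqP ea.
    by exists y, x, b; rewrite -{2}ea ab xy eq_sym.
  by exists x, y, b; rewrite -{2}ea ab linked_sym xy eq_sym.
suff H : forall a, path linked a q -> (a == x) || (a == y) -> last a q != x -> last a q != y ->
    exists a b, [/\ (a == x) || (a == y), linked a b, b != x & b != y].
  by apply: (H x) => //; rewrite ?eqxx// -zq.
elim: q {pq zq} => [|b q IH] a /=; first by move=> _ /orP[]->.
move=> /andP[ab pq] ha zqx zqy.
have [hb|] := boolP ((b == x) || (b == y)); first exact: (IH b).
by rewrite negb_or => /andP[? ?]; exists a, b.
Qed.

Lemma starts2_disjoint s t r w : linked t s -> linked t r -> s != r ->
  (starts2 s t w + starts2 r t w + starts2 t s w <= 1)%N.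
Proof.
rewrite /starts2 => ts tr sr.
have [dt|ndt] /= := boolP (desc t w).
  have st := linked_sym t s; have rt := linked_sym t r.
  rewrite ts in st; rewrite tr in rt.
  by rewrite (negPf (linked_ndesc (esym st) dt)) (negPf (linked_ndesc (esym rt) dt)) /=; case: desc.
have [ds|] /= := boolP (desc s w); last by rewrite addn0 leq_b1.
have [dr|] /= := boolP (desc r w); last by rewrite !addn0 leq_b1.
have c := common_desc sr ds dr.
have dr' : desc r (gen s * w) by rewrite desc_comm.
by rewrite (negPf (linked_ndesc tr dr')) /= addn0 leq_b1.
Qed.

(** For neighbours [s] and [r] of [t] the sets of elements starting with [s t],
    with [r t] and with [t s] are disjoint, and [conj_walk_desc] moves into each
    of them all nontrivial elements that do not start with a given letter. Since
    [s] and [t] are linked, every element fails to start with one of them. *)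
Lemma spreading : exists (s t : S) (a : bool -> 'I_3 -> seq S) (E : 'I_3 -> W -> bool),
  [/\ linked s t,
      forall w, (\sum_(i < 3) E i w <= 1)%N &
      forall (b : bool) i w, w <> 1 -> ~~ desc (if b then s else t) w ->
        E i (prod (a b i) * w * (prod (a b i))^-1)].
Proof.
have [s [t [r [ts tr sr]]]] := ex_two_neighbours.
have st : linked s t by rewrite linked_sym.
have rt : linked r t by rewrite linked_sym.
pose xy (i : 'I_3) : S * S := nth (s, t) [:: (s, t); (r, t); (t, s)] i.
have xyP i : linked (xy i).1 (xy i).2 by case: i => -[|[|[|//]]] /=.
have ex b i : exists p, [/\ path linked (xy i).1 ((xy i).2 :: p),
    forall r, r \in (xy i).2 :: p & last (xy i).2 p = if b then s else t].
  exact: full_walk.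
pose p b i := sval (cid (ex b i)).
have pP b i : [/\ path linked (xy i).1 ((xy i).2 :: p b i),
    forall r, r \in (xy i).2 :: p b i & last (xy i).2 (p b i) = if b then s else t].
  by rewrite /p; case: cid.
exists s, t, (fun b i => [:: (xy i).1, (xy i).2 & p b i]),
  (fun i => starts2 (xy i).1 (xy i).2); split=> // [w|b i w w1 nd].
  by rewrite !big_ord_recl big_ord0 addn0 addnA starts2_disjoint.
have [h1 h2 h3] := pP b i.
by apply: conj_walk_desc => //; rewrite h3.
Qed.

(** * Decompositions of products *)

(** A quadruple [(v, g, a, w)] describes one way in which the operator of a reduced
    word of [x = v g a] produces a coefficient at [u = v g w] from one at
    [a^-1 g w]: the letters of [a] cancel, those of [g] act by a diagonal term,
    and those of [v] are added. Applying the word letter by letter lists these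
    ways, [grow_create], [grow_middle] and [grow_cancel] being the three terms
    of the action of one letter. *)
Definition config : Type := (W * W * W * W)%type.

Definition grow_create (s : S) (k : config) : config :=
  let: (v, g, a, w) := k in (gen s * v, g, a, w).
Definition grow_middle (s : S) (k : config) : config :=
  let: (v, g, a, w) := k in (v, g * gen s, a, gen s * w).
Definition grow_cancel (s : S) (k : config) : config :=
  let: (v, g, a, w) := k in (v, g, gen s * a, gen s * w).

Fixpoint configs (r : seq S) (u : W) : seq config :=
  if r is s :: r' then
    if desc s u then
      [seq grow_create s k | k <- configs r' (gen s * u)] ++
      [seq grow_middle s k | k <- configs r' u]
    else [seq grow_cancel s k | k <- configs r' (gen s * u)]
  else [:: (1, 1, 1, u)].

Definition config_src (k : config) : W := let: (v, g, a, w) := k in a^-1 * g * w.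

Definition config_valid (x u : W) (k : config) : Prop :=
  let: (v, g, a, w) := k in
  [/\ x = v * g * a, len x = (len v + len g + len a)%N,
      u = v * g * w, len u = (len v + len g + len w)%N &
      len (a^-1 * g * w) = (len a + len g + len w)%N].

(** By [slide] applied to the reduced products [(v g) w] and [v (g w)]. *)
Lemma config_slide s x u v g a w : config_valid x u (v, g, a, w) ->
  ~~ desc s x -> desc s u ->
  [/\ gen s * v = v * gen s, gen s * g = g * gen s, ~~ desc s v, ~~ desc s g & desc s w].
Proof.
move=> [xE xl uE ul _] ndx du.
have [l1 l2] : len (v * g) = (len v + len g)%N /\ len (v * g * a) = (len (v * g) + len a)%N.
  have := lenM v g; have := lenM (v * g) a; rewrite -xE xl => h1 h2.
  have h3 : len (v * g) = (len v + len g)%N.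
    by apply/eqP; rewrite eqn_leq h2 -(leq_add2r (len a)) h1.
  by rewrite h3.
have l3 : len (v * g * w) = (len (v * g) + len w)%N by rewrite -uE ul l1.
have l4 : len (g * w) = (len g + len w)%N.
  apply/eqP; rewrite eqn_leq lenM -(leq_add2l (len v)) addnA -l1 -l3 -mulgA.
  exact: lenM.
have ndvg : ~~ desc s (v * g).
  by apply: contra ndx => /(desc_red l2); rewrite -xE.
have ndv : ~~ desc s v by apply: contra ndvg => /(desc_red l1).
have du' : desc s (v * g * w) by rewrite -uE.
have [c1 dw _ _] := slide l3 ndvg du'.
have l5 : len (v * (g * w)) = (len v + len (g * w))%N by rewrite mulgA l3 l1 l4 addnA.
have [|c2 _ _ _] := slide l5 ndv; first by rewrite mulgA.
have c3 : gen s * g = g * gen s.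
  by apply: (mulgI v); rewrite mulgA -c2 -mulgA c1 mulgA.
split=> //; apply: contra ndvg => dg.
rewrite /desc mulgA c2 -mulgA l1 (leq_ltn_trans (lenM _ _))// ltn_add2l; exact: dg.
Qed.

Lemma configs_valid r u : reduced r ->
  forall k, k \in configs r u -> config_valid (prod r) u k.
Proof.
elim: r u => [|s r IH] u rr k /=.
  rewrite inE => /eqP->; rewrite /config_valid prod_nil invg1 !mul1g len1; split=> //.
have [rr' nd] := reduced_cons rr.
have lsr := len_ndesc nd.
rewrite prod_cons; case: ifP => du.
- rewrite mem_cat => /orP[] /mapP[[[[v g] a] w] /IH h ->{k}] /=.
    have [xE xl uE ul wl] := h rr'.
    have ndv : ~~ desc s v.
      apply: contra nd; rewrite xE -mulgA; apply: desc_red.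
      apply/eqP; rewrite eqn_leq lenM mulgA -xE xl -addnA leq_add2l; exact: lenM.
    have lv := len_ndesc ndv.
    split=> //.
    + by rewrite {1}xE !mulgA.
    + by rewrite lsr xl lv !addSn.
    + by rewrite -!mulgA (mulgA v) -uE genK.
    + by rewrite (len_desc du) ul lv !addSn.
  have {}h := h rr'; have [c1 c2 ndv ndg dw] := config_slide h nd du.
  have [xE xl uE ul wl] := h.
  have lg : len (g * gen s) = (len g).+1 by rewrite -c2 len_ndesc.
  have lw := len_desc dw.
  split.
  + by rewrite {1}xE -c2 !mulgA c1.
  + by rewrite lsr xl lg addnS addSn.
  + by rewrite uE -!mulgA genK.
  + by rewrite ul lg lw !addnS addSn.
  + by rewrite -!mulgA genK mulgA wl lg lw !addnS addSn.
move=> /mapP[[[[v g] a] w] /IH h ->{k}] /=.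
have du' : desc s (gen s * u) by rewrite desc_gen du.
have {}h := h rr'; have [c1 c2 ndv ndg dw] := config_slide h nd du'.
have [xE xl uE ul wl] := h; have lw := len_desc dw.
have ls := len_desc du'; rewrite genK in ls.
have la : len (gen s * a) = (len a).+1.
  apply/eqP; rewrite eqn_leq len_mulgen_le /=.
  have := lenM (v * g) (gen s * a); rewrite -mulgA (mulgA g) -c2 -mulgA (mulgA v) -c1 -!mulgA.
  rewrite (mulgA v) -xE lsr xl => h1; have h2 := lenM v g.
  rewrite -addnS in h1.
  by rewrite -(leq_add2l (len v + len g)) (leq_trans h1)// leq_add2r.
split.
- by rewrite {1}xE !mulgA c1 -(mulgA v (gen s)) c2 !mulgA.
- by rewrite lsr xl la addnS.
- by apply: (mulgI (gen s)); rewrite uE !mulgA c1 -(mulgA v (gen s)) c2 mulgA genKr.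
- by apply/eqP; rewrite -eqSS -ls ul lw addnS.
- by rewrite invgM genV -!mulgA (mulgA (gen s) g) c2 -!mulgA genK mulgA wl la lw !addnS !addSn.
Qed.

Lemma config_src_create s k : config_src (grow_create s k) = config_src k.
Proof. by case: k => [[[v g] a] w]. Qed.

Lemma config_src_middle s k : config_src (grow_middle s k) = config_src k.
Proof. by case: k => [[[v g] a] w] /=; rewrite -!mulgA genK. Qed.

Lemma config_src_cancel s x u k : config_valid x u k -> ~~ desc s x -> desc s u ->
  config_src (grow_cancel s k) = config_src k.
Proof.
case: k => [[[v g] a] w] h nd du /=; have [_ c2 _ _ _] := config_slide h nd du.
by rewrite invgM genV -!mulgA (mulgA (gen s) g) c2 -!mulgA genK.
Qed.

Lemma configs_uniq r u : reduced r -> uniq (configs r u).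
Proof.
elim: r u => [|s r IH] u rr //=; have [rr' nd] := reduced_cons rr.
case: ifP => du; last first.
  rewrite map_inj_uniq ?IH// => -[[[v g] a] w] [[[v' g'] a'] w'] /= [-> ->].
  by move=> /mulgI -> /mulgI ->.
rewrite cat_uniq !map_inj_uniq ?IH//=; last 2 first.
- move=> [[[v g] a] w] [[[v' g'] a'] w'] /= [-> ].
  by move=> /mulIg -> -> /mulgI ->.
- by move=> [[[v g] a] w] [[[v' g'] a'] w'] /= [/mulgI-> -> -> ->].
rewrite andbT; apply/hasPn => k /mapP[[[[v g] a] w] /(configs_valid rr') h ->].
apply/negP => /mapP[[[[v' g'] a'] w'] /(configs_valid rr') h' [vE _ _ _]].
have [_ _ ndv _ _] := config_slide h nd du.
have [xE xl _ _ _] := h'.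
have ndv' : ~~ desc s v'.
  apply: contra nd; rewrite xE -mulgA; apply: desc_red.
  apply/eqP; rewrite eqn_leq lenM mulgA -xE xl -addnA leq_add2l; exact: lenM.
by move: ndv; rewrite vE desc_gen ndv'.
Qed.

Definition same_counts (x y : W) : Prop := forall r, cnt r x = cnt r y.

Definition same_class (k k' : config) : Prop :=
  let: (v, g, a, _) := k in let: (v', g', a', _) := k' in
  [/\ same_counts v v', same_counts g g' & same_counts a a'].

(** Among configurations with given letter counts, any two of the multiplier
    [v g a], the target [v g w] and the source [a^-1 g w] determine the third;
    the three lemmas below extract this from the uniqueness of prefixes. *)
Lemma prefix3_uniq v g a v' g' a' : v * g * a = v' * g' * a' ->
  len (v * g * a) = (len v + len g + len a)%N ->
  len (v' * g' * a') = (len v' + len g' + len a')%N ->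
  same_counts v v' -> same_counts g g' -> [/\ v = v', g = g' & a = a'].
Proof.
have aux x y z : len (x * y * z) = (len x + len y + len z)%N ->
    len (x * (y * z)) = (len x + len (y * z))%N /\ len (y * z) = (len y + len z)%N.
  rewrite -mulgA => l; have h1 := lenM x (y * z); have h2 := lenM y z.
  have h3 : len (y * z) = (len y + len z)%N.
    by apply/eqP; rewrite eqn_leq h2 -(leq_add2l (len x)) addnA -l h1.
  by rewrite l h3 addnA.
move=> e l l' cv cg; have [h1 h2] := aux _ _ _ l; have [h1' h2'] := aux _ _ _ l'.
have vv : v = v' by apply: (prefix_uniq _ h1 h1' cv); rewrite !mulgA.
have e2 : g * a = g' * a' by apply: (mulgI v); rewrite mulgA e vv mulgA.
have gg : g = g' by apply: (prefix_uniq e2 h2 h2' cg).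
by split=> //; apply: (mulgI g); rewrite e2 gg.
Qed.

Lemma config_target_uniq x x' u k k' : config_valid x u k -> config_valid x' u k' ->
  same_class k k' -> k.1.1.1 = k'.1.1.1 /\ k.1.1.2 = k'.1.1.2 /\ k.2 = k'.2.
Proof.
case: k k' => [[[v g] a] w] [[[v' g'] a'] w'] [_ _ uE ul _] [_ _ uE' ul' _] [cv cg _] /=.
by have [] := @prefix3_uniq v g w v' g' w'; rewrite -?uE -?uE'.
Qed.

Lemma config_left_uniq x u u' k k' : config_valid x u k -> config_valid x u' k' ->
  same_class k k' -> k.1 = k'.1.
Proof.
case: k k' => [[[v g] a] w] [[[v' g'] a'] w'] [xE xl _ _ _] [xE' xl' _ _ _] [cv cg _] /=.
by have [|||||-> -> ->] := @prefix3_uniq v g a v' g' a'; rewrite -?xE -?xE'.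
Qed.

Lemma config_src_uniq x x' u u' k k' : config_valid x u k -> config_valid x' u' k' ->
  same_class k k' -> config_src k = config_src k' ->
  k.1.1.2 = k'.1.1.2 /\ k.1.2 = k'.1.2 /\ k.2 = k'.2.
Proof.
case: k k' => [[[v g] a] w] [[[v' g'] a'] w'] [_ _ _ _ wl] [_ _ _ _ wl'] [_ cg ca] /= e.
have [|||||aa -> ->] := @prefix3_uniq a^-1 g w a'^-1 g' w'; rewrite ?lenV//.
  by move=> r; rewrite !cntV.
by split=> //; split=> //; apply: invg_inj.
Qed.

(** * Hecke operators *)

Local Close Scope group_scope.
Local Open Scope ring_scope.

Section WeightedTranslations.
Variables (R : realType) (X : choiceType).
Local Notation C := R[i].
Local Notation H := (l2 R X).

(** The operator [f |-> (w |-> e w * f (sigma w))], meaningful for bounded [e] and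
    injective [sigma]; left and right Hecke operators are sums of two such. *)
Definition weighted (e : X -> R) (sigma : X -> X) : H -> H :=
  locked (fun f : H => insubd (0 : H) ((fun w => (e w)%:C * f (sigma w)) : X -> C^o)).

Lemma weighted_spec (e : X -> R) (sigma : X -> X) (M : R) (f : H) :
  injective sigma -> (forall w, `|e w| <= M) ->
  (forall w, weighted e sigma f w = (e w)%:C * f (sigma w)) /\
  l2norm (weighted e sigma f) <= M * l2norm f.
Proof.
move=> isig eM.
have M0 (w : X) : 0 <= M by apply: le_trans (eM w).
have [|g [gE gn]] := @l2_of_sums R X (fun w => (e w)%:C * f (sigma w)) ((M * l2norm f) ^+ 2).
  move=> Y uY.
  have uY' : uniq (map sigma Y) by rewrite map_inj_uniq.
  rewrite exprMn; apply: le_trans (ler_wpM2l (sqr_ge0 M) (sum_le_l2norm f uY')).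
  rewrite big_map mulr_sumr; apply: ler_sum => w _.
  rewrite normcM exprMn ler_wpM2r ?sqr_ge0// normc_real.
  by rewrite lerXn2r ?nnegrE// (M0 w).
have wE : weighted e sigma f = g.
  apply: l2_eq => w; rewrite gE /weighted -lock.
  have g2 : ((fun w => (e w)%:C * f (sigma w)) : X -> C^o) \in @l2_pred R X.
    have -> : ((fun w => (e w)%:C * f (sigma w)) : X -> C^o) = g by apply/funext => v; rewrite gE.
    exact: valP.
  by have -> := insubdK (0 : H) g2.
split=> [w|]; first by rewrite wE gE.
rewrite wE; have [fX|nX] := pselect (exists w : X, True).
  have [w _] := fX.
  by rewrite -(@ler_pXn2r _ 2) ?nnegrE ?mulr_ge0 ?l2norm_ge0// (M0 w).
have z (k : H) : k = 0 by apply: l2_eq => w; case: nX; exists w.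
by rewrite (z g) (z f) l2norm0 mulr0.
Qed.

Lemma weighted_bounded e sigma M : injective sigma -> (forall w, `|e w| <= M) ->
  bounded_op (weighted e sigma).
Proof.
move=> isig eM; have E f := (weighted_spec f isig eM).1.
split=> [a f g|]; last by exists M => f; have [] := weighted_spec f isig eM.
apply: l2_eq => w; rewrite E !l2D !l2Z !E mulrDr; congr (_ + _); first by rewrite mulrCA.
Qed.

Lemma isometry_inner (T : H -> H) : bounded_op T -> (forall f, l2norm (T f) = l2norm f) ->
  forall f g, l2inner (T f) (T g) = l2inner f g.
Proof.
move=> bT iT f g.
have re h k : complex.Re (l2inner (T h) (T k)) = complex.Re (l2inner h k).
  have := sqr_l2normD (T h) (T k); rewrite -(opD bT) !iT sqr_l2normD.
  by move=> /addIr/addrI/(mulfI _) ->//; rewrite pnatr_eq0.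
have im : complex.Im (l2inner (T f) (T g)) = complex.Im (l2inner f g).
  have := re f ('i%C *: g); rewrite (opZ bT) !innerZr.
  case: (l2inner (T f) _) (l2inner f g) => u v [u' v'].
  by rewrite (_ : ('i%C : C)^* = 0 -i* 1)//= !mul0r !sub0r !mulN1r !opprK.
by move: (re f g) im; case: (l2inner (T f) _) (l2inner f g) => u v [u' v'] /= -> ->.
Qed.

Lemma mul_self_adjoint e M : (forall w, `|e w| <= M) ->
  is_adjoint (weighted e id) (weighted e id).
Proof.
move=> eM f g; rewrite /l2inner.
suff -> : (fun w => weighted e id f w * (g w)^* : C^o) =
    (fun w => f w * (weighted e id g w)^* : C^o) by [].
apply/funext => w.
rewrite !(weighted_spec _ (@inj_id _) eM).1 rmorphM /= conjc_real.
by rewrite mulrA [f w * _]mulrC.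
Qed.

Lemma one_le1 (w : X) : `|(fun=> 1) w| <= 1 :> R. Proof. by rewrite normr1. Qed.

Lemma translation_isometry (sigma : X -> X) : bijective sigma ->
  forall f, l2norm (weighted (fun=> 1) sigma f) = l2norm f.
Proof.
move=> [tau sK tK] f.
have [E n1] := weighted_spec f (can_inj sK) one_le1.
have [E' n2] := weighted_spec (weighted (fun=> 1) sigma f) (can_inj tK) one_le1.
have fE : weighted (fun=> 1) tau (weighted (fun=> 1) sigma f) = f.
  by apply: l2_eq => w; rewrite E' E !mul1r tK.
rewrite fE in n2; rewrite mul1r in n1; rewrite mul1r in n2.
by apply/eqP; rewrite eq_le n1 n2.
Qed.

Lemma involution_self_adjoint (sigma : X -> X) : involutive sigma ->
  is_adjoint (weighted (fun=> 1) sigma) (weighted (fun=> 1) sigma).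
Proof.
move=> sK f g; have bT := weighted_bounded (inv_inj sK) one_le1.
have E h := (weighted_spec h (inv_inj sK) one_le1).1.
rewrite -[LHS](isometry_inner bT); last exact: translation_isometry (inv_bij sK).
by congr l2inner; apply: l2_eq => w; rewrite !E !mul1r sK.
Qed.

End WeightedTranslations.

Section HeckeOperators.
Variables (R : realType) (q : S -> R).
Local Notation C := R[i].
Local Notation H := (l2 R W).
Local Notation op := (H -> H).
Local Notation p := (hecke_p q).
Local Notation delta := (l2delta R).

Definition Lop (s : S) : op := hecke_op gen2 q s.

Lemma LopE s f v :
  Lop s f v = (if desc s v then p s else 0)%:C * f v + f (gen s * v)%g.
Proof. by []. Qed.

Lemma Lop_hecke s : is_hecke_op gen q s (Lop s). Proof. exact: hecke_opP. Qed.

Lemma Lop_bounded s : bounded_op (Lop s). Proof. by case: (Lop_hecke s). Qed.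

Definition rdesc (s : S) (w : W) : bool := desc s w^-1%g.

Definition rmul_op (t : S) : op := weighted (fun=> 1) (fun v => (v * gen t)%g).
Definition lmul_op (s : S) : op := weighted (fun=> 1) (fun v => (gen s * v)%g).

Lemma rmul_inv t : involutive (fun v : W => (v * gen t)%g).
Proof. by move=> v; rewrite genKr. Qed.
Lemma lmul_inv t : involutive (fun v : W => (gen t * v)%g).
Proof. by move=> v; rewrite genK. Qed.

Lemma rmul_opE t f v : rmul_op t f v = f (v * gen t)%g.
Proof.
by rewrite /rmul_op (weighted_spec f (inv_inj (rmul_inv t)) (@one_le1 R W)).1 mul1r.
Qed.
Lemma lmul_opE t f v : lmul_op t f v = f (gen t * v)%g.
Proof.
by rewrite /lmul_op (weighted_spec f (inv_inj (lmul_inv t)) (@one_le1 R W)).1 mul1r.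
Qed.

Definition lweight (s : S) (a b : R) : op := weighted (fun v => if desc s v then a else b) id.
Definition rweight (s : S) (a b : R) : op := weighted (fun v => if rdesc s v then a else b) id.

Lemma if_le (b : bool) (x y : R) : `|if b then x else y| <= `|x| + `|y|.
Proof. by case: b; rewrite ?lerDl ?lerDr. Qed.

Lemma lweightE s a b f v : lweight s a b f v = (if desc s v then a else b)%:C * f v.
Proof. by rewrite /lweight (weighted_spec f (@inj_id W) (fun v => if_le (desc s v) a b)).1. Qed.
Lemma rweightE s a b f v : rweight s a b f v = (if rdesc s v then a else b)%:C * f v.
Proof. by rewrite /rweight (weighted_spec f (@inj_id W) (fun v => if_le (rdesc s v) a b)).1. Qed.

(** The mirror image of [Lop], acting by right multiplication. *)
Definition Rop (t : S) : op := rweight t (p t) 0 + rmul_op t.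

Lemma RopE t f v :
  Rop t f v = (if rdesc t v then p t else 0)%:C * f v + f (v * gen t)%g.
Proof. by rewrite -[LHS]/((rweight t (p t) 0 f + rmul_op t f) v) l2D rweightE rmul_opE. Qed.

Lemma LopW s : Lop s = lweight s (p s) 0 + lmul_op s.
Proof.
apply/funext => f; apply: l2_eq => v.
by rewrite -[RHS]/((lweight s (p s) 0 f + lmul_op s f) v) l2D lweightE lmul_opE.
Qed.

Lemma lweight_bounded s a b : bounded_op (lweight s a b).
Proof. exact: (weighted_bounded (@inj_id W) (fun v => if_le (desc s v) a b)). Qed.
Lemma rweight_bounded s a b : bounded_op (rweight s a b).
Proof. exact: (weighted_bounded (@inj_id W) (fun v => if_le (rdesc s v) a b)). Qed.
Lemma lmul_bounded s : bounded_op (lmul_op s).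
Proof. exact: (weighted_bounded (inv_inj (lmul_inv s)) (@one_le1 R W)). Qed.
Lemma rmul_bounded s : bounded_op (rmul_op s).
Proof. exact: (weighted_bounded (inv_inj (rmul_inv s)) (@one_le1 R W)). Qed.

Lemma Rop_bounded t : bounded_op (Rop t).
Proof. by apply: bounded_D; [exact: rweight_bounded|exact: rmul_bounded]. Qed.

Lemma Lop_adjoint s : is_adjoint (Lop s) (Lop s).
Proof.
rewrite LopW; apply: adjD; last exact: involution_self_adjoint (lmul_inv s).
exact: (mul_self_adjoint (fun v => if_le (desc s v) (p s) 0)).
Qed.

Lemma LR_comm s t f : Lop s (Rop t f) = Rop t (Lop s f).
Proof.
apply: l2_eq => v; rewrite LopE !RopE !LopE mulgA.
case: (desc_mulr s t v) => [[e1 e2]|[st e]].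
  by rewrite e1 [rdesc t (gen s * v)%g]e2 -/(rdesc t v); ring.
rewrite -st in e *.
have len_eq x : (gen s * x)%g = (x * gen s)%g -> rdesc s x = desc s x.
  by move=> ex; rewrite /rdesc /desc -{1}genV -invgM !lenV ex.
have e' : (gen s * (gen s * v))%g = (gen s * v * gen s)%g by rewrite {2}e genK genKr.
by rewrite -e (len_eq _ e) (len_eq _ e') ; ring.
Qed.

Lemma Rop_delta t w : ~~ rdesc t w -> Rop t (delta w) = delta (w * gen t)%g.
Proof.
move=> nd; apply: l2_eq => v; rewrite RopE !l2deltaE.
have -> : (v * gen t == w)%g = (v == w * gen t)%g.
  by apply/eqP/eqP => [<-|->]; rewrite genKr.
by case: (eqVneq v w) => [->|_]; [rewrite (negPf nd) mul0r add0r|rewrite mulr0 add0r].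
Qed.

Lemma Lop_delta t w : ~~ desc t w -> Lop t (delta w) = delta (gen t * w)%g.
Proof.
move=> nd; apply: l2_eq => v; rewrite LopE !l2deltaE.
have -> : (gen t * v == w)%g = (v == gen t * w)%g.
  by apply/eqP/eqP => [<-|->]; rewrite genK.
by case: (eqVneq v w) => [->|_]; [rewrite (negPf nd) mul0r add0r|rewrite mulr0 add0r].
Qed.

Definition commutes_right (T : op) : Prop := forall t f, T (Rop t f) = Rop t (T f).

(** The vector [delta 1] is cyclic for the right Hecke operators, hence separating
    for the operators commuting with them. *)
Lemma right_separating T U : bounded_op T -> bounded_op U ->
  commutes_right T -> commutes_right U -> T (delta 1%g) = U (delta 1%g) -> T = U.
Proof.
move=> bT bU cT cU e; apply: delta_ext => // w; rewrite -[w]invgK.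
elim/len_ind: w^-1%g => [|s v nd IH]; first by rewrite invg1.
have -> : delta (gen s * v)^-1%g = Rop s (delta v^-1%g).
  by rewrite Rop_delta ?/rdesc ?invgK// invgM genV.
by rewrite cT cU IH.
Qed.

(** Noncommutative polynomials in the Hecke operators, filtered by degree. Letters
    may be multiplied on either side, so that products, adjoints and the trace
    property are handled by induction. *)
Inductive hecke_poly : nat -> op -> Prop :=
| HeckeOne : hecke_poly 0 idfun
| HeckeLin d (a : C) T U : hecke_poly d T -> hecke_poly d U -> hecke_poly d (a *: T + U)
| HeckeWiden d T : hecke_poly d T -> hecke_poly d.+1 T
| HeckeMulL d s T : hecke_poly d T -> hecke_poly d.+1 (Lop s \o T)
| HeckeMulR d s T : hecke_poly d T -> hecke_poly d.+1 (T \o Lop s).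

Lemma hecke_poly_bounded d T : hecke_poly d T -> bounded_op T.
Proof.
elim=> {d T} [|d a T U _ bT _ bU|d T _ bT|d s T _ bT|d s T _ bT] //.
- exact: bounded_id.
- exact: bounded_lin.
- by apply: bounded_comp => //; exact: Lop_bounded.
- by apply: bounded_comp => //; exact: Lop_bounded.
Qed.

Lemma hecke_poly_right d T : hecke_poly d T -> commutes_right T.
Proof.
elim=> {d T} [|d a T U _ cT _ cU|d T _ cT|d s T _ cT|d s T _ cT] t f //.
- rewrite -[LHS]/(a *: T (Rop t f) + U (Rop t f)) cT cU.
  by rewrite -(op_lin (Rop_bounded t)).
- by rewrite /= cT LR_comm.
- by rewrite /= LR_comm cT.
Qed.

Lemma hecke_poly_supp d T : hecke_poly d T -> forall v, (d < len v)%N -> T (delta 1%g) v = 0.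
Proof.
elim=> {d T} [|d a T U _ hT _ hU|d T _ hT|d s T _ hT|d s T pT hT] v dv.
- rewrite l2deltaE; case: eqP dv => // ->; by rewrite len1.
- by rewrite -[LHS]/(a * T (delta 1%g) v + U (delta 1%g) v) hT// hU// mulr0 addr0.
- by apply: hT; exact: ltnW.
- rewrite LopE !hT ?mulr0 ?addr0//; last exact: ltnW.
  by have := len_mulgen_ge s v; move: dv; lia.
rewrite /= Lop_delta ?desc1// mulg1.
have -> : delta (gen s) = Rop s (delta 1%g) by rewrite Rop_delta ?mul1g// /rdesc invg1 desc1.
rewrite (hecke_poly_right pT) RopE !hT ?mulr0 ?addr0//; last exact: ltnW.
have := len_mulgen_ge s v^-1%g.
have -> : len (gen s * v^-1)%g = len (v * gen s)%g by rewrite -lenV invgM invgK genV.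
by rewrite lenV => /(leq_trans dv).
Qed.

Lemma hecke_poly_adjoint d T : hecke_poly d T ->
  exists2 T', hecke_poly d T' & is_adjoint T T'.
Proof.
elim=> {d T} [|d a T U _ [T' pT aT] _ [U' pU aU]|d T _ [T' pT aT]|d s T _ [T' pT aT]|d s T _ [T' pT aT]].
- by exists idfun; [exact: HeckeOne|exact: adj_id].
- by exists (a^* *: T' + U'); [exact: HeckeLin|exact: adj_lin].
- by exists T' => //; exact: HeckeWiden.
- exists (T' \o Lop s); first exact: HeckeMulR.
  by apply: adj_comp => //; exact: Lop_adjoint.
- exists (Lop s \o T'); first exact: HeckeMulL.
  by apply: adj_comp => //; exact: Lop_adjoint.
Qed.

Lemma hecke_poly_widen d e T : (d <= e)%N -> hecke_poly d T -> hecke_poly e T.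
Proof.
move=> /subnKC <-; elim: (e - d)%N => [|n IH] pT; first by rewrite addn0.
by rewrite addnS; apply: HeckeWiden; exact: IH.
Qed.

Lemma hecke_poly0 d : hecke_poly d 0.
Proof.
apply: (@hecke_poly_widen 0) => //.
have -> : (0 : op) = (-1) *: idfun + idfun by rewrite scaleN1r addNr.
by apply: HeckeLin; exact: HeckeOne.
Qed.

Lemma hecke_polyZ d a T : hecke_poly d T -> hecke_poly d (a *: T).
Proof. by move=> pT; rewrite -[_ *: _]addr0; apply: HeckeLin => //; exact: hecke_poly0. Qed.

Lemma hecke_polyD d T U : hecke_poly d T -> hecke_poly d U -> hecke_poly d (T + U).
Proof. by move=> pT pU; rewrite -[T]scale1r; exact: HeckeLin. Qed.

Lemma hecke_poly_comp d e T U : hecke_poly d T -> hecke_poly e U -> hecke_poly (d + e) (T \o U).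
Proof.
move=> pT; elim: pT e U => {d T} [|d a T T2 _ hT _ hT2|d T _ hT|d s T _ hT|d s T _ hT] e U pU.
- exact: pU.
- have -> : (a *: T + T2) \o U = a *: (T \o U) + (T2 \o U) by [].
  by apply: HeckeLin; [exact: hT|exact: hT2].
- by rewrite addSn; apply: HeckeWiden; exact: hT.
- by rewrite addSn; apply: (HeckeMulL s (hT _ _ pU)).
- by rewrite addSnnS; apply: (hT _ (Lop s \o U)); exact: HeckeMulL.
Qed.

Definition hecke_word (r : seq S) : op := foldr (fun s T => Lop s \o T) idfun r.

Lemma hecke_word_poly r : hecke_poly (size r) (hecke_word r).
Proof. by elim: r => [|s r IH]; [exact: HeckeOne|exact: HeckeMulL]. Qed.

Lemma hecke_word_delta r : reduced r -> hecke_word r (delta 1%g) = delta (prod r).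
Proof.
elim: r => [|s r IH] rr; first by rewrite prod_nil.
by have [rr' nd] := reduced_cons rr; rewrite /= IH// Lop_delta// prod_cons.
Qed.

Fixpoint words (d : nat) : seq (seq S) :=
  if d is d'.+1 then [::] :: [seq s :: r | s <- enum S, r <- words d'] else [:: [::]].

Lemma mem_words d r : (size r <= d)%N -> r \in words d.
Proof.
elim: d r => [|d IH] [|s r] //= rd.
by rewrite in_cons; apply/orP; right; apply/allpairsP; exists (s, r); split; rewrite ?mem_enum ?IH.
Qed.

Definition lenball (d : nat) : seq W := undup [seq w <- map prod (words d) | len w <= d]%N.

Lemma lenball_uniq d : uniq (lenball d). Proof. exact: undup_uniq. Qed.

Lemma mem_lenball d w : (w \in lenball d) = (len w <= d)%N.
Proof.
rewrite mem_undup mem_filter andb_idr// => wd.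
by rewrite -[w]prod_redword map_f// mem_words// size_redword.
Qed.

Lemma bounded_sum (I : Type) (r : seq I) (F : I -> op) :
  (forall i, bounded_op (F i)) -> bounded_op (\sum_(i <- r) F i).
Proof.
by move=> bF; elim/big_rec: _ => [|i T _]; [exact: bounded_zero|exact: bounded_D].
Qed.

Lemma sum_opE (I : Type) (r : seq I) (F : I -> op) f :
  (\sum_(i <- r) F i) f = \sum_(i <- r) F i f.
Proof. by elim/big_rec2: _ => // i x y _ <-. Qed.

(** Both sides commute with the right Hecke operators and agree on [delta 1]. *)
Lemma hecke_poly_expand d T : hecke_poly d T ->
  T = \sum_(v <- lenball d) T (delta 1%g) v *: hecke_word (redword v).
Proof.
move=> pT; have bw v := hecke_poly_bounded (hecke_word_poly (redword v)).
have bt v : bounded_op (T (delta 1%g) v *: hecke_word (redword v)) by exact: bounded_Z.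
apply: right_separating.
- exact: hecke_poly_bounded pT.
- exact: bounded_sum.
- exact: hecke_poly_right pT.
- move=> t f; rewrite !sum_opE (op_sum _ _ _ (Rop_bounded t)); apply: eq_bigr => v _.
  rewrite -[LHS]/(_ *: hecke_word (redword v) (Rop t f)).
  rewrite (hecke_poly_right (hecke_word_poly _)) -(opZ (Rop_bounded t)).
  by [].
apply: l2_eq => w; rewrite sum_opE l2_sum.
have E v : (T (delta 1%g) v *: hecke_word (redword v)) (delta 1%g) w = T (delta 1%g) v * (w == v)%:R.
  rewrite -[LHS]/(T (delta 1%g) v * (hecke_word (redword v) (delta 1%g) w)).
  by rewrite hecke_word_delta ?reduced_redword// prod_redword.
under eq_bigr do rewrite E.
have [wd|dw] := boolP (w \in lenball d).
  rewrite (bigD1_seq w) ?lenball_uniq//= eqxx mulr1 big1 => [|v vw].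
    by rewrite /= addr0.
  by rewrite eq_sym (negPf vw) mulr0.
rewrite big_seq big1 => [|v vd].
  by apply: (hecke_poly_supp pT); rewrite ltnNge -mem_lenball.
by case: eqVneq dw => [->|]; rewrite ?vd// mulr0.
Qed.

(** * Rapid decay *)

Hypothesis p_le1 : forall s, `|p s| <= 1.

(** Each configuration contributes a product of coefficients [p s], of modulus at
    most 1, times a value of [f]. *)
Lemma hecke_word_le r f u : reduced r ->
  normc (hecke_word r f u) <= \sum_(k <- configs r u) normc (f (config_src k)).
Proof.
elim: r u => [|s r IH] u rr.
  by rewrite big_seq1 /= invg1 !mul1g.
have [rr' nd] := reduced_cons rr; rewrite -[hecke_word _ f]/(Lop s (hecke_word r f)) LopE /=.
apply: le_trans (le_normcD _ _) _; rewrite normcM normc_real.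
case: ifP => du; last first.
  rewrite normr0 mul0r add0r; apply: le_trans (IH _ rr') _; rewrite big_map.
  rewrite le_eqVlt; apply/orP; left; apply/eqP; apply: eq_big_seq => k kr.
  by rewrite (config_src_cancel (configs_valid rr' kr) nd)// desc_gen du.
rewrite big_cat !big_map addrC; apply: lerD.
  apply: le_trans (IH _ rr') _; rewrite le_eqVlt; apply/orP; left; apply/eqP.
  by apply: eq_bigr => k _; rewrite config_src_create.
apply: (@le_trans _ _ (normc (hecke_word r f u))).
  by rewrite -[leRHS]mul1r ler_wpM2r// normc_ge0.
apply: le_trans (IH _ rr') _; rewrite le_eqVlt; apply/orP; left; apply/eqP.
by apply: eq_bigr => k _; rewrite config_src_middle.
Qed.

Section CauchySchwarz.
Variable I : eqType.
Implicit Types (x y : I -> R).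

Lemma sum_cauchy_schwarz (r : seq I) x y :
  (\sum_(i <- r) x i * y i) ^+ 2 <= (\sum_(i <- r) x i ^+ 2) * (\sum_(i <- r) y i ^+ 2).
Proof.
elim: r => [|i r IH]; first by rewrite !big_nil expr0n mulr0.
rewrite !big_cons; set s := \sum_(_ <- _) _ in IH *; set a := \sum_(_ <- _) _ in IH *.
set b := \sum_(_ <- _) _ in IH *.
have a0 : 0 <= a by apply: sumr_ge0 => j _; exact: sqr_ge0.
have b0 : 0 <= b by apply: sumr_ge0 => j _; exact: sqr_ge0.
have u0 : 0 <= x i ^+ 2 * b by rewrite mulr_ge0// sqr_ge0.
have v0 : 0 <= y i ^+ 2 * a by rewrite mulr_ge0// sqr_ge0.
have h : 2 * s * (x i * y i) <= x i ^+ 2 * b + y i ^+ 2 * a.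
  rewrite (le_trans (ler_norm _))// -(@ler_pXn2r _ 2) ?nnegrE ?addr_ge0//.
  rewrite -normrX ger0_norm ?sqr_ge0//.
  have h1 : 0 <= (x i ^+ 2 * b - y i ^+ 2 * a) ^+ 2 := sqr_ge0 _.
  have h2 : 0 <= x i ^+ 2 * y i ^+ 2 * (a * b - s ^+ 2).
    by rewrite mulr_ge0 ?subr_ge0// mulr_ge0// sqr_ge0.
  have -> : (2 * s * (x i * y i)) ^+ 2 = 4 * (x i ^+ 2 * y i ^+ 2 * s ^+ 2) by ring.
  have -> : (x i ^+ 2 * b + y i ^+ 2 * a) ^+ 2 =
    (x i ^+ 2 * b - y i ^+ 2 * a) ^+ 2 + 4 * (x i ^+ 2 * y i ^+ 2 * (a * b)) by ring.
  by move: h1 h2; rewrite mulrBr; lra.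
have -> : (x i * y i + s) ^+ 2 = (x i ^+ 2 * y i ^+ 2) + 2 * s * (x i * y i) + s ^+ 2 by ring.
have -> : (x i ^+ 2 + a) * (y i ^+ 2 + b) =
  x i ^+ 2 * y i ^+ 2 + (x i ^+ 2 * b + y i ^+ 2 * a) + a * b by ring.
by rewrite lerD// lerD2l.
Qed.

Lemma sqr_sum_le (r : seq I) x :
  (\sum_(i <- r) x i) ^+ 2 <= (size r)%:R * \sum_(i <- r) x i ^+ 2.
Proof.
have := sum_cauchy_schwarz r (fun=> 1) x.
under eq_bigr do rewrite mul1r; rewrite expr1n.
by rewrite big_const_seq count_predT iter_addr addr0.
Qed.

Lemma sum_indicator_le1 (r : seq I) (E : pred I) : uniq r ->
  (forall i j, i \in r -> j \in r -> E i -> E j -> i = j) -> \sum_(i <- r) (E i)%:R <= 1 :> R.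
Proof.
elim: r => [|i r IH] /=; first by rewrite big_nil.
move=> /andP[ir ur] h; rewrite big_cons; case: (boolP (E i)) => Ei; last first.
  by rewrite add0r; apply: IH => // j k jr kr; apply: h; rewrite in_cons ?jr ?kr orbT.
rewrite big_seq big1 ?addr0// => j jr; case: (boolP (E j)) => // Ej.
have ij : i = j by apply: h; rewrite // in_cons ?eqxx// jr orbT.
by move: ir; rewrite ij jr.
Qed.

End CauchySchwarz.

Section ClassSum.
Variables (d : nat) (a b : W -> R).
Hypotheses (a0 : forall v, 0 <= a v) (b0 : forall w, 0 <= b w).

(** Letter counts of elements of length at most [d]; there are polynomially many
    of them in [d]. *)
Definition counts : Type := {ffun S -> 'I_d.+1}.
Definition count_of (w : W) : counts := [ffun r => inord (cnt r w)].

Lemma count_ofP v w : (len v <= d)%N -> (len w <= d)%N ->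
  count_of v = count_of w -> same_counts v w.
Proof.
move=> vd wd /ffunP e r; have /(congr1 (@nat_of_ord _)) := e r; rewrite !ffunE !inordK//.
- by rewrite ltnS (leq_trans (cnt_le _ _)).
- by rewrite ltnS (leq_trans (cnt_le _ _)).
Qed.

Definition config_class (k : config) : counts * counts * counts :=
  let: (v, g, a, _) := k in (count_of v, count_of g, count_of a).

Lemma config_classP v u k v' u' k' : (len v <= d)%N -> (len v' <= d)%N ->
  config_valid v u k -> config_valid v' u' k' ->
  config_class k = config_class k' -> same_class k k'.
Proof.
case: k k' => [[[x g] y] w] [[[x' g'] y'] w'] vd vd' [_ l _ _ _] [_ l' _ _ _] [e1 e2 e3].
by split; apply: count_ofP => //; lia.
Qed.

Definition configs_of (v u : W) : seq config := configs (redword v) u.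

Lemma configs_of_valid v u k : k \in configs_of v u -> config_valid v u k.
Proof. by move=> /(configs_valid (reduced_redword v)); rewrite prod_redword. Qed.

Definition class_pairs (th : counts * counts * counts) (vs : seq W) (u : W) : seq (W * config) :=
  [seq z <- [seq (v, k) | v <- vs, k <- configs_of v u] | config_class z.2 == th].

Lemma class_pairsP th vs u z : z \in class_pairs th vs u ->
  [/\ z.1 \in vs, config_valid z.1 u z.2 & config_class z.2 = th].
Proof.
rewrite mem_filter => /andP[/eqP e /allpairsPdep[v [k [vvs /configs_of_valid kv zE]]]].
by rewrite zE in e *.
Qed.

Lemma class_pairs_uniq th vs u : uniq vs -> uniq (class_pairs th vs u).
Proof.
move=> uvs; apply/filter_uniq/allpairs_uniq_dep => //.
- by move=> v _; apply: configs_uniq; exact: reduced_redword.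
- by move=> [v k] [v' k'] _ _ /= [-> ->].
Qed.

(** For a fixed class the source, the multiplier and the target of a configuration
    determine each other pairwise, so after Cauchy-Schwarz at each [u] every product
    [a v ^+ 2 * b w ^+ 2] is charged to at most one [u]. *)
Lemma class_sum_le th vs us : uniq vs -> uniq us ->
  {in vs, forall v, (len v <= d)%N} ->
  forall B : R, (forall ws : seq W, uniq ws -> \sum_(w <- ws) b w ^+ 2 <= B) ->
  \sum_(u <- us) (\sum_(z <- class_pairs th vs u) a z.1 * b (config_src z.2)) ^+ 2 <=
  (\sum_(v <- vs) a v ^+ 2) * B.
Proof.
move=> uvs uus vsd B hB.
pose Pu u := map fst (class_pairs th vs u).
pose Qu u := [seq config_src z.2 | z <- class_pairs th vs u].
pose ws := undup (flatten [seq Qu u | u <- us]).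
have same u u' z z' : z \in class_pairs th vs u -> z' \in class_pairs th vs u' ->
    same_class z.2 z'.2.
  move=> /class_pairsP[zv zk zt] /class_pairsP[zv' zk' zt'].
  by apply: (config_classP _ _ zk zk'); rewrite ?vsd// zt zt'.
have pair_eq u z z' : z \in class_pairs th vs u -> z' \in class_pairs th vs u ->
    z.1 = z'.1 \/ config_src z.2 = config_src z'.2 -> z = z'.
  move=> hz hz'; have sc := same _ _ _ _ hz hz'.
  have [_ zk _] := class_pairsP hz; have [_ zk' _] := class_pairsP hz'.
  have [e1 [e2 e3]] := config_target_uniq zk zk' sc.
  have el : z.1 = z'.1 -> z.2.1 = z'.2.1.
    by move=> vv; rewrite vv in zk; exact: config_left_uniq zk zk' sc.
  have es : config_src z.2 = config_src z'.2 -> z.2.1.2 = z'.2.1.2.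
    by move=> e; have [_ []] := config_src_uniq zk zk' sc e.
  case: z z' zk zk' e1 e2 e3 el es {hz hz' sc} => [v [[[x g] y] w]] [v' [[[x' g'] y'] w']] /=.
  move=> [vE _ _ _ _] [vE' _ _ _ _] e1 e2 e3 el es [vv|e4].
    by have [-> -> ->] := el vv; rewrite vv e3.
  by rewrite vE vE' e1 e2 e3 (es e4).
have uP u : uniq (Pu u).
  rewrite map_inj_in_uniq ?class_pairs_uniq// => z z' hz hz' e.
  by apply: (pair_eq u) => //; left.
have uQ u : uniq (Qu u).
  rewrite map_inj_in_uniq ?class_pairs_uniq// => z z' hz hz' e.
  by apply: (pair_eq u) => //; right.
have step u : u \in us -> (\sum_(z <- class_pairs th vs u) a z.1 * b (config_src z.2)) ^+ 2 <=
    \sum_(v <- vs) \sum_(w <- ws) a v ^+ 2 * b w ^+ 2 * ((v \in Pu u) && (w \in Qu u))%:R.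
  move=> uus'; apply: le_trans (sum_cauchy_schwarz _ _ _) _.
  have -> : \sum_(z <- class_pairs th vs u) a z.1 ^+ 2 = \sum_(v <- Pu u) a v ^+ 2.
    by rewrite big_map.
  have -> : \sum_(z <- class_pairs th vs u) b (config_src z.2) ^+ 2 = \sum_(w <- Qu u) b w ^+ 2.
    by rewrite big_map.
  have -> : \sum_(v <- vs) \sum_(w <- ws) a v ^+ 2 * b w ^+ 2 * ((v \in Pu u) && (w \in Qu u))%:R =
     (\sum_(v <- [seq v <- vs | v \in Pu u]) a v ^+ 2) *
     (\sum_(w <- [seq w <- ws | w \in Qu u]) b w ^+ 2).
    rewrite big_filter mulr_suml [RHS]big_mkcond; apply: eq_bigr => v _.
    case: (v \in Pu u) => /=; last by rewrite big1// => w _; rewrite mulr0.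
    rewrite big_filter mulr_sumr [RHS]big_mkcond; apply: eq_bigr => w _.
    by case: (w \in Qu u); rewrite ?mulr1 ?mulr0.
  apply: ler_pM; try by apply: sumr_ge0 => i _; exact: sqr_ge0.
    apply: sum_subseq_le => [v|//|v vP]; first exact: sqr_ge0.
    by rewrite mem_filter vP; case/mapP: vP => z /class_pairsP[zv _ _] ->.
  apply: sum_subseq_le => [v|//|w wQ]; first exact: sqr_ge0.
  rewrite mem_filter wQ mem_undup; apply/flattenP; exists (Qu u) => //.
  exact: map_f.
rewrite big_seq; apply: le_trans (ler_sum _ step) _; rewrite -big_seq.
rewrite exchange_big /= mulr_suml; apply: ler_sum => v _.
rewrite exchange_big /=; under eq_bigr do rewrite -mulr_sumr.
apply: (@le_trans _ _ (\sum_(w <- ws) a v ^+ 2 * b w ^+ 2)).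
  apply: ler_sum => w _; rewrite -[leRHS]mulr1 ler_wpM2l ?mulr_ge0 ?sqr_ge0//.
  apply: sum_indicator_le1 => // u u' _ _.
  move=> /andP[/mapP[z1 h1 v1] /mapP[z2 h2 w2]] /andP[/mapP[z1' h1' v1'] /mapP[z2' h2' w2']].
  have [_ k1 _] := class_pairsP h1; have [_ k2 _] := class_pairsP h2.
  have [_ k1' _] := class_pairsP h1'; have [_ k2' _] := class_pairsP h2'.
  have [a1 [a2 a3]] := config_target_uniq k1 k2 (same _ _ _ _ h1 h2).
  rewrite -v1 in k1; rewrite -v1' in k1'.
  have a4 := config_left_uniq k1 k1' (same _ _ _ _ h1 h1').
  have [_ [_ a5]] := config_src_uniq k2 k2' (same _ _ _ _ h2 h2') (etrans (esym w2) w2').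
  have [a1' [a2' a3']] := config_target_uniq k1' k2' (same _ _ _ _ h1' h2').
  case: (z1.2) (z2.2) (z1'.2) (z2'.2) k1 k1' a1 a2 a3 a4 a5 a1' a2' a3' {k2 k2'}
    => [[[x1 g1] y1] t1] [[[x2 g2] y2] t2] [[[x3 g3] y3] t3] [[[x4 g4] y4] t4].
  move=> [_ _ uE _ _] [_ _ uE' _ _] /= _ _ e1 [e2 e3 _] e4 _ _ e5.
  by rewrite uE uE' e1 e2 e3 e4 e5.
by rewrite -mulr_sumr ler_wpM2l ?sqr_ge0// hB// undup_uniq.
Qed.

Lemma class_sum_total (F : W * config -> R) vs u :
  \sum_(v <- vs) \sum_(k <- configs_of v u) F (v, k) =
  \sum_(th : counts * counts * counts) \sum_(z <- class_pairs th vs u) F z.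
Proof.
under [RHS]eq_bigr do rewrite /class_pairs big_filter.
rewrite (exchange_big_dep xpredT)//= big_allpairs_dep.
apply: eq_bigr => v _; apply: eq_bigr => k _.
by rewrite (bigD1 (config_class k))//= big1 ?addr0// => th /andP[/eqP->]; rewrite eqxx.
Qed.

End ClassSum.

Definition decay_bound (d : nat) : R := ((d.+1 ^ #|S|) ^ 3)%:R.

Lemma card_counts d : #|{: counts d * counts d * counts d}| = ((d.+1 ^ #|S|) ^ 3)%N.
Proof. by rewrite !card_prod !card_ffun card_ord !expnS expn0 muln1 mulnA. Qed.

(** Haagerup's inequality: every class of configurations acts with norm at most
    the 2-norm of [T], and the number of classes is polynomial in the degree. *)
Theorem rapid_decay d T : hecke_poly d T ->
  bounded_by (decay_bound d * l2norm (T (delta 1%g))) T.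
Proof.
move=> pT f; set x := T (delta 1%g); set vs := lenball d.
pose a v := normc (x v); pose b w := normc (f w).
have pt u : normc (T f u) <= \sum_(v <- vs) \sum_(k <- configs_of v u) a v * b (config_src k).
  rewrite (hecke_poly_expand pT) sum_opE l2_sum.
  have -> : \sum_(v <- lenball d) (T (delta 1%g) v *: hecke_word (redword v)) f u =
     \sum_(v <- vs) x v * hecke_word (redword v) f u by [].
  elim: vs => [|v r IH]; first by rewrite !big_nil normc0.
  rewrite !big_cons (le_trans (le_normcD _ _))// lerD// normcM -mulr_sumr.
  by rewrite ler_wpM2l ?normc_ge0// hecke_word_le// reduced_redword.
have N0 : 0 <= decay_bound d by [].
rewrite -(@ler_pXn2r _ 2) ?nnegrE ?mulr_ge0 ?l2norm_ge0//.
rewrite -lee_fin sqr_l2normE; apply: l2sqnorm_le_sum => us uus.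
have pu u : normc (T f u) ^+ 2 <= decay_bound d * \sum_(th : counts d * counts d * counts d)
   (\sum_(z <- class_pairs th vs u) a z.1 * b (config_src z.2)) ^+ 2.
  have := pt u; rewrite (@class_sum_total d (fun z => a z.1 * b (config_src z.2))) => h.
  apply: (@le_trans _ _ ((\sum_(th : counts d * counts d * counts d)
     \sum_(z <- class_pairs th vs u) a z.1 * b (config_src z.2)) ^+ 2)).
    rewrite lerXn2r// ?nnegrE ?normc_ge0// sumr_ge0// => th _; rewrite sumr_ge0// => z _.
    by rewrite mulr_ge0// normc_ge0.
  apply: le_trans (sqr_sum_le _ _) _.
  by rewrite /index_enum -enumT -cardE card_counts.
apply: le_trans (ler_sum _ (fun u _ => pu u)) _.
rewrite -mulr_sumr exchange_big /=.
rewrite (_ : (_ * _) ^+ 2 = decay_bound d * (decay_bound d * (l2norm x ^+ 2 * l2norm f ^+ 2))); last by ring.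
apply: ler_wpM2l => //.
apply: (@le_trans _ _ (\sum_(th : counts d * counts d * counts d) l2norm x ^+ 2 * l2norm f ^+ 2)).
  apply: ler_sum => th _.
  apply: le_trans (@class_sum_le d a b _ _ th vs us (lenball_uniq d) uus _ (l2norm f ^+ 2) _) _.
  - by move=> v; exact: normc_ge0.
  - by move=> w; exact: normc_ge0.
  - by move=> v; rewrite mem_lenball.
  - by move=> ws uws; exact: sum_le_l2norm.
  rewrite ler_wpM2r ?sqr_ge0//; apply: sum_le_l2norm; exact: lenball_uniq.
by rewrite big_const card_counts iter_addr addr0 mulr_natl.
Qed.

(** * Conjugation by symmetries *)

Lemma l2norm_le (f g : H) : (forall v, normc (f v) <= normc (g v)) -> l2norm f <= l2norm g.
Proof.
move=> h; rewrite -(@ler_pXn2r _ 2) ?nnegrE ?l2norm_ge0// -lee_fin sqr_l2normE.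
apply: l2sqnorm_le_sum => X uX; apply: le_trans (sum_le_l2norm g uX).
by apply: ler_sum => w _; rewrite lerXn2r ?nnegrE ?normc_ge0.
Qed.

Lemma lmul_adjoint s : is_adjoint (lmul_op s) (lmul_op s).
Proof. exact: involution_self_adjoint (lmul_inv s). Qed.
Lemma rmul_adjoint s : is_adjoint (rmul_op s) (rmul_op s).
Proof. exact: involution_self_adjoint (rmul_inv s). Qed.
Lemma lweight_adjoint s a b : is_adjoint (lweight s a b) (lweight s a b).
Proof. exact: (mul_self_adjoint (fun v => if_le (desc s v) a b)). Qed.
Lemma rweight_adjoint s a b : is_adjoint (rweight s a b) (rweight s a b).
Proof. exact: (mul_self_adjoint (fun v => if_le (rdesc s v) a b)). Qed.

Lemma lmul_norm s f : l2norm (lmul_op s f) = l2norm f.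
Proof. exact: translation_isometry (inv_bij (lmul_inv s)) f. Qed.
Lemma rmul_norm s f : l2norm (rmul_op s f) = l2norm f.
Proof. exact: translation_isometry (inv_bij (rmul_inv s)) f. Qed.

(** Twice [T_s - p_s / 2]. The quadratic relation gives it the scalar square
    [4 + p_s ^+ 2], so it is a multiple of a self-adjoint unitary of the Hecke
    algebra; [Zop] is its right-handed counterpart. *)
Definition Yop (s : S) : op := locked (lweight s (p s) (- p s) + (2 : C) *: lmul_op s).
Definition Zop (s : S) : op := locked (rweight s (p s) (- p s) + (2 : C) *: rmul_op s).

Lemma YopW s : Yop s = lweight s (p s) (- p s) + (2 : C) *: lmul_op s.
Proof. by rewrite /Yop -lock. Qed.
Lemma ZopW s : Zop s = rweight s (p s) (- p s) + (2 : C) *: rmul_op s.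
Proof. by rewrite /Zop -lock. Qed.

Lemma YopE s f v : Yop s f v = (if desc s v then p s else - p s)%:C * f v + 2 * f (gen s * v)%g.
Proof. by rewrite YopW -[LHS]/(lweight s (p s) (- p s) f v + 2 * lmul_op s f v) lweightE lmul_opE. Qed.
Lemma ZopE s f v : Zop s f v = (if rdesc s v then p s else - p s)%:C * f v + 2 * f (v * gen s)%g.
Proof. by rewrite ZopW -[LHS]/(rweight s (p s) (- p s) f v + 2 * rmul_op s f v) rweightE rmul_opE. Qed.

Lemma YopL s : Yop s = (2 : C) *: Lop s + (- p s)%:C *: idfun.
Proof.
apply/funext => f; apply: l2_eq => v; rewrite YopE.
rewrite -[RHS]/(2 * Lop s f v + (- p s)%:C * f v) LopE.
by case: (desc s v); rewrite ?(realcD, rmorphN) /=; rewrite ?rmorphN /=; ring.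
Qed.

Lemma ZopR s : Zop s = (2 : C) *: Rop s + (- p s)%:C *: idfun.
Proof.
apply/funext => f; apply: l2_eq => v; rewrite ZopE.
rewrite -[RHS]/(2 * Rop s f v + (- p s)%:C * f v) RopE.
by case: (rdesc s v); rewrite ?rmorphN /=; ring.
Qed.

Lemma Yop_bounded s : bounded_op (Yop s).
Proof. by rewrite YopW; apply: bounded_D; [exact: lweight_bounded|apply: bounded_Z; exact: lmul_bounded]. Qed.
Lemma Zop_bounded s : bounded_op (Zop s).
Proof. by rewrite ZopW; apply: bounded_D; [exact: rweight_bounded|apply: bounded_Z; exact: rmul_bounded]. Qed.

Lemma conj2 : (2 : C)^* = 2. Proof. exact: rmorph_nat. Qed.

Lemma Yop_adjoint s : is_adjoint (Yop s) (Yop s).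
Proof.
rewrite YopW; apply: adjD; first exact: lweight_adjoint.
by rewrite -{2}conj2; apply: adjZ; exact: lmul_adjoint.
Qed.
Lemma Zop_adjoint s : is_adjoint (Zop s) (Zop s).
Proof.
rewrite ZopW; apply: adjD; first exact: rweight_adjoint.
by rewrite -{2}conj2; apply: adjZ; exact: rmul_adjoint.
Qed.

Definition Ksq (s : S) : R := 4 + p s ^+ 2.
Lemma Ksq_gt0 s : 0 < Ksq s. Proof. by rewrite ltr_wpDr// sqr_ge0. Qed.

Lemma KsqE s : (Ksq s)%:C = 4 + (p s)%:C ^+ 2 :> C.
Proof. by rewrite /Ksq realcD (rmorph_nat (real_complex R)) expr2 realcM. Qed.

Lemma YY s f : Yop s (Yop s f) = (Ksq s)%:C *: f.
Proof.
apply: l2_eq => v; rewrite !YopE l2Z KsqE genK desc_gen.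
by case: (desc s v) => /=; rewrite ?rmorphN /=; ring.
Qed.

Lemma rdesc_gen s v : rdesc s (v * gen s)%g = ~~ rdesc s v.
Proof. by rewrite /rdesc invgM genV desc_gen. Qed.

Lemma ZZ s f : Zop s (Zop s f) = (Ksq s)%:C *: f.
Proof.
apply: l2_eq => v; rewrite !ZopE l2Z KsqE genKr rdesc_gen.
by case: (rdesc s v) => /=; rewrite ?rmorphN /=; ring.
Qed.

Lemma Yop_norm s f : l2norm (Yop s f) ^+ 2 = Ksq s * l2norm f ^+ 2.
Proof.
by apply: (@complexI R); rewrite -inner_self Yop_adjoint YY innerZr inner_self conjc_real -realcM.
Qed.
Lemma Zop_norm s f : l2norm (Zop s f) ^+ 2 = Ksq s * l2norm f ^+ 2.
Proof.
by apply: (@complexI R); rewrite -inner_self Zop_adjoint ZZ innerZr inner_self conjc_real -realcM.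
Qed.

Definition Kinv (s : S) : C := (Ksq s)^-1%:C.
Lemma normc_Kinv s : normc (Kinv s) = (Ksq s)^-1.
Proof. by rewrite normc_real ger0_norm// invr_ge0 ltW// Ksq_gt0. Qed.
Lemma KinvK s : Kinv s * (Ksq s)%:C = 1.
Proof. by rewrite /Kinv -realcM mulVf// gt_eqF// Ksq_gt0. Qed.

Lemma KinvKl s (z : C) : Kinv s * ((Ksq s)%:C * z) = z.
Proof. by rewrite mulrA KinvK mul1r. Qed.

(** On the vectors [T (delta 1)] conjugation of [T] by the symmetry of [s] becomes
    the unitary [conj_vec s]; at [p = 0] it is the permutation [perm_vec s] of the
    coordinates by conjugation with [gen s]. *)
Definition conj_vec (s : S) : op := locked (fun f => Kinv s *: Yop s (Zop s f)).
Definition perm_vec (s : S) : op := locked (fun f => lmul_op s (rmul_op s f)).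

Lemma conj_vecE s f : conj_vec s f = Kinv s *: Yop s (Zop s f).
Proof. by rewrite /conj_vec -lock. Qed.

Lemma conj_vec_bounded s : bounded_op (conj_vec s).
Proof.
rewrite /conj_vec -lock; apply: (@bounded_Z R W (Kinv s) (Yop s \o Zop s)).
by apply: bounded_comp; [exact: Yop_bounded|exact: Zop_bounded].
Qed.
Lemma conj_vec_norm s f : l2norm (conj_vec s f) = l2norm f.
Proof.
apply/eqP; rewrite -(@eqrXn2 _ 2) ?l2norm_ge0//; apply/eqP.
rewrite conj_vecE l2normZ exprMn Yop_norm Zop_norm normc_Kinv.
by field; rewrite gt_eqF// Ksq_gt0.
Qed.

Lemma perm_vec_norm s f : l2norm (perm_vec s f) = l2norm f.
Proof. by rewrite /perm_vec -lock lmul_norm rmul_norm. Qed.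

Lemma perm_vecE s f v : perm_vec s f v = f (gen s * v * gen s)%g.
Proof. by rewrite /perm_vec -lock lmul_opE rmul_opE. Qed.

Lemma conj_vec1 s f : conj_vec s f 1%g = f 1%g.
Proof.
rewrite conj_vecE l2Z YopE !ZopE !(mulg1, mul1g) gen2 desc1 /rdesc invg1 desc1 genV.
have -> : desc s (gen s) by rewrite -[gen s]mulg1 desc_gen desc1.
rewrite -[RHS](KinvKl s) KsqE; congr (_ * _).
by rewrite rmorphN /=; ring.
Qed.

(** The difference is explicit: every term carries a factor [p s]. *)
Lemma conj_perm_dist s f : l2norm (conj_vec s f - perm_vec s f) <= 2 * `|p s| * l2norm f.
Proof.
set E := lweight s 1 (-1); set E' := rweight s 1 (-1).
have nE g : l2norm (E g) <= l2norm g.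
  apply: l2norm_le => v; rewrite lweightE normcM normc_real.
  by case: (desc s v); rewrite ?normrN normr1 mul1r.
have nE' g : l2norm (E' g) <= l2norm g.
  apply: l2norm_le => v; rewrite rweightE normcM normc_real.
  by case: (rdesc s v); rewrite ?normrN normr1 mul1r.
have -> : conj_vec s f - perm_vec s f = Kinv s *:
    ((p s ^+ 2)%:C *: (E (E' f) - perm_vec s f) +
     (2 * p s)%:C *: (E (rmul_op s f) + lmul_op s (E' f))).
  rewrite conj_vecE; apply: l2_eq => v.
  have yz : Yop s (Zop s f) v = (if desc s v then p s else - p s)%:C *
      ((if rdesc s v then p s else - p s)%:C * f v + 2 * f (v * gen s)%g) +
      2 * ((if rdesc s (gen s * v)%g then p s else - p s)%:C * f (gen s * v)%g +
      2 * f (gen s * v * gen s)%g) by rewrite YopE !ZopE.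
  have ee : E (E' f) v = (if desc s v then 1 else -1)%:C * ((if rdesc s v then 1 else -1)%:C * f v).
    by rewrite lweightE rweightE.
  have er : E (rmul_op s f) v = (if desc s v then 1 else -1)%:C * f (v * gen s)%g.
    by rewrite lweightE rmul_opE.
  have le : lmul_op s (E' f) v = (if rdesc s (gen s * v)%g then 1 else -1)%:C * f (gen s * v)%g.
    by rewrite lmul_opE rweightE.
  have eq (a b c d e : C) :
     a = (if desc s v then p s else - p s)%:C *
      ((if rdesc s v then p s else - p s)%:C * f v + 2 * f (v * gen s)%g) +
      2 * ((if rdesc s (gen s * v)%g then p s else - p s)%:C * f (gen s * v)%g +
      2 * f (gen s * v * gen s)%g) ->
     b = f (gen s * v * gen s)%g ->
     c = (if desc s v then 1 else -1)%:C * ((if rdesc s v then 1 else -1)%:C * f v) ->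
     d = (if desc s v then 1 else -1)%:C * f (v * gen s)%g ->
     e = (if rdesc s (gen s * v)%g then 1 else -1)%:C * f (gen s * v)%g ->
     Kinv s * a - b = Kinv s * ((p s ^+ 2)%:C * (c - b) + (2 * p s)%:C * (d + e)).
    move=> -> -> -> -> ->.
    rewrite -[X in _ - X](KinvKl s) -mulrBr; congr (_ * _).
    rewrite KsqE (realcM (p s) (p s)) (realcM 2 (p s)) (rmorph_nat (real_complex R)).
    case: (desc s v); case: (rdesc s v); case: (rdesc s (gen s * v)%g);
      rewrite ?rmorphN ?rmorph1 /=; ring.
  exact: eq yz (perm_vecE s f v) ee er le.
rewrite l2normZ normc_Kinv.
have nf := l2norm_ge0 f.
have n1 : l2norm ((p s ^+ 2)%:C *: (E (E' f) - perm_vec s f)) <= p s ^+ 2 * (2 * l2norm f).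
  rewrite l2normZ normc_real ger0_norm ?sqr_ge0// ler_wpM2l ?sqr_ge0//.
  rewrite (le_trans (l2normB _ _))// perm_vec_norm mulrDl mul1r lerD2r.
  exact: le_trans (nE _) (nE' _).
have n2 : l2norm ((2 * p s)%:C *: (E (rmul_op s f) + lmul_op s (E' f))) <=
    2 * `|p s| * (2 * l2norm f).
  rewrite l2normZ normc_real normrM ger0_norm// ler_wpM2l ?mulr_ge0//.
  rewrite (le_trans (l2normD _ _))// mulrDl mul1r lmul_norm.
  by rewrite lerD// (le_trans (nE _))// rmul_norm.
rewrite -ler_pdivlMl ?invr_gt0 ?Ksq_gt0// invrK.
apply: le_trans (l2normD _ _) _; apply: le_trans (lerD n1 n2) _.
have a1 := p_le1 s; have a0 := normr_ge0 (p s).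
have -> : p s ^+ 2 = `|p s| ^+ 2 by rewrite real_normK ?num_real.
have -> : Ksq s = 4 + `|p s| ^+ 2 by rewrite /Ksq real_normK ?num_real.
set t := `|p s| in a1 a0 *; set F := l2norm f in nf *.
have -> : t ^+ 2 * (2 * F) + 2 * t * (2 * F) = (2 * t ^+ 2 + 4 * t) * F by ring.
rewrite [leRHS]mulrA; apply: ler_wpM2r => //.
exact: cubic_bound.
Qed.

Definition conj_word_vec (r : seq S) : op := foldr (fun s T => conj_vec s \o T) idfun r.
Definition perm_word_vec (r : seq S) : op := foldr (fun s T => perm_vec s \o T) idfun r.

Lemma conj_word_vec_norm r f : l2norm (conj_word_vec r f) = l2norm f.
Proof. by elim: r => //= s r IH; rewrite conj_vec_norm. Qed.
Lemma perm_word_vec_norm r f : l2norm (perm_word_vec r f) = l2norm f.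
Proof. by elim: r => //= s r IH; rewrite perm_vec_norm. Qed.

Lemma conj_word_vec1 r f : conj_word_vec r f 1%g = f 1%g.
Proof.
elim: r => // s r IH.
by rewrite -[LHS]/(conj_vec s (conj_word_vec r f) 1%g) conj_vec1.
Qed.

Lemma perm_word_vecE r f v : perm_word_vec r f v = f ((prod r)^-1 * v * prod r)%g.
Proof.
elim: r v => [|s r IH] v; first by rewrite prod_nil invg1 mul1g mulg1.
by rewrite /= perm_vecE IH prod_cons invgM genV !mulgA.
Qed.

Lemma conj_perm_word_dist (e : R) r f : (forall s, 2 * `|p s| <= e) ->
  l2norm (conj_word_vec r f - perm_word_vec r f) <= (size r)%:R * e * l2norm f.
Proof.
move=> pe; elim: r => [|s r IH] /=; first by rewrite subrr l2norm0 !mul0r.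
apply: le_trans (l2norm_distD _ (conj_vec s (perm_word_vec r f)) _) _.
rewrite -(opB (conj_vec_bounded s)) conj_vec_norm.
rewrite -natr1 mulrDl mulrDl mul1r; apply: lerD => //.
apply: le_trans (conj_perm_dist s _) _; rewrite perm_word_vec_norm.
by rewrite ler_wpM2r// l2norm_ge0.
Qed.

(** * Spectral gap *)

Definition indic (P : pred W) : op := weighted (fun v => (P v)%:R) id.

Lemma indic_le (P : pred W) v : `|(P v)%:R| <= 1 :> R.
Proof. by case: (P v); rewrite ?normr1 ?normr0. Qed.

Lemma indicE P f v : indic P f v = if P v then f v else 0.
Proof.
rewrite /indic (weighted_spec f (@inj_id W) (indic_le P)).1.
by case: (P v); rewrite ?mul1r ?mul0r.
Qed.

Lemma indic_bounded P : bounded_op (indic P).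
Proof. exact: weighted_bounded (@inj_id W) (indic_le P). Qed.

Lemma indic_norm P f : l2norm (indic P f) <= l2norm f.
Proof.
by apply: l2norm_le => v; rewrite indicE; case: (P v); rewrite ?normc0 ?normc_ge0.
Qed.

Lemma indic_sqr P f : l2norm (indic P f) ^+ 2 = complex.Re (l2inner (indic P f) f).
Proof.
have -> : l2inner (indic P f) f = (l2norm (indic P f) ^+ 2)%:C; last by [].
rewrite -inner_self -[RHS](mul_self_adjoint (indic_le P)).
by congr l2inner; apply: l2_eq => v; rewrite -/(indic P) !indicE; case: (P v).
Qed.

Lemma Re_add (z z' : C) : complex.Re (z + z') = complex.Re z + complex.Re z'.
Proof. by case: z z' => u v [u' v']. Qed.

Section Gap.
Variables (s t : S) (a : bool -> 'I_3 -> seq S) (E : 'I_3 -> W -> bool).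
Hypothesis st : linked s t.
Hypothesis E_disj : forall w, (\sum_(i < 3) E i w <= 1)%N.
Hypothesis aE : forall (b : bool) i w, w <> 1%g -> ~~ desc (if b then s else t) w ->
  E i (prod (a b i) * w * (prod (a b i))^-1)%g.

(** Let [F b] be the part of [f] on the elements not starting with the [b]-th of
    the letters [s], [t]; the two parts cover [f]. The three permutations move
    [F b] into disjoint sets, so if [f] were almost invariant then
    [3 * |F b|^2] would be at most about [5/4 * |f|^2], and adding the two bounds
    contradicts [5/2 < 3]. *)
Lemma perm_gap (f : H) : f 1%g = 0 ->
  l2norm f ^+ 2 <=
  10 * \sum_(j : bool * 'I_3) l2norm (perm_word_vec (a j.1 j.2) f - f) ^+ 2.
Proof.
move=> f1; pose c (b : bool) := if b then s else t.
pose F b := indic (fun v => ~~ desc (c b) v) f.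
have sumE : \sum_(i < 3) l2norm (indic (E i) f) ^+ 2 <= l2norm f ^+ 2.
  have -> : \sum_(i < 3) l2norm (indic (E i) f) ^+ 2 =
      complex.Re (l2inner (indic (fun v => [exists i, E i v]) f) f).
    have -> : indic (fun v => [exists i, E i v]) f = \sum_(i < 3) indic (E i) f.
      apply: l2_eq => v; rewrite l2_sum indicE; under eq_bigr do rewrite indicE.
      case: ifPn => [/existsP[i Ei]|/existsPn nE].
        rewrite (bigD1 i)//= Ei big1 ?addr0// => k ki.
        have := E_disj v; rewrite (bigD1 i)//= Ei (bigD1 k)//=.
        by case: (E k v).
      by rewrite big1// => i _; rewrite (negPf (nE i)).
    rewrite !big_ord_recr !big_ord0 /= !add0r !innerDl !Re_add.
    by congr (_ + _ + _); exact: indic_sqr.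
  apply: le_trans (Re_le_normc _) _; apply: le_trans (cauchy_schwarz _ _) _.
  by rewrite expr2 ler_wpM2r ?l2norm_ge0// indic_norm.
have sumF : l2norm f ^+ 2 <= l2norm (F true) ^+ 2 + l2norm (F false) ^+ 2.
  have -> : l2norm (F true) ^+ 2 + l2norm (F false) ^+ 2 =
     complex.Re (l2inner (F true) f) + complex.Re (l2inner (F false) f).
    by congr (_ + _); exact: indic_sqr.
  rewrite -Re_add -innerDl /F.
  have -> : indic (fun v => ~~ desc (c true) v) f + indic (fun v => ~~ desc (c false) v) f =
      f + indic (fun v => ~~ desc s v && ~~ desc t v) f.
    apply: l2_eq => v; rewrite !l2D !indicE /=.
    have [ds|_] /= := boolP (desc s v); last by [].
    have -> /= : ~~ desc t v by apply: contraT; rewrite negbK => dt;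
      case/negP: (linked_ndesc st dt).
    by rewrite addrC.
  rewrite innerDl Re_add inner_self -(indic_sqr (fun v => ~~ desc s v && ~~ desc t v) f) lerDl.
  exact: sqr_ge0.
have step b i : l2norm (F b) ^+ 2 <= 5 / 4 * l2norm (indic (E i) f) ^+ 2 +
    5 * l2norm (perm_word_vec (a b i) f - f) ^+ 2.
  set D := perm_word_vec (a b i) f - f.
  have le : l2norm (F b) <= l2norm (indic (E i) f) + l2norm D.
    rewrite -(perm_word_vec_norm (a b i)).
    apply: (@le_trans _ _ (l2norm (indic (E i) (perm_word_vec (a b i) f)))).
      apply: l2norm_le => v; rewrite perm_word_vecE !indicE perm_word_vecE.
      set w := (_ * v * _)%g.
      case: ifPn => dw; last by rewrite normc0 normc_ge0.
      have [w1|w1] := eqVneq w 1%g; first by rewrite w1 f1 normc0; case: ifP; rewrite ?normc0.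
      have vE : v = (prod (a b i) * w * (prod (a b i))^-1)%g.
        by rewrite /w !mulgA mulgV mul1g mulgK.
      by rewrite {1}vE aE//; apply/eqP.
    have -> : perm_word_vec (a b i) f = f + D by rewrite /D addrC subrK.
    rewrite (opD (indic_bounded _)) (le_trans (l2normD _ _))// lerD2l.
    exact: indic_norm.
  have a0 := l2norm_ge0 (indic (E i) f); have d0 := l2norm_ge0 D.
  apply: (@le_trans _ _ ((l2norm (indic (E i) f) + l2norm D) ^+ 2)).
    by rewrite lerXn2r ?nnegrE ?addr_ge0 ?l2norm_ge0.
  exact: young_sqr.
have tot b : 3 * l2norm (F b) ^+ 2 <= 5 / 4 * l2norm f ^+ 2 +
    5 * \sum_(i < 3) l2norm (perm_word_vec (a b i) f - f) ^+ 2.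
  apply: (@le_trans _ _ (\sum_(i < 3) (5 / 4 * l2norm (indic (E i) f) ^+ 2 +
    5 * l2norm (perm_word_vec (a b i) f - f) ^+ 2))).
    apply: le_trans (ler_sum _ (fun i _ => step b i)).
    by rewrite sumr_const card_ord mulr_natl.
  by rewrite big_split -!mulr_sumr lerD2r ler_wpM2l// divr_ge0.
have -> : \sum_(j : bool * 'I_3) l2norm (perm_word_vec (a j.1 j.2) f - f) ^+ 2 =
    \sum_(i < 3) l2norm (perm_word_vec (a true i) f - f) ^+ 2 +
    \sum_(i < 3) l2norm (perm_word_vec (a false i) f - f) ^+ 2.
  by rewrite -(pair_bigA _ (fun b i => l2norm (perm_word_vec (a b i) f - f) ^+ 2)) /= big_bool.
exact: gap_arith sumF (tot true) (tot false).
Qed.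

Variable N : nat.
Hypothesis aN : forall b i, (size (a b i) <= N)%N.
Hypothesis p_small : forall r, 32 * N%:R * `|p r| <= 1.

(** The gap of the permutations survives a perturbation of size 1/16. *)
Lemma conj_gap (f : H) : f 1%g = 0 ->
  l2norm f ^+ 2 <=
  40 * \sum_(j : bool * 'I_3) l2norm (conj_word_vec (a j.1 j.2) f - f) ^+ 2.
Proof.
move=> f1; have := perm_gap f1.
have nf := l2norm_ge0 f.
have dist j : l2norm (conj_word_vec (a j.1 j.2) f - perm_word_vec (a j.1 j.2) f) <= 16^-1 * l2norm f.
  have [N0|N0] := posnP N.
    have := aN j.1 j.2; rewrite N0 leqn0 => /nilP -> /=.
    by rewrite subrr l2norm0 mulr_ge0.
  have Np : 0 < N%:R :> R by rewrite ltr0n.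
  have := @conj_perm_word_dist ((16 * N%:R)^-1) (a j.1 j.2) f.
  have h r : 2 * `|p r| <= (16 * N%:R)^-1.
    rewrite -[leRHS]mul1r ler_pdivlMr ?mulr_gt0// (le_trans _ (p_small r))//.
    by rewrite le_eqVlt; apply/orP; left; apply/eqP; ring.
  move=> /(_ h) h1; apply: le_trans h1 _; apply: ler_wpM2r => //.
  rewrite invfM mulrA mulrAC -[leRHS]mul1r ler_wpM2r ?invr_ge0//.
  by rewrite ler_pdivrMr// mul1r ler_nat.
have sq j : l2norm (perm_word_vec (a j.1 j.2) f - f) ^+ 2 <=
    2 * l2norm (conj_word_vec (a j.1 j.2) f - f) ^+ 2 + 2 / 256 * l2norm f ^+ 2.
  have := l2norm_distD (perm_word_vec (a j.1 j.2) f) (conj_word_vec (a j.1 j.2) f) f.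
  rewrite -(l2normN (_ - conj_word_vec _ _)) opprB.
  have := dist j; have := l2norm_ge0 (perm_word_vec (a j.1 j.2) f - f).
  have := l2norm_ge0 (conj_word_vec (a j.1 j.2) f - f).
  move: nf; set x := l2norm f; set y := l2norm (perm_word_vec _ _ - f).
  set z := l2norm (conj_word_vec _ _ - f); set w := l2norm _.
  move=> x0 z0 y0 wx yzw.
  by apply: sqr_le_split => //; apply: le_trans yzw _; rewrite lerD2r.
by move=> h; exact: gap_arith2 (sqr_ge0 _) h (sum_six_le sq).
Qed.

End Gap.

(** * The Hecke algebra and its completion *)

Local Notation A := (hecke_cstar gen q).
Definition hecke_alg : set op := [set T | exists d, hecke_poly d T].

Lemma is_hecke_op_unique s T : is_hecke_op gen q s T -> T = Lop s.
Proof.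
move=> [bT hT]; have [bL hL] := Lop_hecke s; apply: delta_ext => // w.
have [d|nd] := boolP (desc s w); first by rewrite (hT w).2// (hL w).2.
have lt : (len w < len (gen s * w)%g)%N by rewrite len_ndesc.
by rewrite (hT w).1// (hL w).1.
Qed.

Lemma approximable_sub (B : set op) T : B T -> approximable B T.
Proof.
move=> BT e e0; exists T => //; rewrite subrr => f.
by rewrite [l2norm _]l2norm0 mulr_ge0 ?l2norm_ge0// ltW.
Qed.

Lemma hecke_alg_lin (c : C) T U : hecke_alg T -> hecke_alg U -> hecke_alg (c *: T + U).
Proof.
move=> [d pT] [e pU]; exists (maxn d e); apply: HeckeLin.
  by apply: hecke_poly_widen pT; exact: leq_maxl.
by apply: hecke_poly_widen pU; exact: leq_maxr.
Qed.

Lemma hecke_alg_comp T U : hecke_alg T -> hecke_alg U -> hecke_alg (T \o U).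
Proof. by move=> [d pT] [e pU]; exists (d + e)%N; exact: hecke_poly_comp. Qed.

Lemma hecke_alg_bounded T : hecke_alg T -> bounded_op T.
Proof. by move=> [d /hecke_poly_bounded]. Qed.

Lemma split_lin (c : C) (T U T' U' : op) :
  (c *: T + U) - (c *: T' + U') = c *: (T - T') + (U - U').
Proof. by rewrite scalerBr opprD addrACA. Qed.

Lemma split_comp (T U T' U' : op) : bounded_op T' ->
  (T \o U) - (T' \o U') = ((T - T') \o U) + (T' \o (U - U')).
Proof.
move=> bT'; apply/funext => f.
rewrite -[LHS]/(T (U f) - T' (U' f)) -[RHS]/((T (U f) - T' (U f)) + T' (U f - U' f)).
by rewrite (opB bT') addrA subrK.
Qed.

Lemma hecke_closure_cstar :
  unital_cstar_subalgebra [set T | bounded_op T /\ approximable hecke_alg T].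
Proof.
split.
- by move=> T [].
- by split; [exact: bounded_id|apply: approximable_sub; exists 0; exact: HeckeOne].
- move=> c T U [bT hT] [bU hU]; split; first exact: bounded_lin.
  move=> e e0; have n0 : 0 < normc c + 1 by rewrite ltr_wpDl ?normc_ge0.
  have [T' aT' hT'] := hT (e / 2 / (normc c + 1)) (divr_gt0 (divr_gt0 e0 (ltr0n _ 2)) n0).
  have [U' aU' hU'] := hU (e / 2) (divr_gt0 e0 (ltr0n _ 2)).
  exists (c *: T' + U'); first exact: hecke_alg_lin.
  rewrite split_lin; apply: bounded_by_le (bounded_byD (bounded_byZ c hT') hU').
  rewrite [leRHS](splitr e) lerD2r mulrA ler_pdivrMr// mulrC.
  by rewrite ler_wpM2l ?divr_ge0 ?(ltW e0)// lerDl.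
- move=> T U [bT hT] [bU hU]; split; first exact: bounded_comp.
  move=> e e0; have [M M0 hM] := bounded_by_ge0 bU.
  have M1 : 0 < M + 1 by rewrite ltr_wpDl.
  have [T' aT' hT'] := hT (e / 2 / (M + 1)) (divr_gt0 (divr_gt0 e0 (ltr0n _ 2)) M1).
  have bT' := hecke_alg_bounded aT'; have [K K0 hK] := bounded_by_ge0 bT'.
  have K1 : 0 < K + 1 by rewrite ltr_wpDl.
  have [U' aU' hU'] := hU (e / 2 / (K + 1)) (divr_gt0 (divr_gt0 e0 (ltr0n _ 2)) K1).
  exists (T' \o U'); first exact: hecke_alg_comp.
  rewrite split_comp//.
  have h1 := bounded_by_comp (ltW (divr_gt0 (divr_gt0 e0 (ltr0n _ 2)) M1)) hT' hM.
  apply: bounded_by_le (bounded_byD h1 (bounded_by_comp K0 hK hU')).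
  rewrite [leRHS](splitr e); apply: lerD.
    rewrite mulrAC ler_pdivrMr// ler_wpM2l ?divr_ge0 ?(ltW e0)// lerDl.
    by [].
  rewrite mulrA ler_pdivrMr// mulrC ler_wpM2l ?divr_ge0 ?(ltW e0)// lerDl.
  by [].
- move=> T T' [bT hT] bT' adj; split; first exact: bT'.
  move=> e e0; have [U [d pU] hU] := hT e e0.
  have [U' pU' adjU] := hecke_poly_adjoint pU; exists U'; first by exists d.
  exact: adj_bounded_by (ltW e0) (adjB adj adjU) hU.
move=> T bT /op_closureP h; split; first exact: bT.
move=> e e0.
have [U [bU hU] hTU] := h bT (fun U => @proj1 _ _) (e / 2) (divr_gt0 e0 (ltr0n _ 2)).
have [V aV hV] := hU (e / 2) (divr_gt0 e0 (ltr0n _ 2)); exists V; first exact: aV.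
have -> : T - V = (T - U) + (U - V) by rewrite addrA subrK.
by rewrite (splitr e); exact: bounded_byD.
Qed.

Lemma hecke_cstar_approx T : A T -> bounded_op T /\ approximable hecke_alg T.
Proof.
move=> /(_ _ hecke_closure_cstar); apply=> U [s /is_hecke_op_unique ->]; split.
  exact: Lop_bounded.
by apply: approximable_sub; exists 1%N; have := HeckeMulL s HeckeOne.
Qed.

Lemma hecke_poly_cstar d T : hecke_poly d T -> A T.
Proof.
move=> pT B cB GB; have BL s : B (Lop s) by apply: GB; exists s; exact: Lop_hecke.
elim: pT => {d T} [|d c T U _ BT _ BU|d T _ BT|d s T _ BT|d s T _ BT] //.
- exact: (cstar_unit cB).
- exact: (cstar_lin cB).
- exact: (cstar_mul cB).
- exact: (cstar_mul cB).
Qed.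

Lemma hecke_cstarP : unital_cstar_subalgebra A.
Proof.
split.
- by move=> T /hecke_cstar_approx[].
- exact: hecke_poly_cstar HeckeOne.
- by move=> c T U AT AU B cB GB; apply: (cstar_lin cB); [exact: AT|exact: AU].
- by move=> T U AT AU B cB GB; apply: (cstar_mul cB); [exact: AT|exact: AU].
- by move=> T T' AT bT' adj B cB GB; apply: (cstar_adj cB _ bT' adj); exact: AT.
move=> T bT /op_closureP h B cB GB; apply: (cstar_approx cB bT) => e e0.
have [U AU hU] := h bT (fun U AU => (hecke_cstar_approx AU).1) e e0.
by exists U => //; exact: AU.
Qed.

Lemma hecke_cstar_bounded T : A T -> bounded_op T.
Proof. by move=> /hecke_cstar_approx[]. Qed.

Lemma l2norm_small (f : H) : (forall e : R, 0 < e -> l2norm f <= e) -> f = 0.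
Proof.
move=> h; apply: l2norm_eq0; apply/eqP; rewrite eq_le l2norm_ge0 andbT.
by apply/ler_addgt0Pr => e e0; rewrite add0r; exact: h.
Qed.

Lemma hecke_cstar_right T : A T -> commutes_right T.
Proof.
move=> /hecke_cstar_approx[bT h] t f; apply/eqP; rewrite -subr_eq0; apply/eqP.
have bR := Rop_bounded t; have [M M0 hM] := bounded_by_ge0 bR.
pose K := l2norm (Rop t f) + M * l2norm f + 1.
have K0 : 0 < K by rewrite ltr_wpDl// addr_ge0 ?mulr_ge0 ?l2norm_ge0.
apply: l2norm_small => e e0.
have [U [d pU] hU] := h (e / K) (divr_gt0 e0 K0).
have -> : T (Rop t f) - Rop t (T f) = (T - U) (Rop t f) - Rop t ((T - U) f).
  rewrite -[(T - U) (Rop t f)]/(T (Rop t f) - U (Rop t f)) (hecke_poly_right pU).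
  have -> : Rop t ((T - U) f) = Rop t (T f) - Rop t (U f) by exact: opB bR _ _.
  by rewrite opprB addrA subrK.
apply: le_trans (l2normB _ _) _.
apply: (@le_trans _ _ (e / K * l2norm (Rop t f) + M * (e / K * l2norm f))).
  apply: lerD; first exact: hU.
  by apply: le_trans (hM _) _; apply: ler_wpM2l => //; exact: hU.
rewrite mulrCA -mulrDr mulrAC ler_pdivrMr// ler_wpM2l ?(ltW e0)// lerDl.
by [].
Qed.

(** The adjoints of polynomials converging geometrically to [T] converge too. *)
Lemma hecke_cstar_adjoint T : A T -> exists2 T', A T' & is_adjoint T T'.
Proof.
move=> AT; have [bT h] := hecke_cstar_approx AT.
have hn n : exists UU : op * op, [/\ hecke_alg UU.1, hecke_alg UU.2,
    is_adjoint UU.1 UU.2 & bounded_by (2^-1 ^+ n) (T - UU.1)].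
  have [U [d pU] hU] := h _ (half_pow_gt0 R n).
  have [U' pU' adj] := hecke_poly_adjoint pU.
  by exists (U, U'); split=> //; exists d.
have [UU hUU] := choice hn.
have step n : bounded_by (2 * 2^-1 ^+ n) ((UU n.+1).2 - (UU n).2).
  have [aU aU' adj hU] := hUU n; have [aV aV' adj' hV] := hUU n.+1.
  have p0 := ltW (half_pow_gt0 R n).
  apply: adj_bounded_by (adjB adj' adj) _; first by rewrite mulr_ge0.
  have -> : (UU n.+1).1 - (UU n).1 = (T - (UU n).1) - (T - (UU n.+1).1).
    by rewrite opprB [RHS]addrC addrA subrK.
  apply: bounded_by_le (bounded_byB hU hV).
  have -> : 2 * 2^-1 ^+ n = 2^-1 ^+ n + 2^-1 ^+ n :> R by ring.
  rewrite lerD2l exprS ler_piMl//.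
  by rewrite invf_le1// ler1n.
have bU' n : bounded_op (UU n).2 by have [_ aU' _ _] := hUU n; exact: hecke_alg_bounded.
have [V bV hV] := op_complete bU' step.
have adjV : is_adjoint T V.
  apply: (@adj_limit _ _ T V (fun n => (UU n).1) (fun n => (UU n).2) (2 * 2)) => n.
  - by have [_ _ adj _] := hUU n.
  - have [_ _ _ hU] := hUU n; apply: bounded_by_le hU.
    by rewrite ler_peMl ?(ltW (half_pow_gt0 R n))// -natrM ler1n.
  - exact: hV.
by exists V => //; exact: (cstar_adj hecke_cstarP AT bV adjV).
Qed.

(** * The canonical trace *)

Definition trace0 (T : op) : C := T (delta 1%g) 1%g.

Lemma trace0_bounded_by e T : bounded_by e T -> normc (trace0 T) <= e.
Proof.
move=> eT; apply: le_trans (normc_le_l2norm _ _) _.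
by have := eT (delta 1%g); rewrite l2norm_delta mulr1.
Qed.

Lemma trace0B T U : trace0 (T - U) = trace0 T - trace0 U.
Proof. by []. Qed.

Lemma trace0_Lop s T : bounded_op T -> commutes_right T ->
  trace0 (Lop s \o T) = trace0 (T \o Lop s).
Proof.
move=> bT cT; rewrite -[LHS]/(Lop s (T (delta 1%g)) 1%g) -[RHS]/(T (Lop s (delta 1%g)) 1%g).
rewrite LopE desc1 mul0r add0r mulg1.
have -> : Lop s (delta 1%g) = Rop s (delta 1%g).
  by rewrite Lop_delta ?desc1// Rop_delta ?/rdesc ?invg1 ?desc1// mulg1 mul1g.
by rewrite cT RopE /rdesc invg1 desc1 mul0r add0r mul1g.
Qed.

(** Letters move around one at a time: [T_s (delta 1)] is also the right
    translate of [delta 1], and right operators commute with [T]. *)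
Lemma trace0_poly d U T : hecke_poly d U -> bounded_op T -> commutes_right T ->
  trace0 (U \o T) = trace0 (T \o U).
Proof.
move=> pU; elim: pU T => {d U} [|d c U V _ hU _ hV|d U _ hU|d s U pU hU|d s U pU hU] T bT cT.
- by [].
- rewrite -[LHS]/(c * trace0 (U \o T) + trace0 (V \o T)) hU// hV//.
  rewrite -[LHS]/((c *: T (U (delta 1%g)) + T (V (delta 1%g))) 1%g).
  by rewrite -(op_lin bT).
- exact: hU.
- have bU := hecke_poly_bounded pU; have cU := hecke_poly_right pU.
  rewrite -[LHS]/(trace0 (Lop s \o (U \o T))) trace0_Lop; last 2 first.
  + exact: bounded_comp.
  + by move=> t f /=; rewrite cT cU.
  rewrite -[LHS]/(trace0 (U \o (T \o Lop s))) hU//.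
    exact: bounded_comp (Lop_bounded s).
  by move=> t f /=; rewrite LR_comm cT.
have bU := hecke_poly_bounded pU; have cU := hecke_poly_right pU.
rewrite -[LHS]/(trace0 (U \o (Lop s \o T))) hU; last 2 first.
- exact: bounded_comp (Lop_bounded s) bT.
- by move=> t f /=; rewrite cT LR_comm.
rewrite -[LHS]/(trace0 (Lop s \o (T \o U))) trace0_Lop//.
  exact: bounded_comp.
by move=> t f /=; rewrite cU cT.
Qed.

Lemma normc_small (z : C) : (forall e : R, 0 < e -> normc z <= e) -> z = 0.
Proof.
move=> h; apply: eq0_normc; apply/eqP; rewrite eq_le normc_ge0 andbT.
by apply/ler_addgt0Pr => e e0; rewrite add0r; exact: h.
Qed.

Lemma trace0_comm T U : A T -> A U -> trace0 (T \o U) = trace0 (U \o T).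
Proof.
move=> AT AU; have bT := hecke_cstar_bounded AT; have bU := hecke_cstar_bounded AU.
have [_ h] := hecke_cstar_approx AT; have [M M0 hM] := bounded_by_ge0 bU.
have cU := hecke_cstar_right AU.
apply/eqP; rewrite -subr_eq0; apply/eqP; apply: normc_small => e e0.
have K0 : 0 < M + M + 1 by rewrite ltr_wpDl// addr_ge0.
have d0 := divr_gt0 e0 K0.
have [V [d pV] hV] := h _ d0; have bV := hecke_poly_bounded pV.
have -> : trace0 (T \o U) - trace0 (U \o T) = trace0 ((T - V) \o U) - trace0 (U \o (T - V)).
  have -> : trace0 (U \o (T - V)) = trace0 (U \o T) - trace0 (U \o V).
    rewrite -[RHS]/((U (T (delta 1%g)) - U (V (delta 1%g))) 1%g).
    by rewrite -(opB bU).
  rewrite -[trace0 ((T - V) \o U)]/(trace0 (T \o U) - trace0 (V \o U)).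
  by rewrite (trace0_poly pV bU cU) opprB addrA subrK.
apply: le_trans (le_normcD _ _) _; rewrite normcN.
apply: (@le_trans _ _ (e / (M + M + 1) * M + M * (e / (M + M + 1)))).
  apply: lerD; apply: trace0_bounded_by.
    exact: bounded_by_comp (ltW d0) hV hM.
  exact: bounded_by_comp M0 hM hV.
rewrite [M * _]mulrC -mulrDr mulrAC ler_pdivrMr// ler_wpM2l ?(ltW e0)// lerDl.
by [].
Qed.

Lemma trace0_state : tracial_state A trace0.
Proof.
split.
- by [].
- move=> T T' AT AT' adj; rewrite /trace0 /= -inner_deltar (adj_sym adj) inner_self.
  by rewrite ler0c sqr_ge0.
- by rewrite -[LHS]/(delta 1%g 1%g) l2deltaE eqxx.
- exact: trace0_comm.
Qed.

(** The coefficient of [T (delta 1)] at [v] is the trace of [T] multiplied by the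
    adjoint of the operator of a reduced word of [v]. *)
Lemma trace0_detects T : A T -> T <> 0 -> exists2 V, hecke_alg V & trace0 (V \o T) <> 0.
Proof.
move=> AT T0; have [v Tv] : exists v, T (delta 1%g) v <> 0.
  apply: contrapT => /forallNP h; apply: T0; apply: right_separating.
  - exact: hecke_cstar_bounded.
  - exact: bounded_zero.
  - exact: hecke_cstar_right.
  - by move=> t f; rewrite -[LHS]/(0 : H) -[RHS]/(Rop t 0) (op0 (Rop_bounded t)).
  by apply: l2_eq => v; rewrite -[RHS]/(0 : C); apply: contrapT; exact: h.
have [V pV adj] := hecke_poly_adjoint (hecke_word_poly (redword v)).
exists V; first by exists (size (redword v)).
rewrite /trace0 /= -inner_deltar (adj_sym adj) hecke_word_delta ?reduced_redword//.
by rewrite prod_redword inner_deltar.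
Qed.

(** * Averages of conjugates *)

Lemma parallelogram (f g : H) : l2norm g = l2norm f ->
  l2norm (f + g) ^+ 2 = 4 * l2norm f ^+ 2 - l2norm (g - f) ^+ 2.
Proof.
have := sqr_l2normD g f; have := sqr_l2normB g f; rewrite [g + f]addrC.
move: (l2norm (f + g)) (l2norm (g - f)) (l2norm f) (l2norm g) (complex.Re _) => x y z u v.
by move=> -> -> ->; ring.
Qed.

Lemma Yop_normE s f : l2norm (Yop s f) = Num.sqrt (Ksq s) * l2norm f.
Proof.
rewrite -[LHS](ger0_norm (l2norm_ge0 _)) -sqrtr_sqr (congr1 Num.sqrt (Yop_norm s f)).
by rewrite sqrtrM ?(ltW (Ksq_gt0 s))// sqrtr_sqr ger0_norm// l2norm_ge0.
Qed.

Definition conj_op (s : S) (T : op) : op := Kinv s *: (Yop s \o (T \o Yop s)).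

Lemma conj_opE s T f : conj_op s T f = Kinv s *: Yop s (T (Yop s f)).
Proof. by []. Qed.

Lemma conj_op_bounded_by s e T : bounded_by e T -> bounded_by e (conj_op s T).
Proof.
move=> eT f; rewrite conj_opE l2normZ normc_Kinv Yop_normE.
have K0 := Ksq_gt0 s; have h := eT (Yop s f); rewrite Yop_normE in h.
apply: (@le_trans _ _ ((Ksq s)^-1 * (Num.sqrt (Ksq s) * (e * (Num.sqrt (Ksq s) * l2norm f))))).
  by rewrite ler_wpM2l ?invr_ge0 ?(ltW K0)// ler_wpM2l ?sqrtr_ge0.
have -> : (Ksq s)^-1 * (Num.sqrt (Ksq s) * (e * (Num.sqrt (Ksq s) * l2norm f))) =
   (Ksq s)^-1 * Num.sqrt (Ksq s) ^+ 2 * (e * l2norm f) by ring.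
by rewrite sqr_sqrtr ?(ltW K0)// mulVf ?mul1r// gt_eqF.
Qed.

Lemma conj_op_lin s (a : C) T U : conj_op s (a *: T + U) = a *: conj_op s T + conj_op s U.
Proof.
apply/funext => f; rewrite -[RHS]/(a *: conj_op s T f + conj_op s U f) !conj_opE.
have -> : Yop s ((a *: T + U) (Yop s f)) = a *: Yop s (T (Yop s f)) + Yop s (U (Yop s f)).
  exact: op_lin (Yop_bounded s) _ _ _.
by rewrite scalerDr !scalerA [Kinv s * a]mulrC.
Qed.

Lemma conj_op_id s : conj_op s idfun = idfun.
Proof. by apply/funext => f; rewrite conj_opE /= YY scalerA KinvK scale1r. Qed.

Lemma Yop_poly s : hecke_poly 1 (Yop s).
Proof.
rewrite YopL; apply: HeckeLin; first by have := HeckeMulL s HeckeOne.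
by apply: hecke_polyZ; apply: HeckeWiden; exact: HeckeOne.
Qed.

Lemma conj_op_poly s d T : hecke_poly d T -> hecke_poly (d + 2) (conj_op s T).
Proof.
move=> pT; apply: hecke_polyZ.
have := hecke_poly_comp (Yop_poly s) (hecke_poly_comp pT (Yop_poly s)).
by rewrite add1n addn1 addn2.
Qed.

Lemma commutes_rightZ T t : bounded_op T -> commutes_right T ->
  T (Zop t (delta 1%g)) = Zop t (T (delta 1%g)).
Proof.
move=> bT cT; have E f : Zop t f = (2 : C) *: Rop t f + (- p t)%:C *: f by rewrite ZopR.
rewrite !E; have -> : T ((2 : C) *: Rop t (delta 1%g) + (- p t)%:C *: delta 1%g) =
  (2 : C) *: T (Rop t (delta 1%g)) + T ((- p t)%:C *: delta 1%g) by exact: op_lin bT _ _ _.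
by rewrite cT; congr (_ + _); exact: opZ bT _ _.
Qed.

Lemma Yop_delta1 s : Yop s (delta 1%g) = Zop s (delta 1%g).
Proof.
apply: l2_eq => v; rewrite YopE ZopE !l2deltaE.
have -> : (gen s * v == 1)%g = (v * gen s == 1)%g.
  apply/eqP/eqP => e; first by rewrite -[v](genK s) e mulg1 gen2.
  by rewrite -[v](genKr s) e mul1g gen2.
case: (eqVneq v 1%g) => [->|_]; last by rewrite !mulr0.
by rewrite /rdesc invg1.
Qed.

Lemma conj_op_vec s T : bounded_op T -> commutes_right T ->
  conj_op s T (delta 1%g) = conj_vec s (T (delta 1%g)).
Proof.
move=> bT cT; rewrite conj_opE conj_vecE; congr (_ *: Yop s _).
by rewrite Yop_delta1; exact: commutes_rightZ.
Qed.

Lemma conj_op_bounded s T : bounded_op T -> bounded_op (conj_op s T).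
Proof.
by move=> bT; apply: bounded_Z; apply: bounded_comp (Yop_bounded s) (bounded_comp bT (Yop_bounded s)).
Qed.

Lemma Yop_right s : commutes_right (Yop s).
Proof. exact: hecke_poly_right (Yop_poly s). Qed.

Lemma conj_op_right s T : commutes_right T -> commutes_right (conj_op s T).
Proof.
move=> cT t f; rewrite !conj_opE !Yop_right cT Yop_right.
by apply/esym; exact: opZ (Rop_bounded t) _ _.
Qed.

Definition conj_word_op (r : seq S) (T : op) : op := foldr conj_op T r.

Lemma conj_word_op_bounded_by r e T : bounded_by e T -> bounded_by e (conj_word_op r T).
Proof. by move=> eT; elim: r => //= s r; exact: conj_op_bounded_by. Qed.

Lemma conj_word_op_lin r (a : C) T U :
  conj_word_op r (a *: T + U) = a *: conj_word_op r T + conj_word_op r U.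
Proof. by elim: r => //= s r ->; exact: conj_op_lin. Qed.

Lemma conj_word_op_id r : conj_word_op r idfun = idfun.
Proof. by elim: r => //= s r ->; exact: conj_op_id. Qed.

Lemma conj_word_op_poly r d T : hecke_poly d T -> hecke_poly (d + 2 * size r) (conj_word_op r T).
Proof.
move=> pT; elim: r => [|s r IH]; first by rewrite muln0 addn0.
by have := conj_op_poly s IH; rewrite -addnA [(_ + 2)%N]addnC -mulnS.
Qed.

Lemma conj_word_op_bounded r T : bounded_op T -> bounded_op (conj_word_op r T).
Proof. by move=> bT; elim: r => //= s r; exact: conj_op_bounded. Qed.

Lemma conj_word_op_right r T : commutes_right T -> commutes_right (conj_word_op r T).
Proof. by move=> cT; elim: r => //= s r; exact: conj_op_right. Qed.

Lemma conj_word_op_vec r T : bounded_op T -> commutes_right T ->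
  conj_word_op r T (delta 1%g) = conj_word_vec r (T (delta 1%g)).
Proof.
move=> bT cT; elim: r => //= s r <-; apply: conj_op_vec.
  exact: conj_word_op_bounded.
exact: conj_word_op_right.
Qed.

Section Averaging.
Variables (a : bool -> 'I_3 -> seq S) (N : nat).
Hypothesis aN : forall b i, (size (a b i) <= N)%N.
Hypothesis gap : forall f : H, f 1%g = 0 ->
  l2norm f ^+ 2 <=
  40 * \sum_(j : bool * 'I_3) l2norm (conj_word_vec (a j.1 j.2) f - f) ^+ 2.

(** Six conjugations, each averaged with the identity: the identity terms turn the
    spectral gap, a lower bound on displacements, into a contraction. *)
Definition avg (T : op) : op :=
  (12^-1 : R)%:C *: \sum_(j : bool * 'I_3) (T + conj_word_op (a j.1 j.2) T).

Lemma avgE T f :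
  avg T f = (12^-1 : R)%:C *: \sum_(j : bool * 'I_3) (T f + conj_word_op (a j.1 j.2) T f).
Proof.
by rewrite -[LHS]/((12^-1 : R)%:C *:
  (\sum_(j : bool * 'I_3) (T + conj_word_op (a j.1 j.2) T)) f) sum_opE.
Qed.

Lemma avg_ind (P : op -> Prop) T :
  (forall (c : C) U V, P U -> P V -> P (c *: U + V)) ->
  (forall s U, P U -> P (conj_op s U)) -> P T -> P (avg T).
Proof.
move=> Plin Pconj PT.
have P0 : P 0 by have := Plin (-1) _ _ PT PT; rewrite scaleN1r addNr.
have PD U V : P U -> P V -> P (U + V) by rewrite -{2}[U]scale1r; exact: Plin.
rewrite -[avg T]addr0; apply: (Plin _ _ _ _ P0).
elim/big_rec: _ => // j U _ PU; apply: (PD _ _ _ PU); apply: (PD _ _ PT).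
by elim: (a _ _) => //= s r; exact: Pconj.
Qed.

Lemma avg_poly d T : hecke_poly d T -> hecke_poly (d + 2 * N) (avg T).
Proof.
move=> pT; apply: hecke_polyZ; elim/big_rec: _ => [|j U _ pU]; first exact: hecke_poly0.
apply: hecke_polyD pU; apply: hecke_polyD; first by apply: hecke_poly_widen pT; rewrite leq_addr.
apply: hecke_poly_widen (conj_word_op_poly _ pT).
by rewrite leq_add2l leq_mul2l aN orbT.
Qed.

Lemma avg_bounded T : bounded_op T -> bounded_op (avg T).
Proof. by move=> bT; apply: avg_ind bT; [exact: bounded_lin|exact: conj_op_bounded]. Qed.

Lemma commutes_right_lin (c : C) T U :
  commutes_right T -> commutes_right U -> commutes_right (c *: T + U).
Proof.
move=> cT cU t f; rewrite -[LHS]/(c *: T (Rop t f) + U (Rop t f)) cT cU.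
by apply/esym; exact: op_lin (Rop_bounded t) _ _ _.
Qed.

Lemma avg_right T : commutes_right T -> commutes_right (avg T).
Proof. by move=> cT; apply: avg_ind cT; [exact: commutes_right_lin|exact: conj_op_right]. Qed.

Lemma card_bool3 : #|{: bool * 'I_3}| = 6. Proof. by rewrite card_prod card_bool card_ord. Qed.

Lemma avg_lin (c : C) T U : avg (c *: T + U) = c *: avg T + avg U.
Proof.
rewrite /avg scalerA mulrC -scalerA -scalerDr; congr (_ *: _).
rewrite scaler_sumr -big_split; apply: eq_bigr => j _ /=.
by rewrite conj_word_op_lin scalerDr addrACA.
Qed.

Lemma mean_twelve (z : C) : (12^-1 : R)%:C * \sum_(j : bool * 'I_3) (z + z) = z.
Proof.
have -> : \sum_(j : bool * 'I_3) (z + z) = 12%:R * z.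
  by rewrite sumr_const card_bool3 -mulr2n -mulrnA mulr_natl.
by rewrite mulrA -(rmorph_nat (real_complex R)) -realcM mulVf ?mul1r.
Qed.

Lemma avg_id : avg idfun = idfun.
Proof.
apply/funext => f; apply: l2_eq => v; rewrite -[RHS](mean_twelve (f v)).
rewrite /avg; under eq_bigr do rewrite conj_word_op_id.
rewrite -[LHS]/((12^-1 : R)%:C * (\sum_(j : bool * 'I_3) (idfun + idfun : op)) f v).
by rewrite sum_opE l2_sum.
Qed.

Lemma avg_bounded_by e T : 0 <= e -> bounded_by e T -> bounded_by e (avg T).
Proof.
move=> e0 eT f.
rewrite avgE l2normZ normc_real ger0_norm// mulrC ler_pdivrMr//.
apply: le_trans (l2norm_sum _ _ _) _.
apply: (@le_trans _ _ (\sum_(j : bool * 'I_3) (2 * (e * l2norm f)))).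
  apply: ler_sum => j _; apply: le_trans (l2normD _ _) _.
  by rewrite mulr2n mulrDl mul1r; apply: lerD (eT f) _; exact: conj_word_op_bounded_by.
rewrite mulr_sumr_six le_eqVlt; apply/orP; left; apply/eqP; ring.
Qed.

Lemma avg_vec T : bounded_op T -> commutes_right T ->
  avg T (delta 1%g) = (12^-1 : R)%:C *:
    \sum_(j : bool * 'I_3) (T (delta 1%g) + conj_word_vec (a j.1 j.2) (T (delta 1%g))).
Proof.
move=> bT cT; rewrite avgE; congr (_ *: _); apply: eq_bigr => j _.
by rewrite -(conj_word_op_vec _ bT cT).
Qed.

Lemma avg_vec1 T : bounded_op T -> commutes_right T -> avg T (delta 1%g) 1%g = T (delta 1%g) 1%g.
Proof.
move=> bT cT; rewrite avg_vec// l2Z l2_sum.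
under eq_bigr do rewrite l2D conj_word_vec1.
exact: mean_twelve.
Qed.

(** By the parallelogram law the norm of [x + u x] falls short of [2 * |x|] by the
    displacement [u x - x], and the gap bounds the displacements below. *)
Lemma avg_contracts T : bounded_op T -> commutes_right T -> T (delta 1%g) 1%g = 0 ->
  l2norm (avg T (delta 1%g)) ^+ 2 <= rate R * l2norm (T (delta 1%g)) ^+ 2.
Proof.
move=> bT cT; rewrite avg_vec//; set x := T (delta 1%g) => x1.
have g := gap x1.
rewrite l2normZ normc_real ger0_norm// exprMn.
have sq j : l2norm (x + conj_word_vec (a j.1 j.2) x) ^+ 2 =
    4 * l2norm x ^+ 2 - l2norm (conj_word_vec (a j.1 j.2) x - x) ^+ 2.
  by apply: parallelogram; exact: conj_word_vec_norm.
have sqs : \sum_(j : bool * 'I_3) l2norm (x + conj_word_vec (a j.1 j.2) x) ^+ 2 =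
    6 * (4 * l2norm x ^+ 2) -
    \sum_(j : bool * 'I_3) l2norm (conj_word_vec (a j.1 j.2) x - x) ^+ 2.
  by rewrite (eq_bigr _ (fun j _ => sq j)) sumrB mulr_sumr_six.
apply: avg_arith g _; rewrite -sqs.
apply: (@le_trans _ _ ((\sum_(j : bool * 'I_3) l2norm (x + conj_word_vec (a j.1 j.2) x)) ^+ 2)).
  by rewrite lerXn2r ?nnegrE ?l2norm_ge0 ?sumr_ge0 ?l2norm_sum// => j _; exact: l2norm_ge0.
have := sqr_sum_le (index_enum (bool * 'I_3)%type)
  (fun j => l2norm (x + conj_word_vec (a j.1 j.2) x)).
by rewrite (_ : size _ = 6)// -card_bool3 -sum1_size sum1_card.
Qed.

Lemma iter_avg_bounded k T : bounded_op T -> bounded_op (iter k avg T).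
Proof. by move=> bT; elim: k => //= k; exact: avg_bounded. Qed.

Lemma iter_avg_right k T : commutes_right T -> commutes_right (iter k avg T).
Proof. by move=> cT; elim: k => //= k; exact: avg_right. Qed.

Lemma iter_avg_vec1 k T : bounded_op T -> commutes_right T ->
  iter k avg T (delta 1%g) 1%g = T (delta 1%g) 1%g.
Proof.
move=> bT cT; elim: k => //= k <-; apply: avg_vec1; first exact: iter_avg_bounded.
exact: iter_avg_right.
Qed.

Lemma iter_avg_lin k (c : C) T U : iter k avg (c *: T + U) = c *: iter k avg T + iter k avg U.
Proof. by elim: k => //= k ->; exact: avg_lin. Qed.

Lemma iter_avg_id k : iter k avg idfun = idfun.
Proof. by elim: k => //= k ->; exact: avg_id. Qed.

Lemma iter_avg_bounded_by k e T : 0 <= e -> bounded_by e T -> bounded_by e (iter k avg T).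
Proof. by move=> e0 eT; elim: k => //= k; exact: avg_bounded_by. Qed.

Lemma iter_avg_poly k d T : hecke_poly d T -> hecke_poly (d + 2 * N * k) (iter k avg T).
Proof.
move=> pT; elim: k => [|k IH]; first by rewrite muln0 addn0.
by rewrite mulnS [(2 * N + _)%N]addnC addnA /=; exact: avg_poly.
Qed.

Lemma iter_avg_contracts k T : bounded_op T -> commutes_right T -> T (delta 1%g) 1%g = 0 ->
  l2norm (iter k avg T (delta 1%g)) ^+ 2 <= rate R ^+ k * l2norm (T (delta 1%g)) ^+ 2.
Proof.
move=> bT cT T1; elim: k => [|k IH]; first by rewrite expr0 mul1r.
have h : l2norm (iter k.+1 avg T (delta 1%g)) ^+ 2 <=
    rate R * l2norm (iter k avg T (delta 1%g)) ^+ 2.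
  apply: avg_contracts; first exact: iter_avg_bounded.
    exact: iter_avg_right.
  by rewrite iter_avg_vec1.
apply: le_trans h _; rewrite [rate R ^+ _]exprS -mulrA; apply: ler_wpM2l IH.
exact: ltW (rate_gt0 R).
Qed.

(** After [k] averages the degree is linear in [k], so the rapid decay constant
    grows polynomially, against the exponential decay of the 2-norm. *)
Lemma averages_vanish d T (e : R) : hecke_poly d T -> T (delta 1%g) 1%g = 0 -> 0 < e ->
  exists k, bounded_by e (iter k avg T).
Proof.
move=> pT T1 e0; have bT := hecke_poly_bounded pT; have cT := hecke_poly_right pT.
have [k hk] := poly_geometric (#|S| * 3 * 2) (d.+1 + 2 * N) (rate_gt0 R) (rate_lt1 R)
  (sqr_ge0 (l2norm (T (delta 1%g)))) (exprn_gt0 2 e0).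
exists k; apply: bounded_by_le (rapid_decay (iter_avg_poly k pT)).
rewrite -(@ler_pXn2r _ 2) ?nnegrE ?mulr_ge0 ?l2norm_ge0 ?(ltW e0)// ?ler0n//.
rewrite exprMn; apply: le_trans hk; rewrite -mulrA.
apply: ler_pM; rewrite ?sqr_ge0//; last exact: iter_avg_contracts.
rewrite /decay_bound -natrX ler_nat -!expnM mulnA.
have le : ((d + 2 * N * k).+1 <= (d.+1 + 2 * N) * k.+1)%N by nia.
by case: (#|S| * 3 * 2)%N => // n; rewrite leq_exp2r.
Qed.

Lemma hecke_cstar_conj s T : A T -> A (conj_op s T).
Proof.
have AY := hecke_poly_cstar (Yop_poly s); have cA := hecke_cstarP.
move=> AT; apply: (cstarZ cA); apply: (cstar_mul cA) => //.
exact: (cstar_mul cA).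
Qed.

Lemma hecke_cstar_avg T : A T -> A (avg T).
Proof.
have cA := hecke_cstarP; move=> AT.
by apply: avg_ind AT; [exact: (cstar_lin cA)|exact: hecke_cstar_conj].
Qed.

Lemma hecke_cstar_iter k T : A T -> A (iter k avg T).
Proof. by move=> AT; elim: k => //= k; exact: hecke_cstar_avg. Qed.

(** * Averages converge to the trace *)

Lemma iter_avgB k T U : iter k avg (T - U) = iter k avg T - iter k avg U.
Proof. by rewrite addrC -scaleN1r iter_avg_lin scaleN1r addrC. Qed.

(** Averaging is norm-nonincreasing, so it suffices to approximate [T] by a
    polynomial and subtract its trace. *)
Lemma averages_converge T (e : R) : A T -> 0 < e ->
  exists k, bounded_by e (iter k avg T - trace0 T *: idfun).
Proof.
move=> AT e0; have [bT h] := hecke_cstar_approx AT.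
have d0 : 0 < e / 3 by rewrite divr_gt0.
have [U [d pU] hU] := h _ d0.
pose U0 : op := (- trace0 U) *: idfun + U.
have pU0 : hecke_poly d U0.
  by apply: HeckeLin pU; exact: (hecke_poly_widen (leq0n d) HeckeOne).
have U01 : U0 (delta 1%g) 1%g = 0.
  rewrite -[LHS]/(- trace0 U * delta 1%g 1%g + trace0 U) l2deltaE eqxx mulr1.
  by rewrite addNr.
have [k hk] := averages_vanish pU0 U01 d0; exists k.
have -> : iter k avg T - trace0 T *: idfun =
    iter k avg (T - U) + (iter k avg U0 + trace0 (U - T) *: idfun).
  rewrite iter_avgB iter_avg_lin iter_avg_id trace0B scalerBl scaleNr.
  move: (iter k avg T) (iter k avg U) (trace0 U *: idfun) (trace0 T *: idfun) => X Y x y.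
  by rewrite [- x + Y]addrC [Y - x + _]addrA subrK addrA subrK.
have tr : bounded_by (e / 3) (trace0 (U - T) *: (idfun : op)).
  move=> f; rewrite [l2norm _]l2normZ ler_wpM2r ?l2norm_ge0//.
  apply: trace0_bounded_by => g; rewrite -opprB.
  by rewrite [l2norm _]l2normN; exact: hU.
have := bounded_byD (iter_avg_bounded_by k (ltW d0) hU) (bounded_byD hk tr).
have -> // : e / 3 + (e / 3 + e / 3) = e by field.
Qed.

(** * Simplicity and uniqueness of the trace *)

(** Ideals are stable under averaging: one that contains [T] contains the limit
    [trace0 (V \o T)] of the averages of [V \o T], an invertible scalar for
    some [V]. *)
Lemma hecke_cstar_simple : simple_cstar A.
Proof.
move=> I cI; have cA := hecke_cstarP.
have IZ (c : C) T : I T -> I (c *: T).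
  by move=> IT; rewrite -[_ *: _]addr0; apply: (ideal_lin cI) IT (ideal_zero cI).
have [[T [IT T0]]|h] := pselect (exists T, I T /\ T <> 0); last first.
  left; apply/seteqP; split=> T /=; last by move=> ->; exact: (ideal_zero cI).
  by move=> IT; apply: contrapT => T0; apply: h; exists T.
right; apply/seteqP; split; first exact: (ideal_sub cI).
have [V [d pV] t0] := trace0_detects (ideal_sub cI IT) T0.
have AV := hecke_poly_cstar pV.
have IVT : I (V \o T) by exact: (ideal_mull cI).
have Iavg U : I U -> I (avg U).
  move=> IU; apply: avg_ind IU; first exact: (ideal_lin cI).
  move=> s X IX; apply: IZ; have AY := hecke_poly_cstar (Yop_poly s).
  by apply: (ideal_mull cI AY); exact: (ideal_mulr cI).
have Iscal : I (trace0 (V \o T) *: idfun).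
  apply: (ideal_closed cI); first by apply: (cstarZ cA); exact: (cstar_unit cA).
  apply/op_closureP.
  - by apply: bounded_Z; exact: bounded_id.
  - by move=> X /(ideal_sub cI); exact: hecke_cstar_bounded.
  move=> e e0; have [k hk] := averages_converge (ideal_sub cI IVT) e0.
  exists (iter k avg (V \o T)); first by elim: k {hk} => //= k; exact: Iavg.
  by rewrite -opprB => f; rewrite [l2norm _]l2normN; exact: hk.
have I1 : I idfun.
  have := IZ (trace0 (V \o T))^-1 _ Iscal.
  by rewrite scalerA mulVf ?scale1r//; apply/eqP.
by move=> X AX; have := ideal_mull cI AX I1.
Qed.

Section UniqueTrace.
Variable tau : op -> C.
Hypothesis tauP : tracial_state A tau.

Lemma tau_sum (I : Type) (r : seq I) (F : I -> op) : (forall i, A (F i)) ->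
  A (\sum_(i <- r) F i) /\ tau (\sum_(i <- r) F i) = \sum_(i <- r) tau (F i).
Proof.
have cA := hecke_cstarP; move=> AF.
have tD T U : A T -> A U -> tau (T + U) = tau T + tau U.
  by move=> AT AU; rewrite -[T]scale1r (state_lin tauP)// mul1r scale1r.
have t0 : tau 0 = 0.
  have := tD _ _ (cstar0 cA) (cstar0 cA); rewrite addr0 => /eqP.
  by rewrite -subr_eq0 opprD addrA subrr sub0r oppr_eq0 => /eqP.
elim: r => [|i r [Ar tr]]; first by rewrite !big_nil; split=> //; exact: cstar0 cA.
by rewrite !big_cons tD// tr; split=> //; exact: (cstarD cA).
Qed.

Lemma tau_conj s T : A T -> tau (conj_op s T) = tau T.
Proof.
have cA := hecke_cstarP; have AY := hecke_poly_cstar (Yop_poly s); move=> AT.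
have -> : conj_op s T = Yop s \o (Kinv s *: (T \o Yop s)).
  apply/funext => f; apply/esym; exact: opZ (Yop_bounded s) _ _.
rewrite (state_trace tauP)//; last first.
  by apply: (cstarZ cA); exact: (cstar_mul cA).
congr tau; apply/funext => f.
rewrite -[LHS]/(Kinv s *: T (Yop s (Yop s f))) YY (opZ (hecke_cstar_bounded AT)).
by rewrite scalerA KinvK scale1r.
Qed.

Lemma tau_avg T : A T -> tau (avg T) = tau T.
Proof.
have cA := hecke_cstarP; move=> AT.
have Ac r : A (conj_word_op r T) by elim: r => //= s r; exact: hecke_cstar_conj.
have tc r : tau (conj_word_op r T) = tau T.
  by elim: r => //= s r <-; exact: tau_conj (Ac r).
have AF (j : bool * 'I_3) : A (T + conj_word_op (a j.1 j.2) T) by exact: (cstarD cA).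
have [As ts] := tau_sum (index_enum (bool * 'I_3)%type) AF.
have -> : tau (avg T) = (12^-1 : R)%:C * \sum_(j : bool * 'I_3) (tau T + tau T).
  rewrite -[avg T]addr0 (state_lin tauP _ As (cstar0 cA)) ts.
  have -> : tau 0 = 0 by have [_] := @tau_sum nat [::] (fun=> 0) (fun=> cstar0 cA); rewrite !big_nil.
  rewrite addr0; congr (_ * _); apply: eq_bigr => j _.
  by rewrite -{1}[T]scale1r (state_lin tauP _ AT (Ac _)) mul1r tc.
exact: mean_twelve.
Qed.

(** A tracial state is invariant under averaging and norm-continuous. *)
Lemma trace_unique T : A T -> tau T = trace0 T.
Proof.
have cA := hecke_cstarP; move=> AT.
apply/eqP; rewrite -subr_eq0; apply/eqP; apply: normc_small => e e0.
have d0 : 0 < e / 4 by rewrite divr_gt0.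
have [k hk] := averages_converge AT d0.
have Ak := hecke_cstar_iter k AT.
have tk : tau (iter k avg T) = tau T.
  by elim: k {hk Ak} => //= k <-; apply: tau_avg; exact: hecke_cstar_iter.
set D := iter k avg T - trace0 T *: idfun in hk.
have DE : D = (- trace0 T) *: idfun + iter k avg T by rewrite /D addrC scaleNr.
have AD : A D by rewrite DE; apply: (cstar_lin cA) => //; exact: (cstar_unit cA).
have tD : tau D = tau T - trace0 T.
  by rewrite DE (state_lin tauP _ (cstar_unit cA) Ak) (state_unit tauP) mulr1 tk addrC.
have [D' AD' adj] := hecke_cstar_adjoint AD.
have := state_bound cA tauP d0 AD AD' adj hk; rewrite tD.
by have -> // : 4 * (e / 4) = e by field.
Qed.

End UniqueTrace.

Theorem simple_unique_trace : simple_cstar A /\ unique_tracial_state A.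
Proof.
split; first exact: hecke_cstar_simple.
split; first by exists trace0; exact: trace0_state.
by move=> tau tau' h h' T AT; rewrite (trace_unique h AT) (trace_unique h' AT).
Qed.

End Averaging.

End HeckeOperators.

(** * Conclusion *)

Lemma hecke_p_le (R : realType) (x : R) : `|x - 1| <= 2^-1 ->
  `|(Num.sqrt x)^-1 * (x - 1)| <= 2 * `|x - 1|.
Proof.
move=> h; rewrite normrM ler_wpM2r//.
have x2 : 4^-1 <= x by move: h; rewrite ler_distl; lra.
have s2 : 2^-1 <= Num.sqrt x.
  have -> : 2^-1 = Num.sqrt (4^-1 : R).
    have -> : 4^-1 = 2^-1 ^+ 2 :> R by field.
    by rewrite sqrtr_sqr ger0_norm.
  by rewrite ler_wsqrtr.
rewrite ger0_norm ?invr_ge0 ?sqrtr_ge0// -[leRHS]invrK lef_pV2// posrE ?invr_gt0//.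
by apply: lt_le_trans s2; rewrite invr_gt0.
Qed.

Lemma uniform_parameters (R : realType) : exists2 eta : R, 0 < eta &
  forall q : S -> R, (forall s, `|q s - 1| < eta) ->
    simple_cstar (hecke_cstar gen q) /\ unique_tracial_state (hecke_cstar gen q).
Proof.
have [s [t [a [E [st E_disj aE]]]]] := spreading.
pose N := \max_(j : bool * 'I_3) size (a j.1 j.2).
have aN b i : (size (a b i) <= N)%N.
  exact: (@leq_bigmax _ (fun j : bool * 'I_3 => size (a j.1 j.2)) (b, i)).
(* At most [2 * eta] in modulus, each [p_s] then satisfies [32 * N * |p_s| <= 1]. *)
pose eta : R := (64 * N.+1)%:R^-1; have eta0 : 0 < eta by rewrite invr_gt0 ltr0n.
exists eta => // q qeta.
have p_small r : `|hecke_p q r| <= 2 * eta.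
  apply: le_trans (hecke_p_le _) _; last by rewrite ler_wpM2l// ltW.
  rewrite (le_trans (ltW (qeta r)))// lef_pV2 ?posrE ?ltr0n//.
  by rewrite ler_nat; nia.
have eta64 : 64 * N.+1%:R * eta = 1.
  by rewrite -natrM mulfV// pnatr_eq0.
have p_le1 r : `|hecke_p q r| <= 1.
  apply: le_trans (p_small r) _; rewrite -[leRHS]eta64 ler_wpM2r ?(ltW eta0)//.
  by rewrite -natrM ler_nat; nia.
apply: (simple_unique_trace p_le1 aN).
apply: (conj_gap p_le1 st E_disj aE aN) => r.
apply: (@le_trans _ _ (32 * N%:R * (2 * eta))).
  by rewrite ler_wpM2l.
rewrite -[leRHS]eta64 mulrA ler_wpM2r ?(ltW eta0)// mulrAC -natrM -!natrM ler_nat.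
by nia.
Qed.

End RightAngled.

Local Close Scope complex_scope.

Lemma open_box (R : realType) (S : finType) (eta : R) :
  open [set q : {ptws S -> R} | forall s, `|q s - 1| < eta].
Proof.
rewrite openE => q qeta.
apply: (@filter_forall _ S (fun s => [set x : {ptws S -> R} | `|x s - 1| < eta]) (nbhs q)) => s.
have op : open ((fun q : {ptws S -> R} => q s) @^-1` [set x : R | `|x - 1| < eta]).
  apply: open_comp; first by move=> x _; exact: proj_continuous.
  have -> : [set x : R | `|x - 1| < eta] = ball (1 : R) eta.
    by apply/seteqP; split=> x /=; rewrite /ball /= distrC.
  exact: ball_open.
by apply: open_nbhs_nbhs; split => //; exact: qeta.
Qed.

Theorem theorem5p7 (R : realType) (W : groupType) (S : finType) (gen : S -> W)
    (m : S -> S -> option nat) :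
  coxeter_system gen m -> right_angled m -> coxeter_irreducible m ->
  (3 <= #|S|)%N ->
  exists U : set {ptws S -> R},
    [/\ U `<=` hecke_params gen,
        open (U : set (subspace (hecke_params (R := R) gen))),
        U (fun=> 1) &
        forall q, U q ->
          simple_cstar (hecke_cstar gen q) /\
          unique_tracial_state (hecke_cstar gen q)].
Proof.
move=> cox ra irr S3.
have [eta eta0 h] := uniform_parameters cox ra irr S3 R.
exists ([set q | forall s, `|q s - 1| < eta] `&` hecke_params gen); split.
- by move=> q [].
- apply/open_subspaceP; exists [set q | forall s, `|q s - 1| < eta]; first exact: open_box.
  by rewrite -setIA setIid.
- by split=> [s|]; [rewrite subrr normr0|split].
- by move=> q [/h].
Qed.
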